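(* Let $X=\mathbb{R}\times(0,\infty)$, let $\sigma(T(x,s))=s$ on the collection of tents $T(x,s)$, $(x,s)\in X$, and let $S_2,S_\infty$ be the sizes defined in the context. Let $\phi$ be a smooth function on the real line supported in $[-1,1]$, and for a locally integrable function $f$ on $\mathbb{R}$ set $$F_\phi(f)(y,t):=\int_{\mathbb{R}} f(x)\,t^{-1}\overline{\phi(t^{-1}(y-x))}\,dx,\qquad (y,t)\in X .$$ Let $1<p\le\infty$. Then there is a constant $C_{p,\phi}$ depending only on $p$ and $\phi$ such that for all $f\in L^p(\mathbb{R})$ $$\|F_\phi(f)\|_{L^p(X,\sigma,S_\infty)}\le C_{p,\phi}\|f\|_p .$$ If in addition $\int\phi=0$, then $$\|F_\phi(f)\|_{L^p(X,\sigma,S_2)}\le C_{p,\phi}\|f\|_p .$$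
   Context: $\|f\|_p$ is the classical $L^p(\mathbb{R})$ norm. Tents and sizes: for $(x,s)\in X=\mathbb{R}\times(0,\infty)$, $T(x,s)=\{(y,t)\in\mathbb{R}\times(0,\infty): t<s,\ |x-y|<s-t\}$; $\mathbf{E}$ is the collection of all such tents, and $\sigma(T(x,s))=s$. For Borel measurable $F$ on $X$, $$S_2(F)(T(x,s)):=\Big(s^{-1}\int_{T(x,s)}|F(y,t)|^2\,dy\,\frac{dt}{t}\Big)^{1/2},\qquad S_\infty(F)(T(x,s)):=\sup_{(y,t)\in T(x,s)}|F(y,t)| .$$ Outer measure: for $A\subset X$, $\mu(A)=\inf\sum_{E'\in\mathbf{E}'}\sigma(E')$, the infimum being over all countable subcollections $\mathbf{E}'\subset\mathbf{E}$ covering $A$ (empty sum $=0$, infimum of the empty set $=\infty$). Outer $L^p$ for a size $S$: for a Borel set $A\subset X$, $\operatorname{outsup}_A S(F):=\sup_{E\in\mathbf{E}}S(F1_A)(E)$. For $\lambda>0$ the super level measure $\mu(S(F)>\lambda)$ is the infimum of $\mu(A)$ over all Borel sets $A\subset X$ with $\operatorname{outsup}_{X\setminus A}S(F)\le\lambda$. Then $\|F\|_{L^\infty(X,\sigma,S)}:=\sup_{E\in\mathbf{E}}S(F)(E)$ and, for $0<p<\infty$, $\|F\|_{L^p(X,\sigma,S)}:=\big(\int_0^\infty p\lambda^{p-1}\mu(S(F)>\lambda)\,d\lambda\big)^{1/p}$. *)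

(* Defs.v *)
From HB Require Import structures.
From mathcomp Require Import all_boot all_order all_algebra.
From mathcomp Require Import all_classical all_reals all_analysis.
From mathcomp Require Import complex.

Set Implicit Arguments.
Unset Strict Implicit.
Unset Printing Implicit Defensive.

Import Order.TTheory GRing.Theory Num.Theory.
Import numFieldNormedType.Exports.
Import ComplexField.Normc.

Local Open Scope classical_set_scope.
Local Open Scope ring_scope.
Local Open Scope complex_scope.

(* R * R with the Borel (product) sigma-algebra; the half plane X is a subset
   of it, and functions on X are total functions of which only the values on X
   matter, since every tent lies in X. *)
Notation plane R := (measurableTypeR R * measurableTypeR R)%type.

Definition halfplane (R : realType) : set (plane R) := [set q | 0 < q.2].
Arguments halfplane : clear implicits.

(* Tents are indexed by their apex; the apex is determined by the tent, so
   collections of tents are the same as sets of apexes in X. *)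
Definition tent (R : realType) (q : plane R) : set (plane R) :=
  [set w | [/\ 0 < w.2, w.2 < q.2 & `|q.1 - w.1| < q.2 - w.2]].

Definition sigma (R : realType) (q : plane R) : \bar R := (q.2)%:E.

Definition size2 (R : realType) (F : plane R -> R[i]) (q : plane R) : \bar R :=
  (((q.2)^-1%:E *
    \int[lebesgue_measure \x lebesgue_measure]_(w in tent q)
      (normc (F w) ^+ 2 / w.2)%:E) `^ 2^-1)%E.

Definition sizeoo (R : realType) (F : plane R -> R[i]) (q : plane R) : \bar R :=
  ereal_sup [set (normc (F w))%:E | w in tent q].

Definition outer_mu (R : realType) (A : set (plane R)) : \bar R :=
  ereal_inf [set \esum_(q in D) sigma q | D in
    [set D : set (plane R) | [/\ D `<=` halfplane R, countable D &
                                 A `<=` \bigcup_(q in D) tent q]]].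

Section outer_Lp.
Context (R : realType).
(* S F q is the size of F on the tent with apex q *)
Variable S : (plane R -> R[i]) -> plane R -> \bar R.
Implicit Types (F : plane R -> R[i]) (A : set (plane R)).

Definition outsup A F : \bar R :=
  ereal_sup [set S (fun w => F w * (\1_A w)%:C) q | q in halfplane R].

Definition super_level F (l : R) : \bar R :=
  ereal_inf [set outer_mu A | A in
    [set A | [/\ measurable A, A `<=` halfplane R &
                 (outsup (halfplane R `\` A) F <= l%:E)%E]]].

(* The value at -oo is irrelevant. *)
Definition outer_Lnorm (p : \bar R) F : \bar R :=
  match p with
  | p%:E => ((\int[lebesgue_measure]_(l in `]0%R, +oo[)
                ((p * l `^ (p - 1))%:E * super_level F l)) `^ p^-1)%E
  | +oo%E => ereal_sup [set S F q | q in halfplane R]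
  | -oo%E => 0%E
  end.

End outer_Lp.

Definition cintegral (R : realType) (f : measurableTypeR R -> R[i]) : R[i] :=
  (\int[lebesgue_measure]_x complex.Re (f x)) +i*
  (\int[lebesgue_measure]_x complex.Im (f x)).

Definition cmeasurable (R : realType) (f : measurableTypeR R -> R[i]) : Prop :=
  measurable_fun setT (fun x => complex.Re (f x)) /\
  measurable_fun setT (fun x => complex.Im (f x)).

Definition cLnorm (R : realType) (p : \bar R)
    (f : measurableTypeR R -> R[i]) : \bar R :=
  Lnorm lebesgue_measure p (fun x => (normc (f x))%:E).

(* Elements of L^p are given by Borel representatives. *)
Definition in_Lp (R : realType) (p : \bar R)
    (f : measurableTypeR R -> R[i]) : Prop :=
  cmeasurable f /\ (cLnorm p f < +oo)%E.

Definition csmooth (R : realType) (phi : R -> R[i]) : Prop :=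
  forall (n : nat) (x : R),
    derivable (derive1n n (fun u => complex.Re (phi u))) x 1 /\
    derivable (derive1n n (fun u => complex.Im (phi u))) x 1.

Definition Fphi (R : realType) (phi : R -> R[i])
    (f : measurableTypeR R -> R[i]) (w : plane R) : R[i] :=
  cintegral (fun x => f x * (w.2^-1)%:C * conjc (phi (w.2^-1 * (w.1 - x)))).

(* Main.v *)
(* The exceptional set at level lam is a union A of tents over a Vitali subfamily of
   the balls of radius r on which the integral of |f| exceeds lam * r, so that mu(A)
   is at most (12 / lam) times the integral of |f| over {|f| > lam / 4}. At points
   (y, t) outside A all balls of radius r >= t about y satisfy the opposite
   inequality. This gives |F_phi f| <= C lam there, which is the bound for S_oo.
   For S_2, f is replaced on a tent by its average at a variable scale delta
   comparable to the height of the region outside A: the average is bounded by C lam,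
   hence handled by the L^2 square function estimate (T T^* and Schur's test, which
   use the mean zero of phi), and the difference is controlled pointwise by the
   Lipschitz norm of phi and delta. Both sizes thus have the same exceptional sets,
   and integrating the bound for mu(A) in the level (Tonelli) gives the L^p estimate,
   while for p = oo the set A is empty at level 2 ||f||_oo. *)
Require Import Defs.
From HB Require Import structures.
From mathcomp Require Import all_boot all_order all_algebra.
From mathcomp Require Import all_classical all_reals all_analysis.
From mathcomp Require Import complex finmap.
From mathcomp Require Import measurable_realfun ess_sup_inf ring lra.
Import Order.TTheory GRing.Theory Num.Theory.
Import numFieldNormedType.Exports.
Import ComplexField.Normc.
Local Open Scope classical_set_scope.
Local Open Scope ring_scope.

Set Implicit Arguments.
Unset Strict Implicit.
Unset Printing Implicit Defensive.

(** A general f in L^p is unbounded, and off the exceptional set its averages are controlled only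
    down to the height of that set. The L^2 estimate, which needs a function of size lam, therefore
    cannot be applied to f, nor to an average of f at one fixed scale. A 1/2-Lipschitz scale is
    comparable at any two points within one averaging radius; this is what bounds the average. The
    error made at a point of the tent has both a pointwise bound C lam and an integral bound C lam
    s, and the product of the two controls its square integral. No maximal function and no second
    exceptional set enter.

    All of this is done at heights at least eps. There the double integrals converge absolutely, the
    scale is positive, and the quantity to be absorbed in the T T^* argument is finite. The
    constants do not depend on eps, which is removed at the end by monotone convergence. Complex
    values enter last, through four real convolutions. *)

Notation integ m f := (m.-integrable setT (EFin \o f)).

(** * Integrability and Fubini for real-valued integrands *)

Lemma integ_dom d (T : measurableType d) (R : realType)
    (m : {measure set T -> \bar R}) (f g : T -> R) :
  measurable_fun setT f -> integ m g -> (forall x, `|f x| <= g x) -> integ m f.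
Proof.
move=> mf ig fg; apply: (le_integrable measurableT _ _ ig).
  exact/measurable_EFinP.
by move=> x _ /=; rewrite lee_fin (le_trans (fg x))// ler_norm.
Qed.

Lemma integ_measurable d (T : measurableType d) (R : realType)
    (m : {measure set T -> \bar R}) (f : T -> R) :
  integ m f -> measurable_fun setT f.
Proof. by move=> /measurable_int /measurable_EFinP. Qed.

Section integ_ops.
Context d (T : measurableType d) (R : realType).
Variable m : {measure set T -> \bar R}.
Implicit Types f g : T -> R.

Lemma integ_norm f : integ m f -> integ m (fun x => `|f x|).
Proof. exact: integrable_norm. Qed.

Lemma integZl k f : integ m f -> integ m (fun x => k * f x).
Proof.
move=> /(integrableZl measurableT k); by apply: eq_integrable.
Qed.

Lemma integZr k f : integ m f -> integ m (fun x => f x * k).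
Proof.
move=> /(integrableZr measurableT k); by apply: eq_integrable.
Qed.

Lemma integD f g : integ m f -> integ m g -> integ m (fun x => f x + g x).
Proof.
move=> /(integrableD measurableT) fg /fg; by apply: eq_integrable.
Qed.

Lemma integB f g : integ m f -> integ m g -> integ m (fun x => f x - g x).
Proof.
move=> /(integrableB measurableT) fg /fg; by apply: eq_integrable.
Qed.

End integ_ops.

Lemma le_norm_Rintegral d (T : measurableType d) (R : realType)
    (m : {measure set T -> \bar R}) (f g : T -> R) :
  measurable_fun setT f -> integ m g -> (forall x, `|f x| <= g x) ->
  `|\int[m]_x f x| <= \int[m]_x g x.
Proof.
move=> mf ig fg; have iF := integ_dom mf ig fg.
apply: (le_trans (le_normr_Rintegral measurableT iF)).
apply: le_Rintegral => //; apply: integ_dom ig _ => //.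
  exact: measurableT_comp.
by move=> x; rewrite normr_id.
Qed.

(** Tonelli measurability applies to the positive and negative parts separately, so no integrability
    of [H] is assumed; sections that are not integrable still receive measurable values through
    [fine]. *)
Lemma measurable_Rintegral d1 d2 (T1 : measurableType d1)
    (T2 : measurableType d2) (R : realType)
    (m2 : {sigma_finite_measure set T2 -> \bar R}) (H : T1 * T2 -> R) :
  measurable_fun setT H ->
  measurable_fun setT (fun a => \int[m2]_b H (a, b)).
Proof.
move=> mH; rewrite /Rintegral.
have mEH : measurable_fun setT (EFin \o H) by exact/measurable_EFinP.
apply: (@measurableT_comp _ _ _ _ _ _ (@fine R)); first exact: fine_measurable.
rewrite [X in measurable_fun _ X](_ : _ =
    ((fun a => \int[m2]_b (EFin \o H)^\+ (a, b)) \-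
    (fun a => \int[m2]_b (EFin \o H)^\- (a, b)))%E); last first.
  apply/funext => a; rewrite integralE.
  by congr (_ - _)%E; apply: eq_integral => b _; rewrite (funepos.unlock, funeneg.unlock).
apply: emeasurable_funB.
- apply: measurable_fun_fubini_tonelli_F => //.
  exact: measurable_funepos.
- apply: measurable_fun_fubini_tonelli_F => //.
  exact: measurable_funeneg.
Qed.

Section swap.
Context d1 d2 (T1 : measurableType d1) (T2 : measurableType d2) (R : realType).
Variables (m1 : {sigma_finite_measure set T1 -> \bar R}).
Variables (m2 : {sigma_finite_measure set T2 -> \bar R}).
Variables (H : T1 -> T2 -> R) (u : T1 -> R) (v : T2 -> R).
Hypothesis mH : measurable_fun setT (fun z => H z.1 z.2).
Hypotheses (iu : integ m1 u) (iv : integ m2 v).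
Hypothesis Huv : forall a b, `|H a b| <= u a * v b.

Lemma integ_section1 a : integ m2 (H a).
Proof.
apply: (@integ_dom _ _ _ _ _ (fun b => u a * v b)) => //.
- exact: (measurableT_comp mH (pair1_measurable a)).
- exact: integZl.
Qed.

Lemma integ_section2 b : integ m1 (H ^~ b).
Proof.
apply: (@integ_dom _ _ _ _ _ (fun a => u a * v b)) => //.
- exact: (measurableT_comp mH (pair2_measurable b)).
- exact: integZr.
Qed.

Lemma integ_Rintegral1 : integ m1 (fun a => \int[m2]_b H a b).
Proof.
apply: (@integ_dom _ _ _ _ _ (fun a => u a * \int[m2]_b v b)).
- exact: (@measurable_Rintegral _ _ _ _ _ m2 (fun z => H z.1 z.2)).
- exact: integZr.
- move=> a; rewrite -RintegralZl//; apply: le_norm_Rintegral => //.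
  + exact: integ_measurable (integ_section1 a).
  + exact: integZl.
Qed.

(** Domination by a product [u a * v b] makes every section integrable, not just almost every one,
    so the two iterated real integrals agree without exceptional null sets. In the applications one
    factor is a multiple of a box or ball indicator, or a local piece of [N]. *)
Lemma Rintegral_swap :
  \int[m1]_a \int[m2]_b H a b = \int[m2]_b \int[m1]_a H a b.
Proof.
have mEH : measurable_fun setT (fun z => (H z.1 z.2)%:E).
  exact/measurable_EFinP.
have inorm a : integ m2 (fun b => `|H a b|).
  exact: integ_norm (integ_section1 a).
have iH : (m1 \x m2)%E.-integrable setT (fun z => (H z.1 z.2)%:E).
  apply/(integrable12ltyP _ _ mEH).
  have iuv : integ m1 (fun a => u a * \int[m2]_b v b).
    exact: integZr.
  apply: le_lt_trans (integrable_lty measurableT iuv).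
  apply: ge0_le_integral => //.
  - by move=> a _; apply: integral_ge0.
  - apply: (@measurable_fun_fubini_tonelli_F _ _ _ _ _ m2
      (fun z => `|(H z.1 z.2)%:E|%E)) => //.
    exact: measurableT_comp.
  - exact: measurable_int iuv.
  - move=> a _ /=.
    have -> : (\int[m2]_b `|(H a b)%:E| = (\int[m2]_b `|H a b|)%:E)%E.
      by rewrite /Rintegral fineK//; exact: integrable_fin_num (inorm a).
    rewrite lee_fin -RintegralZl//; apply: le_Rintegral => //.
    exact: integZl.
have := congr1 fine (Fubini iH).
rewrite {1 2}/Rintegral/= => FE.
rewrite /Rintegral; move: FE; congr (fine _ = fine _); apply: eq_integral => x _ /=.
  by rewrite fineK//; exact: integrable_fin_num (integ_section1 x).
by rewrite fineK//; exact: integrable_fin_num (integ_section2 x).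
Qed.

End swap.

(** * Lebesgue measure on the half plane *)

(* A head constant for the product measure, so that it can carry a sigma-finite
   instance. *)
Definition leb2 (R : realType) : set (plane R) -> \bar R :=
  (@lebesgue_measure R \x @lebesgue_measure R)%E.
Arguments leb2 : clear implicits.

HB.instance Definition _ (R : realType) := Measure.on (leb2 R).

Lemma sigma_finite_leb2 (R : realType) : sigma_finite setT (leb2 R).
Proof.
exists (fun n => ball (0 : R) n%:R `*` ball (0 : R) n%:R).
  apply/seteqP; split => // -[x y] _.
  exists (Num.truncn (`|x| + `|y|)).+1 => //=; rewrite -!ball_normE/= !sub0r !normrN.
  have h := truncnS_gt (`|x| + `|y|).
  by split; apply: le_lt_trans h; rewrite ?lerDl ?lerDr.
move=> n; split; first by apply: measurableX; exact: measurable_ball.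
rewrite /leb2 product_measure1E; [|exact: measurable_ball..].
have /= -> := @lebesgue_measure_ball R 0 _ (ler0n R n).
by rewrite -EFinM ltry.
Qed.

HB.instance Definition _ (R : realType) :=
  Measure_isSigmaFinite.Build _ _ _ (leb2 R) (@sigma_finite_leb2 R).

Definition ind {R : realType} (b : bool) : R := b%:R.

Lemma ind_ge0 (R : realType) b : 0 <= ind b :> R.
Proof. exact: ler0n. Qed.

Lemma ind_le1 (R : realType) b : ind b <= 1 :> R.
Proof. by rewrite /ind lern1; case: b. Qed.

Lemma le_ind (R : realType) (a b : bool) : (a -> b) -> ind a <= ind b :> R.
Proof. by rewrite /ind ler_nat; case: a; case: b => // /(_ isT). Qed.

Lemma measurable_ind d (T : measurableType d) (R : realType) (b : T -> bool) :
  measurable_fun setT b -> measurable_fun setT (fun x => ind (b x) : R).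
Proof.
move=> mb; rewrite /ind [X in measurable_fun _ X](_ : _ = fun x => if b x then 1 else 0).
  exact: measurable_fun_ifT.
by apply/funext => x; case: (b x).
Qed.

Section ball_indicator.
Context {R : realType}.
Notation mu := (@lebesgue_measure R).

Lemma ball_indicE (c r : R) :
  (fun x : R => ind (`|c - x| < r) : R) = \1_(ball c r).
Proof.
apply/funext => x; rewrite indicE /ind; congr (nat_of_bool _)%:R.
by apply/idP/idP => [h|/set_mem]; [apply/mem_set|]; rewrite -ball_normE.
Qed.

Lemma integ_ball (c r : R) : integ mu (fun x : R => ind (`|c - x| < r) : R).
Proof.
rewrite ball_indicE; apply/integrableP; split.
  by apply/measurable_EFinP; apply: measurable_indic; exact: measurable_ball.
rewrite (eq_integral (fun x : measurableTypeR R => (\1_(ball c r) x)%:E)); last first.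
  by move=> x _ /=; rewrite ger0_norm.
rewrite integral_indic//; last exact: measurable_ball.
rewrite setIT; have [r0|r0] := leP 0 r.
  by have /= -> := lebesgue_measure_ball c r0; rewrite ltry.
by rewrite (ball0 _ _).2 ?measure0 ?ltry// ltW.
Qed.

Lemma Rintegral_ball (c r : R) : 0 <= r ->
  \int[mu]_x (ind (`|c - x| < r) : R) = 2 * r.
Proof.
move=> r0; rewrite ball_indicE /Rintegral integral_indic//; last exact: measurable_ball.
by rewrite setIT; have /= -> := lebesgue_measure_ball c r0; rewrite /= mulr2n; ring.
Qed.

End ball_indicator.

(** * Explicit integrals in the height and over cones *)

Lemma integral_FTC (R : realType) (F f : R -> R) (a b : R) : a < b ->
  (forall x, a <= x <= b -> is_derive x 1 F (f x)) ->
  (forall x, a <= x <= b -> {for x, continuous f}) ->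
  (\int[lebesgue_measure]_(x in `[a, b]) (f x)%:E = (F b - F a)%:E)%E.
Proof.
move=> ab dF cf; rewrite EFinB; apply: continuous_FTC2 => //.
- apply: continuous_in_subspaceT => x /set_mem/=; rewrite in_itv/=; exact: cf.
- have cF x : a <= x <= b -> {for x, continuous F}.
    by move=> /dF h; apply/differentiable_continuous/derivable1_diffP.
  split.
  + by move=> x; rewrite in_itv/= => /andP[/ltW ax /ltW xb]; apply: (@ex_derive _ _ _ _ _ _ _ (dF x _)); rewrite ax xb.
  + by apply: cvg_at_right_filter; apply: cF; rewrite lexx ltW.
  + by apply: cvg_at_left_filter; apply: cF; rewrite lexx ltW.
- move=> x; rewrite in_itv/= => /andP[/ltW ax /ltW xb].
  by rewrite derive1E (@derive_val _ _ _ _ _ _ _ (dF x _)) // ax xb.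
Qed.

Lemma integral_inv_sqr_le (R : realType) (a b : R) : 0 < a ->
  (\int[lebesgue_measure]_(t in `[a, b]) (t ^- 2)%:E <= (a^-1)%:E)%E.
Proof.
move=> a0; have [ba|ab] := leP b a.
  rewrite (@integral_Sset1 _ _ _ a) ?lee_fin ?invr_ge0 ?ltW//.
  move=> x /=; rewrite in_itv/= => /andP[ax xb].
  by apply/eqP; rewrite eq_le ax (le_trans xb).
have dF x : a <= x <= b -> is_derive x 1 (fun x : R => - x^-1) (x ^- 2).
  move=> /andP[ax _]; have x0 : x != 0 by rewrite gt_eqF// (lt_le_trans a0).
  have := is_deriveN (is_deriveV x0 (is_derive_id x 1)).
  by move=> h; apply: is_derive_eq; rewrite scaleNr opprK /GRing.scale/= mulr1.
have cf (x : R) : a <= x <= b -> {for x, continuous (fun x : R => x ^- 2)}.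
  move=> /andP[ax _]; have x0 : x != 0 by rewrite gt_eqF// (lt_le_trans a0).
  apply: continuousV; first by rewrite expf_neq0.
  exact: exprn_continuous.
rewrite (integral_FTC ab dF cf).
by rewrite lee_fin opprK addrC lerBlDr lerDl invr_ge0 ltW// (lt_trans a0).
Qed.
Lemma integral_ind_itv (R : realType) (a b : R) (h : R -> R) :
  (\int[lebesgue_measure]_t (ind (a <= t <= b) * h t)%:E =
   \int[lebesgue_measure]_(t in `[a, b]) (h t)%:E)%E.
Proof.
rewrite [RHS]integral_mkcond; apply: eq_integral => t _.
rewrite patchE /ind; have -> : (t \in `[a, b]%classic) = (a <= t <= b).
  by apply/idP/idP => [/set_mem|h1]; rewrite /= ?in_itv//; apply/mem_set; rewrite /= in_itv.
by case: (_ <= _ <= _); rewrite ?mul1r ?mul0r.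
Qed.

(** A finite extended-real bound for the nonnegative [g] also supplies its integrability.
    Computations by [integral_cone], which stay in the extended reals, can thus be used directly. *)
Lemma le_norm_Rintegral_ereal d (T : measurableType d) (R : realType)
    (m : {measure set T -> \bar R}) (f g : T -> R) (B : R) :
  measurable_fun setT f -> measurable_fun setT g ->
  (forall x, `|f x| <= g x) -> (\int[m]_x (g x)%:E <= B%:E)%E ->
  `|\int[m]_x f x| <= B.
Proof.
move=> mf mg fg gB.
have g0 x : 0 <= g x by apply: le_trans (fg x).
have ig : integ m g.
  apply/integrableP; split; first exact/measurable_EFinP.
  rewrite (eq_integral (EFin \o g)); first by apply: le_lt_trans gB _; rewrite ltry.
  by move=> x _ /=; rewrite ger0_norm.
apply: (le_trans (le_norm_Rintegral mf ig fg)).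
rewrite -lee_fin /Rintegral fineK//; exact: integrable_fin_num.
Qed.

Section cone.
Context {R : realType}.

(** Tonelli, with the horizontal variable integrated first over a ball of length [2 * rho t]. The
    sign condition is confined to heights where [g] is nonzero: truncated weights vanish at negative
    heights, where a radius such as [3 * t] is negative. *)
Lemma integral_cone (y : R) (g rho : R -> R) :
  measurable_fun setT g -> measurable_fun setT rho ->
  (forall t, 0 <= g t) -> (forall t, g t != 0 -> 0 <= rho t) ->
  (\int[leb2 R]_w (g w.2 * ind (`|y - w.1| < rho w.2))%:E =
   \int[lebesgue_measure]_t (g t * (2 * rho t))%:E)%E.
Proof.
move=> mg mrho g0 rho0; rewrite /leb2 fubini_tonelli2; last 2 first.
- apply/measurable_EFinP; apply: measurable_funM.
    by apply: measurableT_comp.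
  apply: measurable_ind; apply: measurable_fun_ltr; last exact: measurableT_comp.
  by apply: measurableT_comp => //; apply: measurable_funB.
- by move=> w; rewrite lee_fin mulr_ge0 ?g0 ?ind_ge0.
apply: eq_integral => t _; rewrite /fubini_G/=.
have [->|gt0] := eqVneq (g t) 0.
  by rewrite mul0r; under eq_integral do rewrite mul0r; rewrite integral0.
rewrite -(Rintegral_ball y (rho0 _ gt0)) -RintegralZl//; last exact: integ_ball.
by rewrite /Rintegral fineK//; apply: integrable_fin_num => //; apply: integZl; exact: integ_ball.
Qed.

End cone.

(** * Kernels *)

Lemma measurable_inv (R : realType) : measurable_fun setT (@GRing.inv R).
Proof.
rewrite (_ : @GRing.inv R =
  fun x => if 0 <= x then x `^ (-1) else - ((- x) `^ (-1))); last first.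
  apply/funext => x; case: (leP 0 x) => x0; first by rewrite powR_inv1.
  by rewrite powR_inv1 ?oppr_ge0 ?ltW// invrN opprK.
apply: measurable_fun_ifT.
- exact: measurable_fun_ler.
- exact: measurable_powR.
- apply: measurableT_comp => //; apply: (measurableT_comp (measurable_powR _)).
  exact: oppr_measurable.
Qed.

Lemma measurable_funV d (T : measurableType d) (R : realType) (f : T -> R) :
  measurable_fun setT f -> measurable_fun setT (fun x => (f x)^-1).
Proof. exact: measurableT_comp (@measurable_inv R). Qed.

Lemma lipschitz_measurable (R : realType) (k : R) (f : R -> R) :
  (forall x y, `|f x - f y| <= k * `|x - y|) ->
  measurable_fun [set: measurableTypeR R] f.
Proof.
move=> fk; apply: continuous_measurable_fun => x; apply/cvgrPdist_lt => e e0.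
have k0 : 0 <= k by have := fk 0 1; rewrite sub0r normrN1 mulr1; exact: le_trans.
have k1 : 0 < k + 1 by rewrite ltr_wpDl.
apply/nbhs_ballP; exists (e / (k + 1)); first by rewrite /= divr_gt0.
move=> y /= xy; apply: (le_lt_trans (fk x y)).
apply: (@le_lt_trans _ _ ((k + 1) * `|x - y|)).
  by rewrite ler_wpM2r// lerDl.
by rewrite mulrC -ltr_pdivlMr.
Qed.

Section kernel.
Context {R : realType}.
Notation mu := (@lebesgue_measure R).
Variables (phi : R -> R) (M L : R).
Hypotheses (phiM : forall x, `|phi x| <= M)
  (phiL : forall x y, `|phi x - phi y| <= L * `|x - y|)
  (phi0 : forall x, 1 <= `|x| -> phi x = 0).

Lemma sup_bound_ge0 : 0 <= M. Proof. exact: le_trans (normr_ge0 _) (phiM 0). Qed.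

Lemma lipschitz_const_ge0 : 0 <= L.
Proof. by have := phiL 0 1; rewrite sub0r normrN1 mulr1; exact: le_trans. Qed.

Definition kap (w : plane R) (x : measurableTypeR R) : R := w.2^-1 * phi (w.2^-1 * (w.1 - x)).

Lemma measurable_kap : measurable_fun setT (fun z : plane R * measurableTypeR R => kap z.1 z.2).
Proof.
have m2 : measurable_fun setT (fun z : plane R * measurableTypeR R => z.1.2^-1).
  by apply: measurable_funV; apply: measurableT_comp.
apply: measurable_funM => //; apply: (measurableT_comp (lipschitz_measurable phiL)).
apply: measurable_funM => //; apply: measurable_funB => //.
by apply: measurableT_comp.
Qed.

Lemma measurable_kap1 w : measurable_fun setT (kap w).
Proof. exact: (measurableT_comp measurable_kap (pair1_measurable w)). Qed.

Lemma kap_neq0 w x : 0 < w.2 -> kap w x != 0 -> `|w.1 - x| < w.2.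
Proof.
move=> t0; apply: contraNT; rewrite -leNgt => h; rewrite /kap phi0 ?mulr0//.
by rewrite normrM gtr0_norm ?invr_gt0// mulrC ler_pdivlMr// mul1r.
Qed.

Lemma kap_le w x : 0 < w.2 -> `|kap w x| <= M / w.2 * ind (`|w.1 - x| < w.2).
Proof.
move=> t0; have [k0|k0] := eqVneq (kap w x) 0.
  by rewrite k0 normr0 mulr_ge0 ?ind_ge0// divr_ge0 ?sup_bound_ge0// ltW.
rewrite (kap_neq0 t0 k0) /ind mulr1 /kap normrM gtr0_norm ?invr_gt0// mulrC.
by rewrite ler_pM2r ?invr_gt0.
Qed.

Lemma kap_lip w x x' : 0 < w.2 ->
  `|kap w x - kap w x'| <= L / w.2 ^+ 2 * `|x - x'|.
Proof.
move=> t0; rewrite /kap -mulrBr normrM gtr0_norm ?invr_gt0//.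
apply: (@le_trans _ _ (w.2^-1 * (L * `|w.2^-1 * (w.1 - x) - w.2^-1 * (w.1 - x')|))).
  by rewrite ler_pM2l ?invr_gt0.
rewrite -mulrBr normrM (gtr0_norm (x := w.2^-1)) ?invr_gt0//.
rewrite (_ : w.1 - x - (w.1 - x') = x' - x) ?(distrC x'); last by ring.
by rewrite le_eqVlt; apply/orP; left; apply/eqP; field; rewrite gt_eqF.
Qed.

Lemma integ_kap w : 0 < w.2 -> integ mu (kap w).
Proof.
move=> t0; apply: (@integ_dom _ _ _ mu _
  (fun x => M / w.2 * ind (`|w.1 - x| < w.2)) (measurable_kap1 w)).
  by apply: integZl; exact: integ_ball.
by move=> x; exact: kap_le.
Qed.

(** The kernel of T T^*, where T sends f to its integrals against [kap w]. *)
Definition kap_corr w w' := \int[mu]_x (kap w x * kap w' x).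

Lemma kap_corrC w w' : kap_corr w w' = kap_corr w' w.
Proof. by apply: eq_Rintegral => x _; rewrite mulrC. Qed.

Lemma integ_kap_corr w w' : 0 < w.2 -> 0 < w'.2 -> integ mu (fun x => kap w x * kap w' x).
Proof.
move=> t0 t'0; apply: (@integ_dom _ _ _ _ _ (fun x => M / w.2 * `|kap w' x|)).
- by apply: measurable_funM; exact: measurable_kap1.
- by apply: integZl; exact: integ_norm (integ_kap t'0).
- move=> x; rewrite normrM ler_wpM2r//; apply: (le_trans (kap_le x t0)).
  by rewrite ler_piMr ?ind_le1// divr_ge0 ?sup_bound_ge0// ltW.
Qed.

Hypothesis kap_mean : forall w, 0 < w.2 -> \int[mu]_x kap w x = 0.

(** The finer kernel [kap w'] has mean zero, so the constant [kap w w'.1] may be subtracted from the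
    coarser one. On the support of [kap w'] the remaining increment is at most
    [L / w.2 ^+ 2 * w'.2], and the L^1 norm of [kap w'] is at most [2 * M]. The supports are
    disjoint once the centres are at least [w.2 + w'.2] apart. *)
Lemma kap_corr_le w w' : 0 < w'.2 -> w'.2 <= w.2 ->
  `|kap_corr w w'| <= 2 * L * M * (w'.2 / w.2 ^+ 2) * ind (`|w.1 - w'.1| < w.2 + w'.2).
Proof.
move=> t'0 tt'; have t0 : 0 < w.2 by apply: lt_le_trans tt'.
case: (ltP (`|w.1 - w'.1|) (w.2 + w'.2)) => h; last first.
  rewrite /ind mulr0 /kap_corr (@eq_Rintegral _ _ _ _ _ (cst 0)); last first.
    move=> x _ /=; apply/eqP; rewrite mulf_eq0; apply/negPn/negP.
    rewrite negb_or => /andP[/(kap_neq0 t0) h1 /(kap_neq0 t'0) h2].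
    move: h; rewrite leNgt => /negP; apply.
    rewrite (_ : w.1 - w'.1 = (w.1 - x) - (w'.1 - x)); last by ring.
    by apply: (le_lt_trans (ler_normB _ _)); rewrite ltrD.
  by rewrite Rintegral_cst// mul0r normr0.
rewrite /ind mulr1.
have -> : kap_corr w w' = \int[mu]_x ((kap w x - kap w w'.1) * kap w' x).
  rewrite /kap_corr [RHS](@eq_Rintegral _ _ _ _ _
    (fun x => kap w x * kap w' x - kap w w'.1 * kap w' x)); last first.
    by move=> x _; rewrite mulrBl.
  rewrite RintegralB//; [|exact: integ_kap_corr|by apply: integZl; exact: integ_kap].
  by rewrite RintegralZl ?kap_mean// ?mulr0 ?subr0//; exact: integ_kap.
apply: (le_trans (@le_norm_Rintegral _ _ _ mu _
  (fun x => L / w.2 ^+ 2 * w'.2 * (M / w'.2) * ind (`|w'.1 - x| < w'.2)) _ _ _)).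
- apply: measurable_funM; last exact: measurable_kap1.
  by apply: measurable_funB => //; exact: measurable_kap1.
- by apply: integZl; exact: integ_ball.
- move=> x; rewrite normrM.
  have [k0|k0] := eqVneq (kap w' x) 0.
    rewrite k0 normr0 mulr0 mulr_ge0 ?ind_ge0// !mulr_ge0 ?invr_ge0 ?exprn_ge0 ?lipschitz_const_ge0 ?sup_bound_ge0//; exact: ltW.
  rewrite -mulrA; apply: ler_pM => //; last exact: kap_le.
  apply: (le_trans (kap_lip _ _ t0)); rewrite ler_wpM2l//.
    by rewrite divr_ge0 ?lipschitz_const_ge0// exprn_ge0// ltW.
  by rewrite distrC ltW// kap_neq0.
- rewrite RintegralZl//; last exact: integ_ball.
  rewrite Rintegral_ball ?(ltW t'0)// le_eqVlt; apply/orP; left; apply/eqP.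
  by field; rewrite !gt_eqF.
Qed.

End kernel.

(** * Schur test and the L^2 square function estimate *)

Section schur_weights.
Context {R : realType}.
Notation mu := (@lebesgue_measure R).

(* On |y - y'| < t + t' the two cases of kap_corr_le together say that |kap_corr w w'| is at most
   2 L M t' (schur_weight eps s t t'). *)
Definition schur_weight (eps s t t' : R) : R :=
  ind (eps <= t' <= t) * t ^- 2 + ind (t <= t' <= s) * (t * t' ^- 3).

Lemma measurable_schur_weight eps s t :
  measurable_fun [set: measurableTypeR R] (schur_weight eps s t).
Proof.
apply: measurable_funD; apply: measurable_funM => //.
- apply: measurable_ind; apply: measurable_and; exact: measurable_fun_ler.
- apply: measurable_ind; apply: measurable_and; exact: measurable_fun_ler.
- apply: measurable_funM => //; apply: measurable_funV; exact: measurable_funX.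
Qed.

Lemma schur_weight_ge0 eps s t t' : 0 < t -> 0 <= schur_weight eps s t t'.
Proof.
move=> t0; apply: addr_ge0.
  by rewrite mulr_ge0 ?ind_ge0// invr_ge0 sqr_ge0.
rewrite /ind; case: (boolP (t <= t' <= s)) => [/andP[h _]|_]; last by rewrite mul0r.
have t'0 := lt_le_trans t0 h.
by rewrite mul1r divr_ge0 ?exprn_ge0 ?ltW.
Qed.

Lemma schur_weight_eq0 eps s t t' : 0 < eps -> 0 < t -> t' < 0 -> schur_weight eps s t t' = 0.
Proof.
move=> e0 t0 h; rewrite /schur_weight /ind !leNgt (lt_trans h e0) (lt_trans h t0)/=.
by rewrite !mul0r addr0.
Qed.

(** The factor [2 * (t + t')] is the length of the interval of admissible y'. For t' <= t the
    integrand is at most 4 / t, which over the larger set |t'| < 2 t contributes 16; for t' >= t it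
    is at most 4 t / t'^2, which contributes 4. *)
Lemma integral_schur_weight_le eps s t : 0 < eps -> 0 < t ->
  (\int[mu]_t' (schur_weight eps s t t' * (2 * (t + t')))%:E <= 20%:E)%E.
Proof.
move=> e0 t0.
pose U (t' : measurableTypeR R) : R := 4 / t * ind (`|0 - t'| < 2 * t).
pose I (t' : measurableTypeR R) : R := ind (t <= t' <= s) * t' ^- 2.
have I0 t' : 0 <= I t' by rewrite /I mulr_ge0 ?ind_ge0// invr_ge0 sqr_ge0.
have mI : measurable_fun setT I.
  apply: measurable_funM.
    by apply: measurable_ind; apply: measurable_and; exact: measurable_fun_ler.
  by apply: measurable_funV; exact: measurable_funX.
have t40 : 0 <= 4 * t by rewrite mulr_ge0// ltW.
have iU : integ mu U by apply: integZl; exact: integ_ball.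
apply: (@le_trans _ _ (\int[mu]_t' (U t' + 4 * t * I t')%:E)%E).
  apply: ge0_le_integral => //.
  - move=> t' _; rewrite lee_fin; case: (ltP t' 0) => h; last first.
      by rewrite mulr_ge0 ?schur_weight_ge0// mulr_ge0// addr_ge0// ltW.
    by rewrite schur_weight_eq0// mul0r.
  - apply/measurable_EFinP; apply: measurable_funM; first exact: measurable_schur_weight.
    by apply: measurable_funM => //; apply: measurable_funD.
  - apply/measurable_EFinP; apply: measurable_funD; last exact: measurable_funM.
    exact: integ_measurable iU.
  - move=> t' _; rewrite lee_fin /schur_weight /U mulrDl; apply: lerD.
      rewrite /ind sub0r normrN; case: (boolP (eps <= t' <= t)) => [/andP[a b]|_]; last first.
        by rewrite !mul0r mulr_ge0// divr_ge0// ltW.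
      have t'0 : 0 < t' by apply: lt_le_trans a.
      rewrite gtr0_norm// (_ : t' < 2 * t) ?mul1r ?mulr1; last by lra.
      rewrite ler_pdivrMl ?exprn_gt0//.
      rewrite (_ : t ^+ 2 * (4 / t) = 4 * t); last by field; rewrite gt_eqF.
      lra.
    rewrite /I /ind; case: (boolP (t <= t' <= s)) => [/andP[a b]|_]; last first.
      by rewrite !(mul0r, mulr0).
    have t'0 : 0 < t' by apply: lt_le_trans a.
    rewrite !mul1r mulrAC [X in _ <= X](_ : _ = 4 * t * t' * t' ^- 3); last first.
      by field; rewrite gt_eqF.
    rewrite ler_pM2r ?invr_gt0 ?exprn_gt0//.
    rewrite (_ : 4 * t * t' = t * (4 * t')); last by ring.
    rewrite ler_pM2l//; lra.
under eq_integral do rewrite EFinD.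
rewrite ge0_integralD//; last 4 first.
- by move=> t' _; rewrite lee_fin /U mulr_ge0 ?ind_ge0// divr_ge0// ltW.
- exact: measurable_int iU.
- by move=> t' _; rewrite lee_fin mulr_ge0.
- by apply/measurable_EFinP; exact: measurable_funM.
have -> : (\int[mu]_t' (U t')%:E = 16%:E)%E.
  have <- : \int[mu]_t' U t' = 16.
    rewrite /U RintegralZl//; last exact: integ_ball.
    rewrite Rintegral_ball; last by rewrite mulr_ge0// ltW.
    by field; rewrite gt_eqF.
  by rewrite /Rintegral fineK//; exact: integrable_fin_num.
rewrite (_ : 20%:E = 16%:E + 4%:E :> \bar R)%E; last by rewrite -EFinD; congr EFin; lra.
apply: leeD => //.
under eq_integral do rewrite EFinM.
rewrite ge0_integralZl_EFin//; last 2 first.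
- by move=> t' _; rewrite lee_fin.
- exact/measurable_EFinP.
rewrite integral_ind_itv.
apply: (@le_trans _ _ ((4 * t)%:E * (t^-1)%:E)%E).
  by rewrite lee_wpmul2l ?integral_inv_sqr_le.
by rewrite -EFinM lee_fin mulfK ?gt_eqF.
Qed.

End schur_weights.

(** The weights used below vanish off the support of [chi], in particular wherever [w.2 <= 0], and
    integrability of the kernels is known only on that support. Hence the separate case [a = 0]. *)
Lemma RintegralZl0 d (T : measurableType d) (R : realType)
    (m : {measure set T -> \bar R}) (a : R) (f : T -> R) :
  (a != 0 -> integ m f) -> \int[m]_x (a * f x) = a * \int[m]_x f x.
Proof.
move=> af; have [->|/af ?] := eqVneq a 0; last exact: RintegralZl.
under eq_Rintegral do rewrite mul0r.
by rewrite Rintegral_cst// !mul0r.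
Qed.

Lemma schur_weight_ge_below (R : realType) (eps s t t' : R) : 0 < eps ->
  eps <= t' <= t -> t' / t ^+ 2 <= schur_weight eps s t t' * t'.
Proof.
move=> e0 att'; have /andP[a tt'] := att'.
have t'0 : 0 < t' by apply: lt_le_trans a.
have t0 : 0 < t by apply: lt_le_trans tt'.
rewrite /schur_weight {1}/ind att' mul1r mulrDl mulrC lerDl.
rewrite mulr_ge0 ?(ltW t'0)// mulr_ge0 ?ind_ge0//.
by rewrite divr_ge0 ?exprn_ge0 ?ltW.
Qed.

Lemma schur_weight_ge_above (R : realType) (eps s t t' : R) : 0 < t ->
  t <= t' <= s -> t / t' ^+ 2 <= schur_weight eps s t t' * t'.
Proof.
move=> t0 tt's; have /andP[tt' b] := tt's.
have t'0 : 0 < t' by apply: lt_le_trans tt'.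
rewrite /schur_weight [X in _ + X * _]/ind tt's mul1r.
rewrite mulrDl (_ : t / t' ^+ 3 * t' = t / t' ^+ 2); last by field; rewrite gt_eqF.
rewrite lerDr mulr_ge0 ?(ltW t'0)// mulr_ge0 ?ind_ge0//.
by rewrite invr_ge0 sqr_ge0.
Qed.

Section truncation.
Context {R : realType}.
Notation mu := (@lebesgue_measure R).
Notation nu := (leb2 R).

Definition box (eps s x0 : R) (w : plane R) : R :=
  ind (eps <= w.2 <= s) * ind (`|x0 - w.1| < s).

Lemma box_ge0 eps s x0 w : 0 <= box eps s x0 w.
Proof. by rewrite mulr_ge0 ?ind_ge0. Qed.

Lemma box_le1 eps s x0 w : box eps s x0 w <= 1.
Proof. by rewrite mulr_ile1 ?ind_ge0 ?ind_le1. Qed.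

Lemma box_neq0 eps s x0 w : box eps s x0 w != 0 ->
  [/\ eps <= w.2, w.2 <= s & `|x0 - w.1| < s].
Proof.
rewrite /box /ind; case: (boolP (_ <= _ <= _)) => [/andP[-> ->]|_]; last by rewrite mul0r eqxx.
by case: (_ < _); rewrite // mulr0 eqxx.
Qed.

Lemma measurable_box eps s x0 : measurable_fun setT (box eps s x0).
Proof.
apply: measurable_funM; apply: measurable_ind.
  by apply: measurable_and; apply: measurable_fun_ler.
apply: measurable_fun_ltr => //; apply: measurableT_comp => //.
exact: measurable_funB.
Qed.

Lemma integ_box eps s x0 : 0 < eps -> integ nu (box eps s x0).
Proof.
move=> e0; have mi : measurable_fun [set: measurableTypeR R] (fun t => ind (eps <= t <= s) : R).
  by apply: measurable_ind; apply: measurable_and; apply: measurable_fun_ler.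
apply/integrableP; split; first by apply/measurable_EFinP; exact: measurable_box.
rewrite (eq_integral (fun w : plane R => (ind (eps <= w.2 <= s) * ind (`|x0 - w.1| < cst s w.2))%:E)); last first.
  by move=> w _ /=; rewrite ger0_norm// box_ge0.
rewrite (@integral_cone _ _ (fun t => ind (eps <= t <= s)))//; last first.
  rewrite /= /ind => t; case: (boolP (_ <= _ <= _)); last by rewrite eqxx.
  by move=> /andP[a b] _; rewrite (le_trans _ b)// (le_trans _ a)// ltW.
pose u (t : measurableTypeR R) : R := 2 * `|s| * ind (`|0 - t| < `|s| + 1).
have iu : integ mu u by apply: integZl; exact: integ_ball.
have lu (t : R) : 0 <= ind (eps <= t <= s) * (2 * s) <= u t.
  rewrite /u /ind sub0r normrN; case: (boolP (eps <= t <= s)); last first.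
    by move=> _; rewrite mul0r lexx mulr_ge0// mulr_ge0.
  move=> /andP[a b]; have t0 : 0 < t by apply: lt_le_trans a.
  have s0 : 0 <= s by apply: le_trans b; exact: ltW.
  rewrite !ger0_norm ?(ltW t0)// mul1r mulr_ge0//= (_ : t < s + 1) ?mulr1//.
  by rewrite ltr_pwDr.
apply: le_lt_trans (integrable_lty measurableT iu).
apply: ge0_le_integral => //.
- by move=> t _; rewrite lee_fin; have /andP[] := lu t.
- apply/measurable_EFinP; apply: (measurable_funM mi).
  exact: (measurable_cst (2 * s)).
- exact: measurable_int iu.
- by move=> t _; rewrite lee_fin; have /andP[] := lu t.
Qed.

End truncation.

Section schur_test.
Context {R : realType}.
Notation mu := (@lebesgue_measure R).
Notation nu := (leb2 R).
Variables (phi : R -> R) (M L : R).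
Hypotheses (phiM : forall x, `|phi x| <= M)
  (phiL : forall x y, `|phi x - phi y| <= L * `|x - y|)
  (phi0 : forall x, 1 <= `|x| -> phi x = 0)
  (kap_mean : forall w, 0 < w.2 -> \int[mu]_x kap phi w x = 0).
Variables (eps s x0 : R) (chi : plane R -> R).
Hypotheses (e0 : 0 < eps) (mchi : measurable_fun setT chi)
  (chi0 : forall w, 0 <= chi w) (chi_box : forall w, chi w <= box eps s x0 w).

Local Notation kap := (kap phi).
Local Notation kap_corr := (kap_corr phi).
Local Notation box := (box eps s x0).

Let M0 := sup_bound_ge0 phiM.
Let L0 := lipschitz_const_ge0 phiL.

Lemma chi_le1 w : chi w <= 1. Proof. exact: le_trans (box_le1 _ _ _ _). Qed.

Lemma chi_neq0 w : chi w != 0 -> [/\ eps <= w.2, w.2 <= s & `|x0 - w.1| < s].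
Proof.
move=> cw; apply: box_neq0; rewrite gt_eqF//; apply: lt_le_trans (chi_box w).
by rewrite lt_neqAle eq_sym cw chi0.
Qed.

Lemma measurable_kap_corr : measurable_fun setT (fun z : plane R * plane R => kap_corr z.1 z.2).
Proof.
pose H (y : (plane R * plane R) * measurableTypeR R) := kap y.1.1 y.2 * kap y.1.2 y.2.
apply: (@measurable_Rintegral _ _ _ _ _ mu H).
apply: measurable_funM.
- apply: (@measurableT_comp _ _ _ _ _ _ (fun z : plane R * measurableTypeR R => kap z.1 z.2) _
    (fun y : (plane R * plane R) * measurableTypeR R => (y.1.1, y.2))).
    exact: measurable_kap phiL.
  by apply: measurable_fun_pair => //; apply: measurableT_comp.
- apply: (@measurableT_comp _ _ _ _ _ _ (fun z : plane R * measurableTypeR R => kap z.1 z.2) _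
    (fun y : (plane R * plane R) * measurableTypeR R => (y.1.2, y.2))).
    exact: measurable_kap phiL.
  by apply: measurable_fun_pair => //; apply: measurableT_comp.
Qed.

Lemma measurable_kap_corr1 w : measurable_fun setT (kap_corr w).
Proof. exact: (measurableT_comp measurable_kap_corr (pair1_measurable w)). Qed.

(** A row sum of the kernel of T T^* for the measure dy dt / t, cut off by [chi]. The 40 is the
    factor 2 of [kap_corr_le] times the 20 of [integral_schur_weight_le]. *)
Lemma schur w : 0 < w.2 ->
  `|\int[nu]_w' (chi w' * (`|kap_corr w w'| / w'.2))| <= 40 * L * M.
Proof.
move=> t0; pose C := 2 * L * M.
have C0 : 0 <= C by rewrite /C !mulr_ge0.
apply: (@le_norm_Rintegral_ereal _ _ _ nu _
  (fun w' => C * (schur_weight eps s w.2 w'.2 * ind (`|w.1 - w'.1| < w.2 + w'.2)))).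
- apply: measurable_funM => //; apply: measurable_funM.
    by apply: measurableT_comp => //; exact: measurable_kap_corr1.
  by apply: measurable_funV.
- apply: measurable_funM => //; apply: measurable_funM.
    by apply: measurableT_comp => //; exact: measurable_schur_weight.
  apply: measurable_ind; apply: measurable_fun_ltr.
    by apply: measurableT_comp => //; exact: measurable_funB.
  exact: measurable_funD.
- move=> w'; have [->|cw] := eqVneq (chi w') 0.
    by rewrite mul0r normr0 mulr_ge0// mulr_ge0 ?ind_ge0// schur_weight_ge0.
  have [a b _] := chi_neq0 cw; have t'0 : 0 < w'.2 by apply: lt_le_trans a.
  rewrite !normrM normr_id normfV (ger0_norm (chi0 _)) (gtr0_norm t'0).
  apply: (@le_trans _ _ (`|kap_corr w w'| / w'.2)).
    by rewrite ler_piMl ?chi_le1// divr_ge0// ltW.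
  rewrite ler_pdivrMr// mulrA mulrAC; case: (leP w'.2 w.2) => tt'.
    apply: (le_trans (kap_corr_le phiM phiL phi0 kap_mean t'0 tt')).
    rewrite ler_wpM2r ?ind_ge0// -[C * _ * _]mulrA ler_wpM2l// schur_weight_ge_below//.
    by rewrite a.
  rewrite kap_corrC; apply: (le_trans (kap_corr_le phiM phiL phi0 kap_mean t0 (ltW tt'))).
  rewrite distrC (addrC w'.2) ler_wpM2r ?ind_ge0// -[C * _ * _]mulrA.
  by rewrite ler_wpM2l// schur_weight_ge_above// (ltW tt').
- have mG : measurable_fun setT (fun w' : plane R => schur_weight eps s w.2 w'.2 * ind (`|w.1 - w'.1| < w.2 + w'.2)).
    apply: measurable_funM.
      by apply: measurableT_comp => //; exact: measurable_schur_weight.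
    apply: measurable_ind; apply: measurable_fun_ltr.
      by apply: measurableT_comp => //; exact: measurable_funB.
    exact: measurable_funD.
  under eq_integral do rewrite EFinM.
  rewrite ge0_integralZl_EFin//; last 2 first.
  + by move=> w' _; rewrite lee_fin mulr_ge0 ?ind_ge0// schur_weight_ge0.
  + exact/measurable_EFinP.
  rewrite (@integral_cone _ _ (schur_weight eps s w.2) (fun t => w.2 + t)); last 4 first.
  + exact: measurable_schur_weight.
  + exact: measurable_funD.
  + by move=> t; rewrite schur_weight_ge0.
  + move=> t; apply: contraNT; rewrite -ltNge => h; rewrite schur_weight_eq0//; lra.
  rewrite (_ : 40 * L * M = C * 20); last by rewrite /C; ring.
  rewrite [X in (_ <= X)%E]EFinM lee_wpmul2l//; exact: integral_schur_weight_le.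
Qed.

End schur_test.

Section symmetrization.
Context d (T : measurableType d) (R : realType).
Variables (m : {sigma_finite_measure set T -> \bar R}) (A Z : T -> T -> R).
Variables (u v : T -> R).
Hypotheses (mA : measurable_fun setT (fun z => A z.1 z.2))
  (mZ : measurable_fun setT (fun z => Z z.1 z.2)) (iu : integ m u) (iv : integ m v)
  (Z_le : forall a b, `|Z a b| <= u a * v b)
  (Zt_le : forall a b, `|Z b a| <= u a * v b)
  (AZ : forall a b, `|A a b| <= 2^-1 * (Z a b + Z b a)).

(** Schur's test for a quadratic form: [AZ] is going to be |q q'| <= (|q|^2 + |q'|^2) / 2 with a
    symmetric weight. Exchanging the variables shows that both halves have the same integral, so
    that row sums in one variable suffice. *)
Lemma le_Rintegral_symmetrized :
  \int[m]_a \int[m]_b A a b <= \int[m]_a \int[m]_b Z a b.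
Proof.
have mZt : measurable_fun setT (fun z => Z z.2 z.1).
  exact: (measurableT_comp mZ (@measurable_swap _ _ _ _)).
have ZZ : \int[m]_a \int[m]_b Z b a = \int[m]_a \int[m]_b Z a b.
  exact: (Rintegral_swap mZt iu iv Zt_le).
have iZ := integ_Rintegral1 mZ iu iv Z_le.
have iZt := integ_Rintegral1 mZt iu iv Zt_le.
have -> : \int[m]_a \int[m]_b Z a b =
    \int[m]_a \int[m]_b (2^-1 * (Z a b + Z b a)).
  transitivity (\int[m]_a (2^-1 * (\int[m]_b Z a b + \int[m]_b Z b a))).
    rewrite (RintegralZl _ measurableT); last exact: (integD iZ iZt).
    by rewrite (RintegralD measurableT iZ iZt) ZZ; field.
  apply: eq_Rintegral => a _.
  have i1 := integ_section1 mZ iv Z_le a.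
  have i2 := integ_section1 mZt iv Zt_le a.
  rewrite (RintegralZl _ measurableT); last exact: (integD i1 i2).
  by rewrite (RintegralD measurableT i1 i2).
have mV : measurable_fun setT (fun z => 2^-1 * (Z z.1 z.2 + Z z.2 z.1)).
  by apply: measurable_funM => //; exact: measurable_funD.
have Vle a b : `|2^-1 * (Z a b + Z b a)| <= u a * v b.
  rewrite normrM gtr0_norm ?invr_gt0// ler_pdivrMl//.
  rewrite (_ : 2 * _ = u a * v b + u a * v b); last by ring.
  by apply: (le_trans (ler_normD _ _)); apply: lerD.
have Ale a b : `|A a b| <= u a * v b.
  by apply: (le_trans (AZ a b)); apply: le_trans (Vle a b); exact: ler_norm.
apply: (le_Rintegral measurableT).
- exact: (integ_Rintegral1 mA iu iv Ale).
- exact: (integ_Rintegral1 mV iu iv Vle).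
move=> a _; apply: (le_Rintegral measurableT).
- exact: (integ_section1 mA iv Ale a).
- exact: (integ_section1 mV iv Vle a).
- by move=> b _; apply: (le_trans (ler_norm _)).
Qed.

End symmetrization.

Lemma norm_sqr_le_ind (R : realType) (a c : R) (b : bool) :
  `|a| <= c * ind b -> `|a ^+ 2| <= c ^+ 2 * ind b.
Proof.
rewrite /ind normrX; case: b; rewrite ?mulr1 ?mulr0 => h.
  by rewrite ler_pXn2r ?nnegrE//; exact: le_trans h.
by move: h; rewrite normr_le0 => /eqP ->; rewrite normr0 expr0n.
Qed.

(** * Convolution with the dilated kernel *)

Section convolution.
Context {R : realType}.
Notation mu := (@lebesgue_measure R).
Variables (phi : R -> R) (M L : R).
Hypotheses (phiM : forall x, `|phi x| <= M)
  (phiL : forall x y, `|phi x - phi y| <= L * `|x - y|)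
  (phi0 : forall x, 1 <= `|x| -> phi x = 0).

Local Notation kap := (kap phi).

Definition kap_conv (f : measurableTypeR R -> R) (w : plane R) : R :=
  \int[mu]_x (f x * kap w x).

Lemma measurable_kap_conv f : measurable_fun setT f -> measurable_fun setT (kap_conv f).
Proof.
move=> mf; pose H (z : plane R * measurableTypeR R) := f z.2 * kap z.1 z.2.
apply: (@measurable_Rintegral _ _ _ _ _ mu H).
apply: measurable_funM; last exact: measurable_kap phiL.
exact: measurableT_comp.
Qed.

Lemma integ_mul_kap (f : measurableTypeR R -> R) (w : plane R) : measurable_fun setT f ->
  integ mu (fun x => ind (`|w.1 - x| < w.2) * `|f x|) -> 0 < w.2 ->
  integ mu (fun x => f x * kap w x).
Proof.
move=> mf ifw t0; apply: (@integ_dom _ _ _ mu _ (fun x => M / w.2 * (ind (`|w.1 - x| < w.2) * `|f x|))).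
- by apply: measurable_funM => //; exact: measurable_kap1 phiL _.
- exact: integZl.
- move=> x; rewrite normrM mulrC mulrA ler_wpM2r//; exact: kap_le phiM phi0 _ _ _.
Qed.

Lemma kap_conv_le (f : measurableTypeR R -> R) (w : plane R) : measurable_fun setT f ->
  integ mu (fun x => ind (`|w.1 - x| < w.2) * `|f x|) -> 0 < w.2 ->
  `|kap_conv f w| <= M / w.2 * \int[mu]_x (ind (`|w.1 - x| < w.2) * `|f x|).
Proof.
move=> mf ifw t0; rewrite -RintegralZl//; apply: le_norm_Rintegral.
- by apply: measurable_funM => //; exact: measurable_kap1 phiL _.
- exact: integZl.
- move=> x; rewrite normrM mulrC mulrA ler_wpM2r//; exact: kap_le phiM phi0 _ _ _.
Qed.

Lemma kap_conv_le_bounded (g : measurableTypeR R -> R) (G : R) (w : plane R) : measurable_fun setT g ->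
  (forall x, `|g x| <= G) -> 0 < w.2 -> `|kap_conv g w| <= 2 * M * G.
Proof.
move=> mg gG t0.
have G0 : 0 <= G by apply: le_trans (gG 0).
have ig : integ mu (fun x => ind (`|w.1 - x| < w.2) * `|g x|).
  apply: (@integ_dom _ _ _ mu _ (fun x => ind (`|w.1 - x| < w.2) * G)).
  - apply: measurable_funM; last exact: measurableT_comp.
    exact: integ_measurable (integ_ball w.1 w.2).
  - by apply: integZr; exact: integ_ball.
  - by move=> x; rewrite normrM normr_id ger0_norm ?ind_ge0// ler_wpM2l ?ind_ge0.
apply: (le_trans (kap_conv_le mg ig t0)).
have M0 := sup_bound_ge0 phiM.
apply: (@le_trans _ _ (M / w.2 * (2 * w.2 * G))); last first.
  by rewrite le_eqVlt; apply/orP; left; apply/eqP; field; rewrite gt_eqF.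
rewrite ler_wpM2l ?divr_ge0 ?(ltW t0)//.
rewrite -(@Rintegral_ball _ w.1 w.2) ?(ltW t0)// -RintegralZr//; last exact: integ_ball.
apply: le_Rintegral => //; first by apply: integZr; exact: integ_ball.
by move=> x _; rewrite ler_wpM2l ?ind_ge0.
Qed.

End convolution.

(** * The square function estimate by duality *)

Section square_function.
Context {R : realType}.
Notation mu := (@lebesgue_measure R).
Notation nu := (leb2 R).
Variables (phi : R -> R) (M L : R).
Hypotheses (phiM : forall x, `|phi x| <= M)
  (phiL : forall x y, `|phi x - phi y| <= L * `|x - y|)
  (phi0 : forall x, 1 <= `|x| -> phi x = 0)
  (kap_mean : forall w, 0 < w.2 -> \int[mu]_x kap phi w x = 0).
Variables (eps s x0 : R) (chi : plane R -> R).
Hypotheses (e0 : 0 < eps) (mchi : measurable_fun setT chi)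
  (chi0 : forall w, 0 <= chi w) (chi_box : forall w, chi w <= box eps s x0 w).
Variables (g : measurableTypeR R -> R) (G r : R).
Hypotheses (mg : measurable_fun setT g) (G0 : 0 <= G)
  (gG : forall x, `|g x| <= G * ind (`|x0 - x| < r)).

Local Notation kap := (kap phi).
Local Notation kap_corr := (kap_corr phi).
Local Notation box := (box eps s x0).
Local Notation q := (kap_conv phi g).

Let M0 := sup_bound_ge0 phiM.
Let L0 := lipschitz_const_ge0 phiL.

Let chineq0 := chi_neq0 chi0 chi_box.

Let tpos w : chi w != 0 -> 0 < w.2.
Proof. by move=> /chineq0[h _ _]; exact: lt_le_trans h. Qed.

Let a w := chi w / w.2 * q w.

Let ma : measurable_fun setT a.
Proof.
apply: measurable_funM; last exact: measurable_kap_conv phiL _ mg.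
by apply: measurable_funM => //; exact: measurable_funV.
Qed.

Let a_neq0 w : a w != 0 -> chi w != 0.
Proof. by apply: contraNneq; rewrite /a => ->; rewrite !mul0r. Qed.

Let ca := 2 * M * G / eps.

Let ca0 : 0 <= ca. Proof. by rewrite /ca divr_ge0 ?mulr_ge0// ltW. Qed.

Let a_le w : `|a w| <= ca * box w.
Proof.
have [->|aw] := eqVneq (a w) 0; first by rewrite normr0 mulr_ge0// box_ge0.
have cw := a_neq0 aw; have t0 := tpos cw; have [eb _ _] := chineq0 cw.
have gG' x : `|g x| <= G by apply: le_trans (gG x) _; rewrite ler_piMr ?ind_le1.
have qG : `|q w| <= 2 * M * G by apply: kap_conv_le_bounded phiM phiL phi0 _ _ _ _ gG' t0.
rewrite /a !normrM normfV (ger0_norm (chi0 _)) (gtr0_norm t0).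
rewrite (_ : ca * box w = box w / eps * (2 * M * G)); last first.
  by rewrite /ca; field; rewrite gt_eqF.
apply: ler_pM => //; first by rewrite divr_ge0// ltW.
by apply: ler_pM => //; [rewrite invr_ge0 ltW|rewrite lef_pV2].
Qed.

Let kap_le_eps w x : chi w != 0 ->
  `|kap w x| <= M / eps * ind (`|x0 - x| < 2 * s).
Proof.
move=> cw; have t0 := tpos cw; have [a1 a2 a3] := chineq0 cw.
apply: (le_trans (kap_le phiM phi0 x t0)); apply: ler_pM.
- by rewrite divr_ge0// ltW.
- exact: ind_ge0.
- by rewrite ler_wpM2l// lef_pV2.
- apply: le_ind => h.
  rewrite (_ : x0 - x = (x0 - w.1) + (w.1 - x)); last by ring.
  apply: (le_lt_trans (ler_normD _ _)); lra.
Qed.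

Let akap_le w x : `|a w * kap w x| <= ca * (M / eps) * box w * ind (`|x0 - x| < 2 * s).
Proof.
have [->|aw] := eqVneq (a w) 0.
  by rewrite mul0r normr0 !mulr_ge0 ?ind_ge0 ?box_ge0// ?invr_ge0 ltW.
rewrite normrM -mulrA mulrACA.
by apply: ler_pM => //; apply: kap_le_eps; exact: a_neq0.
Qed.

(** This is T^* T g, where T g is [q] and the half plane carries the measure chi dy dt / t. *)
Let h (x : measurableTypeR R) : R := \int[nu]_w (a w * kap w x).

Let mh : measurable_fun setT h.
Proof.
apply: (@measurable_Rintegral _ _ _ _ _ nu (fun z : measurableTypeR R * plane R => a z.2 * kap z.2 z.1)).
apply: measurable_funM; first exact: measurableT_comp.
exact: (measurableT_comp (measurable_kap phiL) (@measurable_swap _ _ _ _)).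
Qed.

Let ch := ca * (M / eps) * \int[nu]_w box w.

Let h_le x : `|h x| <= ch * ind (`|x0 - x| < 2 * s).
Proof.
have ib := @integ_box R eps s x0 e0.
rewrite /ch -RintegralZl// -RintegralZr//; last exact: integZl.
apply: le_norm_Rintegral.
- apply: measurable_funM => //.
  exact: (measurableT_comp (measurable_kap phiL) (pair2_measurable x)).
- by apply: integZr; exact: integZl.
- by move=> w; exact: akap_le.
Qed.

Let square_as_pairing :
  \int[nu]_w (chi w / w.2 * q w ^+ 2) = \int[mu]_x (g x * h x).
Proof.
transitivity (\int[nu]_w \int[mu]_x (a w * (g x * kap w x))).
  apply: eq_Rintegral => w _; rewrite RintegralZl0.
    by rewrite -/(kap_conv phi g w) /a expr2 mulrA.
  move=> aw; apply: integ_mul_kap phiM phiL phi0 _ _ mg _ (tpos (a_neq0 aw)).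
  apply: (@integ_dom _ _ _ mu _ (fun x => G * ind (`|x0 - x| < r))).
  - apply: measurable_funM; last exact: measurableT_comp.
    exact: integ_measurable (integ_ball w.1 w.2).
  - by apply: integZl; exact: integ_ball.
  - move=> x; rewrite normrM normr_id ger0_norm ?ind_ge0//.
    by apply: le_trans (gG x); rewrite ler_piMl ?ind_le1.
rewrite (@Rintegral_swap _ _ _ _ _ nu mu _
  (fun w => ca * (M / eps) * box w) (fun x : measurableTypeR R => G * ind (`|x0 - x| < r))).
- apply: eq_Rintegral => x _; rewrite /h -RintegralZl0.
    by apply: eq_Rintegral => w _; rewrite mulrCA.
  move=> _; apply: (@integ_dom _ _ _ nu _ (fun w => ca * (M / eps) * box w)).
  + apply: measurable_funM => //.
    exact: (measurableT_comp (measurable_kap phiL) (pair2_measurable x)).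
  + by apply: integZl; exact: integ_box.
  + move=> w; apply: (le_trans (akap_le _ _)); rewrite ler_piMr ?ind_le1//.
    by rewrite !mulr_ge0 ?box_ge0// invr_ge0 ltW.
- apply: measurable_funM; first exact: measurableT_comp.
  apply: measurable_funM; last exact: measurable_kap phiL.
  exact: measurableT_comp.
- by apply: integZl; exact: integ_box.
- by apply: integZl; exact: integ_ball.
- move=> w x; rewrite mulrCA normrM mulrC; apply: ler_pM => //.
  apply: (le_trans (akap_le _ _)); rewrite ler_piMr ?ind_le1//.
  by rewrite !mulr_ge0 ?box_ge0// invr_ge0 ltW.
Qed.

Let integ_akap x : integ nu (fun w => a w * kap w x).
Proof.
apply: (@integ_dom _ _ _ nu _ (fun w => ca * (M / eps) * box w)).
- apply: measurable_funM => //.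
  exact: (measurableT_comp (measurable_kap phiL) (pair2_measurable x)).
- by apply: integZl; exact: integ_box.
- move=> w; apply: (le_trans (akap_le _ _)); rewrite ler_piMr ?ind_le1//.
  by rewrite !mulr_ge0 ?box_ge0// invr_ge0 ltW.
Qed.

Let integ_hkap w : chi w != 0 -> integ mu (fun x => h x * kap w x).
Proof.
move=> cw; apply: integ_mul_kap phiM phiL phi0 _ _ mh _ (tpos cw).
apply: (@integ_dom _ _ _ mu _ (fun x => ch * ind (`|x0 - x| < 2 * s))).
- apply: measurable_funM; last exact: measurableT_comp.
  exact: integ_measurable (integ_ball w.1 w.2).
- by apply: integZl; exact: integ_ball.
- move=> x; rewrite normrM normr_id ger0_norm ?ind_ge0//.
  by apply: le_trans (h_le x); rewrite ler_piMl ?ind_le1.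
Qed.

Let kk_bound w w' : chi w != 0 -> chi w' != 0 -> `|kap_corr w w'| <= 2 * M ^+ 2 / eps.
Proof.
move=> cw cw'; have t0 := tpos cw; have t'0 := tpos cw'.
have [eb _ _] := chineq0 cw.
apply: (@le_trans _ _ (\int[mu]_x (M / eps * (M / w'.2 * ind (`|w'.1 - x| < w'.2))))).
  apply: le_norm_Rintegral.
  - by apply: measurable_funM; exact: measurable_kap1 phiL _.
  - by apply: integZl; apply: integZl; exact: integ_ball.
  - move=> x; rewrite normrM; apply: ler_pM => //; last exact: kap_le phiM phi0 _ _ _.
    apply: (le_trans (kap_le phiM phi0 _ t0)).
    apply: (@le_trans _ _ (M / w.2)); last by rewrite ler_wpM2l// lef_pV2.
    by rewrite ler_piMr ?ind_le1// divr_ge0// ltW.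
rewrite RintegralZl//; last by apply: integZl; exact: integ_ball.
rewrite RintegralZl//; last exact: integ_ball.
rewrite Rintegral_ball ?(ltW t'0)// le_eqVlt; apply/orP; left; apply/eqP.
by field; rewrite !gt_eqF.
Qed.

Let integ_akk w : chi w != 0 -> integ nu (fun w' => a w' * kap_corr w w').
Proof.
move=> cw; apply: (@integ_dom _ _ _ nu _ (fun w' => 2 * M ^+ 2 / eps * ca * box w')).
- by apply: measurable_funM => //; exact: measurable_kap_corr1 phiL w.
- by apply: integZl; exact: integ_box.
- move=> w'; have [->|aw'] := eqVneq (a w') 0.
    rewrite mul0r normr0 mulr_ge0 ?box_ge0// mulr_ge0//.
    by rewrite divr_ge0 ?(ltW e0)// mulr_ge0 ?sqr_ge0.
  rewrite normrM mulrC -mulrA; apply: ler_pM => //.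
  by apply: kk_bound => //; exact: a_neq0.
Qed.

(** The two copies of [h] are expanded one after the other, so that each exchange of integrals
    involves only two variables and a dominating function of product form. *)
Let adjoint_square :
  \int[mu]_x (h x ^+ 2) = \int[nu]_w \int[nu]_w' (a w * (a w' * kap_corr w w')).
Proof.
transitivity (\int[mu]_x \int[nu]_w (a w * (h x * kap w x))).
  apply: eq_Rintegral => x _; rewrite expr2 {2}/h -RintegralZl//.
  by apply: eq_Rintegral => w _; rewrite mulrCA.
rewrite (@Rintegral_swap _ _ _ _ _ mu nu _
  (fun x => ch * ind (`|x0 - x| < 2 * s)) (fun w => ca * (M / eps) * box w)).
- apply: eq_Rintegral => w _; rewrite RintegralZl0; last first.
    by move=> /a_neq0; exact: integ_hkap.
  have [->|aw] := eqVneq (a w) 0.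
    by rewrite mul0r; under eq_Rintegral do rewrite mul0r; rewrite Rintegral_cst// mul0r.
  have cw := a_neq0 aw; have t0 := tpos cw.
  rewrite RintegralZl0.
    congr (_ * _); transitivity (\int[mu]_x \int[nu]_w' (a w' * (kap w' x * kap w x))).
      apply: eq_Rintegral => x _; rewrite /h -RintegralZr//.
      by apply: eq_Rintegral => w' _; rewrite mulrA.
    rewrite (@Rintegral_swap _ _ _ _ _ mu nu _
      (fun x => `|kap w x|) (fun w' => ca * (M / eps) * box w')).
    + apply: eq_Rintegral => w' _; rewrite kap_corrC RintegralZl0//.
      by move=> /a_neq0/tpos t'0; apply: integ_kap_corr phiM phiL phi0 _ _ t'0 t0.
    + apply: measurable_funM; first exact: measurableT_comp.
      apply: measurable_funM.
        exact: (measurableT_comp (measurable_kap phiL) (@measurable_swap _ _ _ _)).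
      apply: (measurableT_comp (measurable_kap1 phiL w)) => //.
    + by apply: integ_norm; exact: integ_kap phiM phiL phi0 _ _.
    + by apply: integZl; exact: integ_box.
    + move=> x w'; rewrite mulrA normrM mulrC; apply: ler_pM => //.
      apply: (le_trans (akap_le _ _)); rewrite ler_piMr ?ind_le1//.
      by rewrite !mulr_ge0 ?box_ge0// invr_ge0 ltW.
  by move=> _; exact: integ_akk.
- apply: measurable_funM; first exact: measurableT_comp.
  apply: measurable_funM; first exact: measurableT_comp.
  exact: (measurableT_comp (measurable_kap phiL) (@measurable_swap _ _ _ _)).
- by apply: integZl; exact: integ_ball.
- by apply: integZl; exact: integ_box.
- move=> x w; rewrite mulrCA normrM; apply: ler_pM => //.
  apply: (le_trans (akap_le _ _)); rewrite ler_piMr ?ind_le1//.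
  by rewrite !mulr_ge0 ?box_ge0// invr_ge0 ltW.
Qed.

Let I := \int[nu]_w (chi w / w.2 * q w ^+ 2).

(** The square of [q] is placed on the variable [w] alone; the integral in [w'] is then exactly the
    row sum bounded by [schur]. *)
Let Z w w' := chi w / w.2 * q w ^+ 2 * (chi w' * (`|kap_corr w w'| / w'.2)).

Let zc := (2 * M * G) ^+ 2 / eps * (2 * M ^+ 2 / eps / eps).

Let mZ : measurable_fun setT (fun z => Z z.1 z.2).
Proof.
have mq := measurable_kap_conv phiL mg.
apply: measurable_funM; apply: measurable_funM.
- apply: measurable_funM; first exact: measurableT_comp.
  by apply: measurable_funV; apply: measurableT_comp.
- by apply: measurable_funX; exact: measurableT_comp.
- exact: measurableT_comp.
- apply: measurable_funM.
    by apply: measurableT_comp => //; exact: measurable_kap_corr phiL.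
  by apply: measurable_funV; apply: measurableT_comp.
Qed.

Let q_le w : chi w != 0 -> `|q w| <= 2 * M * G.
Proof.
move=> cw; have gG' x : `|g x| <= G by apply: le_trans (gG x) _; rewrite ler_piMr ?ind_le1.
exact: kap_conv_le_bounded phiM phiL phi0 _ _ _ mg gG' (tpos cw).
Qed.

Let energy_le w : `|chi w / w.2 * q w ^+ 2| <= (2 * M * G) ^+ 2 / eps * box w.
Proof.
have [->|cw] := eqVneq (chi w) 0.
  by rewrite !mul0r normr0 mulr_ge0 ?box_ge0// divr_ge0 ?sqr_ge0// ltW.
have t0 := tpos cw; have [eb _ _] := chineq0 cw.
rewrite !normrM normfV (ger0_norm (chi0 _)) (gtr0_norm t0) mulrC -mulrA.
apply: ler_pM => //.
- by rewrite divr_ge0// ltW.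
- by rewrite expr2; apply: ler_pM => //; exact: q_le.
- rewrite [leRHS]mulrC; apply: ler_pM => //; first by rewrite invr_ge0 ltW.
  by rewrite lef_pV2.
Qed.

Let Z_ge0 w w' : 0 <= Z w w'.
Proof.
rewrite /Z; have [->|cw] := eqVneq (chi w) 0; first by rewrite !mul0r.
have [->|cw'] := eqVneq (chi w') 0; first by rewrite !(mul0r, mulr0).
have t0 := tpos cw; have t'0 := tpos cw'.
rewrite mulr_ge0//; first by rewrite mulr_ge0 ?sqr_ge0// divr_ge0// ltW.
by rewrite mulr_ge0// divr_ge0// ltW.
Qed.

Let Z_le w w' : `|Z w w'| <= zc * box w * box w'.
Proof.
have zc0 : 0 <= zc.
  by rewrite /zc mulr_ge0 ?divr_ge0 ?mulr_ge0 ?sqr_ge0 ?(ltW e0).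
have [cw|cw] := eqVneq (chi w) 0.
  by rewrite /Z cw !mul0r normr0 mulr_ge0 ?box_ge0// mulr_ge0 ?box_ge0.
have [cw'|cw'] := eqVneq (chi w') 0.
  by rewrite /Z cw' !(mul0r, mulr0) normr0 mulr_ge0 ?box_ge0// mulr_ge0 ?box_ge0.
have t0 := tpos cw; have t'0 := tpos cw'; have [eb _ _] := chineq0 cw'.
rewrite /Z normrM (_ : zc * _ * _ = ((2 * M * G) ^+ 2 / eps * box w) * (box w' * (2 * M ^+ 2 / eps / eps))); last by rewrite /zc; ring.
apply: ler_pM => //.
rewrite !normrM normfV normr_id (ger0_norm (chi0 _)) (gtr0_norm t'0).
apply: ler_pM => //; first by rewrite divr_ge0// ltW.
apply: ler_pM => //; first by rewrite invr_ge0 ltW.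
  exact: kk_bound.
by rewrite lef_pV2.
Qed.

Let S := 40 * L * M.

Let integ_energy : integ nu (fun w => chi w / w.2 * q w ^+ 2).
Proof.
apply: (@integ_dom _ _ _ nu _ (fun w => (2 * M * G) ^+ 2 / eps * box w)).
- apply: measurable_funM; last by apply: measurable_funX; exact: measurable_kap_conv phiL _ mg.
  by apply: measurable_funM => //; exact: measurable_funV.
- by apply: integZl; exact: integ_box.
- exact: energy_le.
Qed.

Let izbox : integ nu (fun w => zc * box w).
Proof. by apply: integZl; exact: integ_box. Qed.

Let ibox : integ nu box. Proof. exact: integ_box. Qed.

Let Zt_le w w' : `|Z w' w| <= zc * box w * box w'.
Proof. by rewrite mulrAC. Qed.

Let double_Z : \int[nu]_w \int[nu]_w' Z w w' <= S * I.
Proof.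
rewrite /I -RintegralZl//; apply: le_Rintegral => //.
- exact: integ_Rintegral1 mZ izbox ibox Z_le.
- exact: integZl.
move=> w _; rewrite [leRHS]mulrC /Z.
have [->|cw] := eqVneq (chi w) 0.
  rewrite !mul0r; under eq_Rintegral do rewrite !mul0r.
  by rewrite Rintegral_cst// mul0r.
have t0 := tpos cw.
rewrite RintegralZl//.
  rewrite ler_wpM2l//; first by rewrite mulr_ge0 ?sqr_ge0// divr_ge0// ltW.
  apply: (le_trans (ler_norm _)).
  exact: (schur phiM phiL phi0 kap_mean e0 mchi chi0 chi_box t0).
apply: (@integ_dom _ _ _ nu _ (fun w' => 2 * M ^+ 2 / eps / eps * box w')).
- apply: measurable_funM => //; apply: measurable_funM.
    by apply: measurableT_comp => //; exact: measurable_kap_corr1 phiL w.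
  exact: measurable_funV.
- exact: integZl.
- move=> w'; have [->|cw'] := eqVneq (chi w') 0.
    rewrite mul0r normr0 mulr_ge0 ?box_ge0//.
    by rewrite !divr_ge0 ?(ltW e0)// mulr_ge0 ?sqr_ge0.
  have t'0 := tpos cw'; have [eb _ _] := chineq0 cw'.
  rewrite !normrM normfV normr_id (ger0_norm (chi0 _)) (gtr0_norm t'0) mulrC.
  apply: ler_pM => //; first by rewrite divr_ge0// ltW.
  apply: ler_pM => //; first by rewrite invr_ge0 ltW.
    exact: kk_bound.
  by rewrite lef_pV2.
Qed.

Let adjoint_square_le : \int[mu]_x (h x ^+ 2) <= S * I.
Proof.
rewrite adjoint_square; apply: le_trans double_Z.
pose A w w' := a w * (a w' * kap_corr w w').
have mA : measurable_fun setT (fun z => A z.1 z.2).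
  apply: measurable_funM; first exact: measurableT_comp.
  apply: measurable_funM; first exact: measurableT_comp.
  exact: measurable_kap_corr phiL.
have AV w w' : `|A w w'| <= 2^-1 * (Z w w' + Z w' w).
  have [cw|cw] := eqVneq (chi w) 0.
    by rewrite /A /a cw !mul0r normr0 mulr_ge0 ?invr_ge0// addr_ge0.
  have [cw'|cw'] := eqVneq (chi w') 0.
    by rewrite /A /a cw' !(mul0r, mulr0) normr0 mulr_ge0 ?invr_ge0// addr_ge0.
  have t0 := tpos cw; have t'0 := tpos cw'.
  rewrite (_ : Z w w' + Z w' w =
    (chi w / w.2) * (chi w' / w'.2) * `|kap_corr w w'| * (`|q w| ^+ 2 + `|q w'| ^+ 2)); last first.
    by rewrite /Z (kap_corrC phi w' w) !real_normK ?num_real//; ring.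
  rewrite (_ : `|A w w'| =
    (chi w / w.2) * (chi w' / w'.2) * `|kap_corr w w'| * (`|q w| * `|q w'|)); last first.
    rewrite /A /a !normrM !normfV (ger0_norm (chi0 _)) (ger0_norm (chi0 w')).
    by rewrite (gtr0_norm t0) (gtr0_norm t'0); ring.
  rewrite [leRHS]mulrCA ler_wpM2l//.
    by rewrite mulr_ge0// mulr_ge0// divr_ge0// ltW.
  have := sqr_ge0 (`|q w| - `|q w'|); rewrite sqrrB => hh.
  by rewrite ler_pdivlMl//; lra.
exact: (le_Rintegral_symmetrized mA mZ izbox ibox Z_le Zt_le AV).
Qed.

(** With A = S + 1, pairing and the weighted inequality between the means give I = <g, h> <= A/2
    |g|^2 + |h|^2 / (2 A). As |h|^2 <= S I, the last term is at most I / 2 and is absorbed, which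
    leaves I <= A |g|^2. Adding 1 to [S] keeps the divisor positive when [S] vanishes. *)
Lemma square_function_bound :
  \int[nu]_w (chi w / w.2 * kap_conv phi g w ^+ 2) <=
  (40 * L * M + 1) * \int[mu]_x (g x ^+ 2).
Proof.
rewrite -/I -/S; pose A := S + 1.
have S0 : 0 <= S by rewrite /S mulr_ge0 ?mulr_ge0.
have A0 : 0 < A by rewrite /A ltr_wpDl.
have ch0 : 0 <= ch.
  have ei : 0 <= eps^-1 by rewrite invr_ge0 ltW.
  apply: mulr_ge0; last by apply: Rintegral_ge0 => w _; exact: box_ge0.
  by rewrite mulr_ge0// mulr_ge0.
have igg : integ mu (fun x => g x ^+ 2).
  apply: (@integ_dom _ _ _ mu _ (fun x => G ^+ 2 * ind (`|x0 - x| < r))).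
  - exact: measurable_funX.
  - by apply: integZl; exact: integ_ball.
  - by move=> x; apply: norm_sqr_le_ind; exact: gG.
have ihh : integ mu (fun x => h x ^+ 2).
  apply: (@integ_dom _ _ _ mu _ (fun x => ch ^+ 2 * ind (`|x0 - x| < 2 * s))).
  - exact: measurable_funX.
  - by apply: integZl; exact: integ_ball.
  - by move=> x; apply: norm_sqr_le_ind; exact: h_le.
have amgm : \int[mu]_x (g x * h x) <=
    \int[mu]_x (2^-1 * A * g x ^+ 2 + (2 * A)^-1 * h x ^+ 2).
  have key x : `|g x * h x| <= 2^-1 * A * g x ^+ 2 + (2 * A)^-1 * h x ^+ 2.
    have E : 2^-1 * A * g x ^+ 2 + (2 * A)^-1 * h x ^+ 2 - `|g x * h x| =
        (2 * A)^-1 * (A * `|g x| - `|h x|) ^+ 2.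
      rewrite normrM -[g x ^+ 2]real_normK ?num_real// -[h x ^+ 2]real_normK ?num_real//.
      by field; rewrite gt_eqF.
    by rewrite -subr_ge0 E mulr_ge0 ?sqr_ge0// invr_ge0 mulr_ge0// ltW.
  have i2 : integ mu (fun x => 2^-1 * A * g x ^+ 2 + (2 * A)^-1 * h x ^+ 2).
    by apply: integD; exact: integZl.
  apply: le_Rintegral => //.
    apply: (@integ_dom _ _ _ mu _ _ _ i2) => //; exact: measurable_funM.
  by move=> x _; apply: (le_trans (ler_norm _)).
have I0 : 0 <= I.
  apply: Rintegral_ge0 => w _; have [->|cw] := eqVneq (chi w) 0; first by rewrite !mul0r.
  by rewrite mulr_ge0 ?sqr_ge0// divr_ge0// ltW// tpos.
have := amgm; rewrite -square_as_pairing -/I RintegralD//; [|exact: integZl..].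
rewrite !RintegralZl// => H.
have : (2 * A)^-1 * \int[mu]_x h x ^+ 2 <= 2^-1 * I.
  rewrite invfM -mulrA ler_pM2l ?invr_gt0// ler_pdivrMl//.
  by apply: (le_trans adjoint_square_le); rewrite ler_wpM2r// /A lerDl.
move=> H2; have : I <= 2^-1 * A * \int[mu]_x g x ^+ 2 + 2^-1 * I.
  by apply: (le_trans H); rewrite lerD2l.
rewrite -/A -mulrA; lra.
Qed.

End square_function.

(** * Averaging at the scale of the good set *)

Section vertical_distance.
Context {R : realType}.
Variables (E : set (plane R)) (eps : R).
Hypotheses (E0 : E !=set0) (Eeps : forall w, E w -> eps <= w.2).

(* Half the height over x of the sawtooth under E. The integral of |f| over balls
   of radius at least 2 * vdist E x about x is controlled when it is so for the
   points of E; being 1/2-Lipschitz, vdist is a legitimate averaging scale. *)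
Definition vdist (x : R) : R := 2^-1 * inf [set w.2 + `|x - w.1| | w in E].

Let S x := [set w.2 + `|x - w.1| | w in E].

Let lbS x : lbound (S x) eps.
Proof.
by move=> _ [w Ew <-]; apply: (le_trans (Eeps Ew)); rewrite lerDl.
Qed.

Let S0 x : S x !=set0.
Proof. by have [w Ew] := E0; exists (w.2 + `|x - w.1|), w. Qed.

Let infS x : has_inf (S x). Proof. by split => //; exists eps. Qed.

Lemma vdist_ge x : eps / 2 <= vdist x.
Proof.
rewrite /vdist mulrC ler_pM2l ?invr_gt0//.
exact: (lb_le_inf (S0 x) (@lbS x)).
Qed.

Lemma vdist_le w x : E w -> 2 * vdist x <= w.2 + `|x - w.1|.
Proof.
move=> Ew; rewrite mulVKf//; apply: ge_inf; first by exists eps; exact: lbS.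
by exists w.
Qed.

(** The infimum equals [2 * vdist E x] and is positive thanks to eps, so its double is not a lower
    bound and some point of [E] lies below it. *)
Lemma vdist_near x : 0 < eps -> exists2 w, E w & w.2 + `|x - w.1| < 4 * vdist x.
Proof.
move=> e0; have [|_ [w Ew <-] h] := @inf_adherent _ (S x) (2 * vdist x) _ (infS x).
  by rewrite mulr_gt0// (lt_le_trans _ (vdist_ge x))// divr_gt0.
exists w => //; apply: (lt_le_trans h).
by rewrite -/(S x) /vdist -/(S x); lra.
Qed.

(** An infimum of 1-Lipschitz functions is 1-Lipschitz; the 1/2 is the factor in [vdist]. *)
Lemma vdist_lip x y : `|vdist x - vdist y| <= 2^-1 * `|x - y|.
Proof.
have key u v : vdist u - vdist v <= 2^-1 * `|u - v|.
  rewrite -mulrBr ler_pM2l ?invr_gt0// lerBlDr addrC -lerBlDr.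
  apply: (lb_le_inf (S0 v)) => // _ [w Ew <-]; rewrite lerBlDr -addrA.
  apply: (@le_trans _ _ (w.2 + `|u - w.1|)).
    by apply: ge_inf; [exists eps; exact: lbS|exists w].
  rewrite lerD2l (_ : u - w.1 = (v - w.1) + (u - v)); last by ring.
  exact: ler_normD.
rewrite ler_norml key andbT lerNl opprB distrC; exact: key.
Qed.

End vertical_distance.

Lemma lef_pXV (R : realType) (n : nat) (a b : R) :
  0 < a -> a <= b -> b ^- n <= a ^- n.
Proof.
move=> a0 ab; have b0 := lt_le_trans a0 ab.
by rewrite lef_pV2 ?posrE ?exprn_gt0// lerXn2r ?nnegrE// ltW.
Qed.

Section averaging.
Context {R : realType}.
Notation mu := (@lebesgue_measure R).
Notation nu := (leb2 R).
Variables (phi : R -> R) (M L : R).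
Hypotheses (phiM : forall x, `|phi x| <= M)
  (phiL : forall x y, `|phi x - phi y| <= L * `|x - y|)
  (phi0 : forall x, 1 <= `|x| -> phi x = 0)
  (kap_mean : forall w, 0 < w.2 -> \int[mu]_x kap phi w x = 0).
Variables (f N : measurableTypeR R -> R).
Hypotheses (mf : measurable_fun setT f) (mN : measurable_fun setT N)
  (fN : forall x, `|f x| <= N x)
  (iN : forall c r : R, integ mu (fun x : measurableTypeR R => ind (`|c - x| < r) * N x)).
Variables (lam eps s x0 : R) (chi : plane R -> R).
Hypotheses (e0 : 0 < eps) (s0 : 0 < s) (lam0 : 0 <= lam) (mchi : measurable_fun setT chi)
  (chi0 : forall w, 0 <= chi w) (chi1 : forall w, chi w <= 1)
  (chi_supp : forall w, chi w != 0 -> eps <= w.2 /\ `|x0 - w.1| < s - w.2)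
  (chi_good : forall (w : plane R) (r : R), chi w != 0 -> w.2 <= r ->
    \int[mu]_x (ind (`|w.1 - x| < r) * N x) <= lam * r).
Variables (dl : R -> R).
Hypotheses (dl0 : forall x, eps / 2 <= dl x)
  (dl_lip : forall x y, `|dl x - dl y| <= 2^-1 * `|x - y|)
  (dl_good : forall x,
    \int[mu]_z (ind (`|x - z| < 2 * dl x) * N z) <= 6 * lam * dl x)
  (dl_chi : forall w x, chi w != 0 -> 2 * dl x <= w.2 + `|x - w.1|).

Local Notation kap := (kap phi).

Let M0 := sup_bound_ge0 phiM.
Let L0 := lipschitz_const_ge0 phiL.

Let N0 x : 0 <= N x. Proof. exact: le_trans (fN x). Qed.

Let dlpos x : 0 < dl x.
Proof. by apply: lt_le_trans (dl0 x); rewrite divr_gt0. Qed.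

Let mdl : measurable_fun [set: measurableTypeR R] dl.
Proof. exact: lipschitz_measurable dl_lip. Qed.

Let tpos w : chi w != 0 -> 0 < w.2.
Proof. by move=> /chi_supp[h _]; exact: lt_le_trans h. Qed.

Let chi_box w : chi w <= box eps s x0 w.
Proof.
have [->|cw] := eqVneq (chi w) 0; first exact: box_ge0.
have [h1 h2] := chi_supp cw; have t0 := tpos cw.
have h3 : w.2 <= s by have := le_lt_trans (normr_ge0 _) h2; lra.
have h4 : `|x0 - w.1| < s by apply: lt_le_trans h2 _; lra.
by apply: le_trans (chi1 w) _; rewrite /box /ind h1 h3 h4 mulr1.
Qed.

(* The kernel of the average whose scale dl x' depends on the source point x', so that
   it preserves the integral of each piece of f; spread f is bounded by a multiple
   of lam, while f - spread f is seen by kap only through its Lipschitz constant. *)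
Definition avk (x' x : R) : R := (2 * dl x')^-1 * ind (`|x' - x| < dl x').

Lemma avk_ge0 x' x : 0 <= avk x' x.
Proof. by rewrite mulr_ge0 ?ind_ge0// invr_ge0 mulr_ge0// ltW. Qed.

Lemma measurable_avk :
  measurable_fun setT (fun z : measurableTypeR R * measurableTypeR R => avk z.1 z.2).
Proof.
apply: measurable_funM.
  by apply: measurable_funV; apply: measurable_funM => //; exact: measurableT_comp.
apply: measurable_ind; apply: measurable_fun_ltr; last exact: measurableT_comp.
by apply: measurableT_comp => //; exact: measurable_funB.
Qed.

Lemma integ_avk x' : integ mu (avk x').
Proof. by apply: integZl; exact: integ_ball. Qed.

Lemma Rintegral_avk x' : \int[mu]_x avk x' x = 1.
Proof.
rewrite RintegralZl//; last exact: integ_ball.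
by rewrite Rintegral_ball ?(ltW (dlpos _))// mulVf// mulf_neq0// gt_eqF.
Qed.

Definition spread (x : measurableTypeR R) : R := \int[mu]_x' (f x' * avk x' x).

Lemma measurable_spread : measurable_fun setT spread.
Proof.
apply: (@measurable_Rintegral _ _ _ _ _ mu
  (fun z : measurableTypeR R * measurableTypeR R => f z.2 * avk z.2 z.1)).
apply: measurable_funM; first exact: measurableT_comp.
exact: (measurableT_comp measurable_avk (@measurable_swap _ _ _ _)).
Qed.

(** If |z - x| < dl z, the Lipschitz bound gives dl x < 3/2 dl z and dl z < 2 dl x. So only z within
    [2 * dl x] of x contribute, with density at most 3 / (4 dl x); against the mass [6 * lam * dl x]
    from [dl_good] this gives 9/2 lam. *)
Lemma spread_le x : `|spread x| <= 9 / 2 * lam.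
Proof.
have d0 := dlpos x.
apply: (@le_trans _ _ (\int[mu]_z (3 / 4 / dl x * (ind (`|x - z| < 2 * dl x) * N z)))).
  apply: le_norm_Rintegral.
  - apply: measurable_funM => //.
    exact: (measurableT_comp measurable_avk (pair2_measurable x)).
  - by apply: integZl; exact: iN.
  - move=> z; rewrite normrM (ger0_norm (avk_ge0 _ _)) mulrC mulrA.
    apply: ler_pM => //; first exact: avk_ge0.
    rewrite /avk; case: (ltP (`|z - x|) (dl z)) => h; last first.
      rewrite /ind mulr0 mulr_ge0 ?ler0n// divr_ge0 ?(ltW d0)//; lra.
    have := dl_lip x z; rewrite (distrC x z) ler_norml => /andP[h1 h2].
    have dz := dlpos z.
    rewrite (_ : `|z - x| < 2 * dl x) ?mulr1; last by lra.
    rewrite (_ : 3 / 4 / dl x = (4 / 3 * dl x)^-1); last by field; rewrite gt_eqF.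
    rewrite lef_pV2 ?posrE ?mulr_gt0//; lra.
rewrite (RintegralZl _ measurableT (iN x (2 * dl x))).
apply: (@le_trans _ _ (3 / 4 / dl x * (6 * lam * dl x))).
  by rewrite ler_wpM2l// divr_ge0 ?(ltW d0)//; lra.
by rewrite le_eqVlt; apply/orP; left; apply/eqP; field; rewrite gt_eqF.
Qed.

(** The cutoff gives [g] a square integral of order lam^2 s. It leaves the convolution unchanged on
    the support of [chi], since there [kap w] lives over |x0 - x| < s by [near_support]. *)
Let g (x : measurableTypeR R) : R := spread x * ind (`|x0 - x| < s).

Let mg : measurable_fun setT g.
Proof.
apply: measurable_funM; first exact: measurable_spread.
exact: integ_measurable (integ_ball x0 s).
Qed.

Let gG x : `|g x| <= 9 / 2 * lam * ind (`|x0 - x| < s).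
Proof.
by rewrite /g normrM (ger0_norm (ind_ge0 _ _)) ler_wpM2r ?ind_ge0 ?spread_le.
Qed.

Let near_support w x : chi w != 0 -> kap w x != 0 -> `|x0 - x| < s.
Proof.
move=> cw k0; have := kap_neq0 phi0 (tpos cw) k0; have [_ h2] := chi_supp cw.
rewrite (_ : x0 - x = (x0 - w.1) + (w.1 - x)); last by ring.
by move=> h; apply: (le_lt_trans (ler_normD _ _)); lra.
Qed.

(** For d = |w.1 - x'| one has d < w.2 + dl x' and 2 dl x' <= w.2 + d, whence d < 3 w.2. *)
Let avk_support w x x' : chi w != 0 -> kap w x != 0 -> avk x' x != 0 ->
  `|w.1 - x'| < 3 * w.2.
Proof.
move=> cw k0 a0; have h1 := kap_neq0 phi0 (tpos cw) k0.
have h2 : `|x' - x| < dl x'.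
  by apply: contraNT a0; rewrite /avk /ind => /negbTE ->; rewrite mulr0.
have := dl_chi x' cw; rewrite (distrC x').
have : `|w.1 - x'| <= `|w.1 - x| + `|x' - x|.
  rewrite (_ : w.1 - x' = (w.1 - x) - (x' - x)); last by ring.
  exact: ler_normB.
lra.
Qed.

Let avk_dom w x x' : chi w != 0 -> kap w x != 0 ->
  avk x' x <= eps^-1 * ind (`|w.1 - x'| < 3 * w.2).
Proof.
move=> cw k0; have [->|a0] := eqVneq (avk x' x) 0.
  by rewrite mulr_ge0 ?ind_ge0// invr_ge0 ltW.
rewrite (avk_support cw k0 a0) /avk {2}/ind mulr1.
have d0 := dl0 x'; have dp := dlpos x'.
apply: (@le_trans _ _ (2 * dl x')^-1).
  by rewrite ler_piMr ?ind_le1// invr_ge0 mulr_ge0// ltW.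
by rewrite lef_pV2 ?posrE ?mulr_gt0//; lra.
Qed.

(** Fubini moves the averaging from f to the kernel: f minus its average, tested against [kap w], is
    f tested against [kap w] minus the mean of [kap w] over the ball of radius [dl x'] about x'. *)
Let kap_conv_spread w : chi w != 0 ->
  kap_conv phi g w = \int[mu]_x' (f x' * \int[mu]_x (avk x' x * kap w x)).
Proof.
move=> cw; have t0 := tpos cw.
have ik := integ_kap phiM phiL phi0 t0.
transitivity (\int[mu]_x \int[mu]_x' (f x' * (avk x' x * kap w x))).
  apply: eq_Rintegral => x _; rewrite /g.
  have [->|k0] := eqVneq (kap w x) 0.
    rewrite mulr0; under eq_Rintegral do rewrite !mulr0.
    by rewrite Rintegral_cst// mul0r.
  rewrite (near_support cw k0) /ind mulr1 /spread -RintegralZr//.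
    by apply: eq_Rintegral => x' _; rewrite mulrA.
  apply: (@integ_dom _ _ _ mu _ (fun z => eps^-1 * (ind (`|w.1 - z| < 3 * w.2) * N z))).
  - apply: measurable_funM => //.
    exact: (measurableT_comp measurable_avk (pair2_measurable x)).
  - by apply: integZl; exact: iN.
  - move=> z; rewrite normrM (ger0_norm (avk_ge0 _ _)) mulrC mulrA.
    by apply: ler_pM => //; [exact: avk_ge0|exact: avk_dom].
rewrite (@Rintegral_swap _ _ _ _ _ mu mu _ (fun x => `|kap w x|)
  (fun z => eps^-1 * (ind (`|w.1 - z| < 3 * w.2) * N z))).
- apply: eq_Rintegral => x' _; rewrite RintegralZl0// => _.
  apply: (@integ_dom _ _ _ mu _ (fun x => (2 * dl x')^-1 * `|kap w x|)).
  + apply: measurable_funM; last exact: measurable_kap1 phiL w.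
    exact: (measurableT_comp measurable_avk (pair1_measurable x')).
  + by apply: integZl; exact: integ_norm.
  + move=> x; rewrite normrM (ger0_norm (avk_ge0 _ _)) ler_wpM2r//.
    by rewrite ler_piMr ?ind_le1// invr_ge0 mulr_ge0// ltW.
- apply: measurable_funM; first exact: measurableT_comp.
  apply: measurable_funM.
    exact: (measurableT_comp measurable_avk (@measurable_swap _ _ _ _)).
  by apply: measurableT_comp => //; exact: measurable_kap1 phiL w.
- exact: integ_norm.
- by apply: integZl; exact: iN.
- move=> x z; have [->|k0] := eqVneq (kap w x) 0; first by rewrite !mulr0 normr0 mul0r.
  rewrite mulrA normrM [leRHS]mulrC ler_wpM2r// normrM (ger0_norm (avk_ge0 _ _)) mulrC mulrA.
  by apply: ler_pM => //; [exact: avk_ge0|exact: avk_dom].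
Qed.

Let J (w : plane R) (x : measurableTypeR R) : R :=
  ind (`|w.1 - x| < 3 * w.2) * (N x * dl x).

Let mJ : measurable_fun setT (fun z : plane R * measurableTypeR R => J z.1 z.2).
Proof.
apply: measurable_funM.
  apply: measurable_ind; apply: measurable_fun_ltr.
    apply: measurableT_comp => //; apply: measurable_funB => //.
    exact: measurableT_comp.
  by apply: measurable_funM => //; exact: measurableT_comp.
apply: measurable_funM; first exact: (measurableT_comp mN).
exact: (measurableT_comp mdl).
Qed.

Let J_ge0 w x : 0 <= J w x.
Proof. by rewrite mulr_ge0 ?ind_ge0// mulr_ge0// ltW. Qed.

Let J_le w x : chi w != 0 ->
  J w x <= 2 * w.2 * (ind (`|w.1 - x| < 3 * w.2) * N x).
Proof.
move=> cw; rewrite /J /ind; case: (ltP (`|w.1 - x|) (3 * w.2)) => h; last first.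
  by rewrite !mul0r mulr0.
rewrite !mul1r mulrC ler_wpM2r//.
by have := dl_chi x cw; rewrite distrC; lra.
Qed.

Let integ_J w : chi w != 0 -> integ mu (J w).
Proof.
move=> cw; apply: (@integ_dom _ _ _ mu _
  (fun x => 2 * w.2 * (ind (`|w.1 - x| < 3 * w.2) * N x))).
- exact: (measurableT_comp mJ (pair1_measurable w)).
- by apply: integZl; exact: iN.
- by move=> x; rewrite ger0_norm// J_le.
Qed.

(** Up to the factor L this bounds the change of the convolution at w: from the centre x of an
    averaging ball, of radius [dl x], the kernel varies by at most [L / w.2 ^+ 2 * dl x]. *)
Let err (w : plane R) : R := w.2 ^- 2 * \int[mu]_x J w x.

Let err_ge0 w : 0 <= err w.
Proof. by rewrite mulr_ge0 ?invr_ge0 ?sqr_ge0//; apply: Rintegral_ge0 => x _. Qed.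

Let merr : measurable_fun setT err.
Proof.
apply: measurable_funM; first by apply: measurable_funV; exact: measurable_funX.
exact: measurable_Rintegral mJ.
Qed.

(** Where |w.1 - x| < 3 w.2 the scale [dl x] is at most 2 w.2, and by [chi_good] the mass of [N]
    there is at most 3 lam w.2. *)
Let err_le w : chi w != 0 -> err w <= 6 * lam.
Proof.
move=> cw; have t0 := tpos cw.
have h : \int[mu]_x J w x <= 2 * w.2 * (lam * (3 * w.2)).
  apply: (@le_trans _ _ (\int[mu]_x (2 * w.2 * (ind (`|w.1 - x| < 3 * w.2) * N x)))).
    apply: (le_Rintegral measurableT (integ_J cw)); last by move=> x _; exact: J_le.
    by apply: integZl; exact: iN.
  rewrite (RintegralZl _ measurableT (iN w.1 (3 * w.2))).
  apply: ler_wpM2l; first by rewrite mulr_ge0// ltW.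
  by apply: chi_good => //; lra.
rewrite /err mulrC ler_pdivrMr ?exprn_gt0//; apply: (le_trans h).
by rewrite le_eqVlt; apply/orP; left; apply/eqP; ring.
Qed.

Let kap_conv_diff w : chi w != 0 -> `|kap_conv phi f w - kap_conv phi g w| <= L * err w.
Proof.
move=> cw; have t0 := tpos cw.
have ik := integ_kap phiM phiL phi0 t0.
have iak x' : integ mu (fun x => avk x' x * kap w x).
  apply: (@integ_dom _ _ _ mu _ (fun x => (2 * dl x')^-1 * `|kap w x|)).
  + apply: measurable_funM; last exact: measurable_kap1 phiL w.
    exact: (measurableT_comp measurable_avk (pair1_measurable x')).
  + by apply: integZl; exact: integ_norm.
  + move=> x; rewrite normrM (ger0_norm (avk_ge0 _ _)) ler_wpM2r//.
    by rewrite ler_piMr ?ind_le1// invr_ge0 mulr_ge0// ltW.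
pose V x' := \int[mu]_x (avk x' x * kap w x).
have mV : measurable_fun [set: measurableTypeR R] V.
  apply: (@measurable_Rintegral _ _ _ _ _ mu
    (fun z : measurableTypeR R * measurableTypeR R => avk z.1 z.2 * kap w z.2)).
  apply: measurable_funM; first exact: measurable_avk.
  by apply: measurableT_comp => //; exact: measurable_kap1 phiL w.
have Vdiff x' : `|kap w x' - V x'| <= L / w.2 ^+ 2 * (ind (`|w.1 - x'| < 3 * w.2) * dl x').
  have [h|h] := ltP (`|w.1 - x'|) (3 * w.2); last first.
    have k0 : kap w x' = 0.
      by apply/eqP; apply/negPn/negP => /(kap_neq0 phi0 t0); lra.
    have V0 : V x' = 0.
      rewrite /V (@eq_Rintegral _ _ _ _ _ (cst 0)); last first.
        move=> x _ /=; apply/eqP; rewrite mulf_eq0; apply/negPn/negP.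
        rewrite negb_or => /andP[a0 kk0].
        by have := avk_support cw kk0 a0; lra.
      by rewrite Rintegral_cst// mul0r.
    by rewrite k0 V0 subr0 normr0 /ind mul0r mulr0.
  rewrite /ind mul1r.
  have -> : kap w x' - V x' = \int[mu]_x (avk x' x * (kap w x' - kap w x)).
    under eq_Rintegral do rewrite mulrBr.
    rewrite (RintegralB measurableT (integZr _ (integ_avk x')) (iak x')).
    by rewrite (RintegralZr _ measurableT (integ_avk x')) Rintegral_avk mul1r.
  apply: (@le_trans _ _ (\int[mu]_x (avk x' x * (L / w.2 ^+ 2 * dl x')))).
    apply: le_norm_Rintegral.
    - apply: measurable_funM.
        exact: (measurableT_comp measurable_avk (pair1_measurable x')).
      by apply: measurable_funB => //; exact: measurable_kap1 phiL w.
    - by apply: integZr; exact: integ_avk.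
    - move=> x; rewrite normrM (ger0_norm (avk_ge0 _ _)).
      have [->|a0] := eqVneq (avk x' x) 0; first by rewrite !mul0r.
      rewrite ler_wpM2l ?avk_ge0//; apply: (le_trans (kap_lip phiL _ _ t0)).
      rewrite ler_wpM2l//; first by rewrite divr_ge0// exprn_ge0// ltW.
      rewrite ltW//; apply: contraNT a0; rewrite /avk /ind => /negbTE ->.
      by rewrite mulr0.
  by rewrite (RintegralZr _ measurableT (integ_avk x')) Rintegral_avk mul1r.
have ifk : integ mu (fun x => f x * kap w x).
  apply: integ_mul_kap phiM phiL phi0 _ _ mf _ t0.
  apply: (@integ_dom _ _ _ mu _ (fun x => ind (`|w.1 - x| < w.2) * N x)) => //.
    apply: measurable_funM; last exact: measurableT_comp.
    exact: integ_measurable (integ_ball w.1 w.2).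
  by move=> x; rewrite normrM normr_id ger0_norm ?ind_ge0// ler_wpM2l ?ind_ge0.
have dom x : `|f x * (kap w x - V x)| <= L / w.2 ^+ 2 * J w x.
  rewrite (_ : L / w.2 ^+ 2 * J w x =
    N x * (L / w.2 ^+ 2 * (ind (`|w.1 - x| < 3 * w.2) * dl x))); last by rewrite /J; ring.
  by rewrite normrM; apply: ler_pM.
have ifd : integ mu (fun x => f x * (kap w x - V x)).
  apply: (@integ_dom _ _ _ mu _ (fun x => L / w.2 ^+ 2 * J w x)) => //.
    apply: measurable_funM => //; apply: measurable_funB => //.
    exact: measurable_kap1 phiL w.
  by apply: integZl; exact: integ_J.
have ifV : integ mu (fun x => f x * V x).
  apply: eq_integrable (integB ifk ifd) => // x _ /=.
  by congr EFin; rewrite mulrBr opprB addrC subrK.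
rewrite kap_conv_spread// -/(V _).
have -> : kap_conv phi f w - \int[mu]_x' (f x' * V x') = \int[mu]_x (f x * (kap w x - V x)).
  rewrite /kap_conv -(RintegralB measurableT ifk ifV).
  by apply: eq_Rintegral => x _; rewrite mulrBr.
rewrite /err mulrA -(RintegralZl _ measurableT (integ_J cw)).
apply: le_norm_Rintegral => //; first exact: integ_measurable ifd.
by apply: integZl; exact: integ_J.
Qed.

(** If |w.1 - x| < 3 w.2 on the support of [chi], then 2 dl x <= w.2 + |x - w.1| forces w.2 >= dl x
    / 2. A slice of the cone has length 6 t, and 6 t^-2 integrates over t >= dl x / 2 to at most 12
    / dl x. This cancels the factor [dl x] of [J]. *)
Let column_mass (x : R) :
  `|\int[nu]_w (chi w / w.2 ^+ 3 * ind (`|w.1 - x| < 3 * w.2))| <=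
  12 / dl x * ind (`|x0 - x| < 3 * s).
Proof.
have d0 := dlpos x.
have far w : chi w != 0 -> `|w.1 - x| < 3 * w.2 -> `|x0 - x| < 3 * s.
  move=> cw h; have [_ h2] := chi_supp cw.
  have := le_lt_trans (normr_ge0 _) h2.
  rewrite (_ : x0 - x = (x0 - w.1) + (w.1 - x)); last by ring.
  by move=> h3; apply: (le_lt_trans (ler_normD _ _)); lra.
have [h|h] := ltP (`|x0 - x|) (3 * s); last first.
  rewrite (@eq_Rintegral _ _ _ _ _ (cst 0)); last first.
    move=> w _ /=; apply/eqP; rewrite mulf_eq0 mulf_eq0 -orbA; apply/negPn/negP.
    rewrite !negb_or => /and3P[cw _]; rewrite /ind.
    case: (ltP (`|w.1 - x|) (3 * w.2)) => [hh _|_]; last by rewrite eqxx.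
    by have := far w cw hh; lra.
  by rewrite Rintegral_cst// mul0r normr0 /ind mulr0.
rewrite /ind mulr1.
pose G t : R := ind (dl x / 2 <= t <= s) * t ^- 3.
have mG : measurable_fun [set: measurableTypeR R] G.
  apply: measurable_funM.
    by apply: measurable_ind; apply: measurable_and; exact: measurable_fun_ler.
  by apply: measurable_funV; exact: measurable_funX.
have tG t : dl x / 2 <= t <= s -> 0 < t.
  by move=> /andP[h1 _]; apply: lt_le_trans h1; rewrite divr_gt0.
have G0 t : 0 <= G t.
  rewrite /G /ind; case: (boolP (dl x / 2 <= t <= s)) => [/tG t0|_]; last by rewrite mul0r.
  by rewrite mul1r invr_ge0 exprn_ge0// ltW.
apply: (@le_norm_Rintegral_ereal _ _ _ nu _ (fun w => G w.2 * ind (`|x - w.1| < 3 * w.2))).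
- apply: measurable_funM; first by apply: measurable_funM => //; apply: measurable_funV; exact: measurable_funX.
  apply: measurable_ind; apply: measurable_fun_ltr; last exact: measurable_funM.
  by apply: measurableT_comp => //; exact: measurable_funB.
- apply: measurable_funM; first exact: (measurableT_comp mG).
  apply: measurable_ind; apply: measurable_fun_ltr; last exact: measurable_funM.
  by apply: measurableT_comp => //; exact: measurable_funB.
- move=> w; rewrite distrC; have [hx|hx] := ltP (`|x - w.1|) (3 * w.2); last first.
    by rewrite /ind !mulr0 normr0.
  have [->|cw] := eqVneq (chi w) 0; first by rewrite !mul0r normr0 mulr_ge0 ?ind_ge0.
  have t0 := tpos cw; have [_ h2] := chi_supp cw.
  have h3 := le_lt_trans (normr_ge0 _) h2.
  have h4 := dl_chi x cw.
  have cond : dl x / 2 <= w.2 <= s by apply/andP; split; lra.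
  rewrite /G /ind cond mul1r !mulr1 normrM normfV (ger0_norm (chi0 _)) gtr0_norm ?exprn_gt0//.
  by rewrite ler_piMl// invr_ge0 exprn_ge0// ltW.
- rewrite (@integral_cone _ _ G (fun t => 3 * t))//; last 2 first.
  + exact: measurable_funM.
  + move=> t; rewrite /G /ind; case: (boolP (dl x / 2 <= t <= s)) => [/tG t0 _|_].
      by rewrite mulr_ge0// ltW.
    by rewrite mul0r eqxx.
  have mI : measurable_fun [set: measurableTypeR R] (fun t => ind (dl x / 2 <= t <= s) * t ^- 2 : R).
    apply: measurable_funM.
      by apply: measurable_ind; apply: measurable_and; exact: measurable_fun_ler.
    by apply: measurable_funV; exact: measurable_funX.
  rewrite (eq_integral (fun t : measurableTypeR R => 6%:E * (ind (dl x / 2 <= t <= s) * t ^- 2)%:E)%E); last first.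
    move=> t _; rewrite -EFinM; congr EFin; rewrite /G /ind.
    case: (boolP (dl x / 2 <= t <= s)) => [/tG t0|_]; last by rewrite !mul0r mulr0.
    by field; rewrite gt_eqF.
  rewrite ge0_integralZl_EFin//; last 2 first.
  + by move=> t _; rewrite lee_fin mulr_ge0 ?ind_ge0// invr_ge0 sqr_ge0.
  + exact/measurable_EFinP.
  rewrite integral_ind_itv.
  apply: (@le_trans _ _ (6%:E * ((dl x / 2)^-1)%:E)%E).
    by rewrite lee_wpmul2l ?integral_inv_sqr_le// divr_gt0.
  by rewrite -EFinM lee_fin le_eqVlt; apply/orP; left; apply/eqP; field; rewrite gt_eqF.
Qed.

(** Exchanging the integrals and using [column_mass] leaves 12 times the mass of [N] on |x0 - x| < 3
    s. Since the mass is controlled only about points of the support of [chi], this ball is enclosed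
    in one of radius 4 s about such a point [w1]. *)
Let int_err : \int[nu]_w (chi w / w.2 * err w) <= 48 * lam * s.
Proof.
have [[w1 cw1]|nochi] := pselect (exists w, chi w != 0); last first.
  rewrite (@eq_Rintegral _ _ _ _ _ (cst 0)); last first.
    move=> w _ /=; have [->|cw] := eqVneq (chi w) 0; first by rewrite !mul0r.
    by exfalso; apply: nochi; exists w.
  by rewrite Rintegral_cst// mul0r !mulr_ge0// ltW.
pose H w x := chi w / w.2 ^+ 3 * J w x.
have ibox := @integ_box R eps s x0 e0.
pose u w := eps ^- 3 * box eps s x0 w.
pose v (x : measurableTypeR R) := 2 * s * (ind (`|x0 - x| < 3 * s) * N x).
have iu : integ nu u by exact: integZl.
have iv : integ mu v by apply: integZl; exact: iN.
have Hle w x : `|H w x| <= u w * v x.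
  have u0 : 0 <= u w by rewrite mulr_ge0 ?box_ge0// invr_ge0 exprn_ge0// ltW.
  have v0 : 0 <= v x by rewrite mulr_ge0 ?mulr_ge0 ?ind_ge0// ltW.
  have [c0|cw] := eqVneq (chi w) 0; first by rewrite /H c0 !mul0r normr0 mulr_ge0.
  have t0 := tpos cw; have [h1 h2] := chi_supp cw.
  have h3 := le_lt_trans (normr_ge0 _) h2.
  rewrite /H normrM; apply: ler_pM => //.
    rewrite normrM normfV (ger0_norm (chi0 _)) gtr0_norm ?exprn_gt0// mulrC.
    apply: ler_pM => //; first by rewrite invr_ge0 exprn_ge0// ltW.
    exact: lef_pXV.
  rewrite ger0_norm//; apply: (le_trans (J_le _ cw)).
  apply: ler_pM; rewrite ?mulr_ge0 ?ind_ge0 ?(ltW t0)//.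
    by rewrite ler_pM2l//; lra.
  rewrite ler_wpM2r//; apply: le_ind => h.
  rewrite (_ : x0 - x = (x0 - w.1) + (w.1 - x)); last by ring.
  by apply: (le_lt_trans (ler_normD _ _)); lra.
have mH : measurable_fun setT (fun z : plane R * measurableTypeR R => H z.1 z.2).
  apply: measurable_funM => //; apply: measurable_funM.
    exact: (measurableT_comp mchi).
  by apply: measurable_funV; apply: measurable_funX; exact: measurableT_comp.
have -> : \int[nu]_w (chi w / w.2 * err w) = \int[nu]_w \int[mu]_x H w x.
  apply: eq_Rintegral => w _; rewrite /H RintegralZl0.
    have [->|cw] := eqVneq (chi w) 0; first by rewrite !mul0r.
    by rewrite /err; field; rewrite gt_eqF// tpos.
  move=> c0; apply: integ_J; apply: contraNneq c0 => ->; by rewrite mul0r.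
rewrite (Rintegral_swap mH iu iv Hle).
have bound (x : measurableTypeR R) : `|\int[nu]_w H w x| <= 12 * (ind (`|x0 - x| < 3 * s) * N x).
  have -> : \int[nu]_w H w x =
      N x * dl x * \int[nu]_w (chi w / w.2 ^+ 3 * ind (`|w.1 - x| < 3 * w.2)).
    rewrite -RintegralZl0.
      by apply: eq_Rintegral => w _; rewrite /H /J; ring.
    move=> _; apply: (@integ_dom _ _ _ nu _ u) => //.
      apply: measurable_funM; first by apply: measurable_funM => //; apply: measurable_funV; exact: measurable_funX.
      apply: measurable_ind; apply: measurable_fun_ltr; last exact: measurable_funM.
      by apply: measurableT_comp => //; exact: measurable_funB.
    move=> w; have [->|cw] := eqVneq (chi w) 0.
      by rewrite !mul0r normr0 mulr_ge0 ?box_ge0// invr_ge0 exprn_ge0// ltW.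
    have t0 := tpos cw; have [h1 h2] := chi_supp cw.
    rewrite !normrM normfV (ger0_norm (chi0 _)) (ger0_norm (ind_ge0 _ _)) gtr0_norm ?exprn_gt0//.
    apply: (@le_trans _ _ (chi w / w.2 ^+ 3)).
      by rewrite ler_piMr ?ind_le1// divr_ge0// exprn_ge0// ltW.
    rewrite mulrC; apply: ler_pM => //; first by rewrite invr_ge0 exprn_ge0// ltW.
    exact: lef_pXV.
  rewrite normrM (ger0_norm (_ : 0 <= N x * dl x)); last by rewrite mulr_ge0// ltW.
  apply: (le_trans (ler_wpM2l _ (column_mass x))); first by rewrite mulr_ge0// ltW.
  by rewrite le_eqVlt; apply/orP; left; apply/eqP; field; rewrite gt_eqF.
have i12 : integ mu (fun x : measurableTypeR R => 12 * (ind (`|x0 - x| < 3 * s) * N x)).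
  by apply: integZl; exact: iN.
apply: (@le_trans _ _ (\int[mu]_x (12 * (ind (`|x0 - x| < 3 * s) * N x)))).
  apply: (le_trans (ler_norm _)); apply: le_norm_Rintegral => //.
  exact: (@measurable_Rintegral _ _ _ _ _ nu (fun z => H z.2 z.1) (measurableT_comp mH (@measurable_swap _ _ _ _))).
rewrite (RintegralZl _ measurableT (iN x0 (3 * s))).
rewrite (_ : 48 * lam * s = 12 * (lam * (4 * s))); last by ring.
rewrite ler_pM2l//.
have [h1 h2] := chi_supp cw1; have h3 := le_lt_trans (normr_ge0 _) h2.
have t1 := tpos cw1.
apply: (@le_trans _ _ (\int[mu]_x (ind (`|w1.1 - x| < 4 * s) * N x))).
  apply: (le_Rintegral measurableT (iN _ _) (iN _ _)) => x _.
  rewrite ler_wpM2r//; apply: le_ind => h.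
  rewrite (_ : w1.1 - x = - (x0 - w1.1) + (x0 - x)); last by ring.
  by apply: (le_lt_trans (ler_normD _ _)); rewrite normrN; lra.
by apply: chi_good => //; lra.
Qed.

(** The square of the convolution of f is at most twice the square for g plus twice the square of
    the difference. The first part gives 2 (40 L M + 1) (9/2 lam)^2 2 s, hence the 81. In the
    second, one factor [err] is replaced by its bound 6 lam and the other is integrated: 12 L^2 lam
    times 48 lam s, hence the 576. *)
Lemma local_energy_bound :
  integ nu (fun w => chi w / w.2 * kap_conv phi f w ^+ 2) /\
  \int[nu]_w (chi w / w.2 * kap_conv phi f w ^+ 2) <=
  (81 * (40 * L * M + 1) + 576 * L ^+ 2) * lam ^+ 2 * s.
Proof.
have t9 : 0 <= 9 / 2 * lam by rewrite mulr_ge0.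
have sq := square_function_bound phiM phiL phi0 kap_mean e0 mchi chi0 chi_box mg t9 gG.
have ig2 : \int[mu]_x (g x ^+ 2) <= (9 / 2 * lam) ^+ 2 * (2 * s).
  have i1 : integ mu (fun x : measurableTypeR R => (9 / 2 * lam) ^+ 2 * ind (`|x0 - x| < s)).
    by apply: integZl; exact: integ_ball.
  apply: (le_trans (ler_norm _)).
  rewrite -(Rintegral_ball x0 (ltW s0)) -(RintegralZl _ measurableT (integ_ball x0 s)).
  apply: le_norm_Rintegral => //; first exact: measurable_funX.
  by move=> x; apply: norm_sqr_le_ind; exact: gG.
have mQ := measurable_kap_conv phiL mg; have mF := measurable_kap_conv phiL mf.
have mct : measurable_fun setT (fun w : plane R => chi w / w.2).
  by apply: measurable_funM => //; exact: measurable_funV.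
have ibox := @integ_box R eps s x0 e0.
have ct_le w : 0 <= chi w / w.2 <= eps^-1 * box eps s x0 w.
  have [->|cw] := eqVneq (chi w) 0.
    by rewrite mul0r lexx mulr_ge0 ?box_ge0// invr_ge0 ltW.
  have t0 := tpos cw; have [h1 _] := chi_supp cw.
  rewrite divr_ge0 ?(ltW t0)//= mulrC; apply: ler_pM => //; first by rewrite invr_ge0 ltW.
  by rewrite lef_pV2.
have dom (F : plane R -> R) (c : R) : measurable_fun setT F ->
    (forall w, chi w != 0 -> `|F w| <= c) -> 0 <= c ->
    integ nu (fun w => chi w / w.2 * F w).
  move=> mF' Fc c0; apply: (@integ_dom _ _ _ nu _ (fun w => c * (eps^-1 * box eps s x0 w))).
  - exact: measurable_funM.
  - by apply: integZl; exact: integZl.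
  - move=> w; have /andP[p1 p2] := ct_le w.
    have [->|cw] := eqVneq (chi w) 0.
      by rewrite !mul0r normr0 mulr_ge0// (le_trans p1).
    by rewrite normrM (ger0_norm p1) mulrC; apply: ler_pM => //; exact: Fc.
have gG' x : `|g x| <= 9 / 2 * lam.
  by apply: le_trans (gG x) _; rewrite ler_piMr ?ind_le1.
have i1 : integ nu (fun w => chi w / w.2 * kap_conv phi g w ^+ 2).
  apply: (dom _ ((2 * M * (9 / 2 * lam)) ^+ 2)); rewrite ?sqr_ge0//; first exact: measurable_funX.
  move=> w cw; rewrite normrX ler_pXn2r ?nnegrE ?mulr_ge0//.
  exact: kap_conv_le_bounded phiM phiL phi0 _ _ _ mg gG' (tpos cw).
have i2 : integ nu (fun w => chi w / w.2 * err w).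
  apply: (dom _ (6 * lam)) => //; last by rewrite mulr_ge0.
  by move=> w cw; rewrite ger0_norm// err_le.
have key w : `|chi w / w.2 * kap_conv phi f w ^+ 2| <=
    2 * (chi w / w.2 * kap_conv phi g w ^+ 2) + 12 * L ^+ 2 * lam * (chi w / w.2 * err w).
  have /andP[p1 p2] := ct_le w.
  have [->|cw] := eqVneq (chi w) 0; first by rewrite !mul0r !mulr0 normr0 addr0.
  rewrite normrM (ger0_norm p1) ger0_norm ?sqr_ge0//.
  rewrite (_ : 2 * (chi w / w.2 * kap_conv phi g w ^+ 2) + 12 * L ^+ 2 * lam * (chi w / w.2 * err w) =
    chi w / w.2 * (2 * kap_conv phi g w ^+ 2 + 2 * (L ^+ 2 * (6 * lam * err w)))); last by ring.
  rewrite ler_wpM2l//.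
  have h := kap_conv_diff cw.
  have h2 : (kap_conv phi f w - kap_conv phi g w) ^+ 2 <= L ^+ 2 * (6 * lam * err w).
    apply: (@le_trans _ _ ((L * err w) ^+ 2)).
      have Le0 := mulr_ge0 L0 (err_ge0 w).
      by rewrite -[leLHS]real_normK ?num_real// lerXn2r ?nnegrE.
    by rewrite exprMn ler_wpM2l ?sqr_ge0// expr2 ler_wpM2r// err_le.
  have h3 : kap_conv phi f w ^+ 2 <= 2 * kap_conv phi g w ^+ 2 + 2 * (kap_conv phi f w - kap_conv phi g w) ^+ 2.
    rewrite -subr_ge0 (_ : _ - _ = (kap_conv phi f w - 2 * kap_conv phi g w) ^+ 2) ?sqr_ge0//; ring.
  by apply: (le_trans h3); rewrite lerD2l ler_pM2l.
have L2 : 0 <= 12 * L ^+ 2 * lam by rewrite mulr_ge0 ?mulr_ge0 ?sqr_ge0.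
have mE : measurable_fun setT (fun w : plane R => chi w / w.2 * kap_conv phi f w ^+ 2).
  by apply: measurable_funM => //; exact: measurable_funX.
have iE := integ_dom mE (integD (integZl 2 i1) (integZl (12 * L ^+ 2 * lam) i2)) key.
split => //.
apply: (@le_trans _ _ (\int[nu]_w (2 * (chi w / w.2 * kap_conv phi g w ^+ 2) +
    12 * L ^+ 2 * lam * (chi w / w.2 * err w)))).
  apply: (le_trans (ler_norm _)); apply: le_norm_Rintegral => //.
  by apply: integD; exact: integZl.
rewrite (RintegralD measurableT (integZl _ i1) (integZl _ i2)).
rewrite (RintegralZl _ measurableT i1) (RintegralZl _ measurableT i2).
have c0 : 0 <= 40 * L * M + 1 by rewrite addr_ge0// mulr_ge0// mulr_ge0.
rewrite (_ : (81 * (40 * L * M + 1) + 576 * L ^+ 2) * lam ^+ 2 * s =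
  2 * ((40 * L * M + 1) * ((9 / 2 * lam) ^+ 2 * (2 * s))) + 12 * L ^+ 2 * lam * (48 * lam * s)); last by field.
apply: lerD; last exact: ler_wpM2l.
by rewrite ler_pM2l//; apply: (le_trans sq); exact: ler_wpM2l.
Qed.

End averaging.

(** * Smooth bumps *)

Lemma Rintegral_supported (R : realType) (a b : R) (f : measurableTypeR R -> R) :
  (forall x, f x != 0 -> a <= x <= b) ->
  \int[lebesgue_measure]_x f x = fine (\int[lebesgue_measure]_(x in `[a, b]) (f x)%:E).
Proof.
move=> fab; rewrite -[RHS]/(Rintegral lebesgue_measure `[a, b] f) [RHS]Rintegral_mkcond.
apply: eq_Rintegral => x _; rewrite patchE.
case: ifPn => // xab; apply/eqP; apply: contraNT xab => /fab h.
by apply/mem_set; rewrite /= in_itv.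
Qed.

Section bump.
Context {R : realType}.
Notation mu := (@lebesgue_measure R).
Variable phi : R -> R.
Hypotheses (d0 : forall x, derivable phi x 1)
  (d1 : forall x, derivable (derive1 phi) x 1)
  (supp : forall x, phi x != 0 -> -1 <= x <= 1).

Let supp0 x : 1 < `|x| -> phi x = 0.
Proof.
move=> h; apply/eqP; apply/negPn/negP => /supp; rewrite -ler_norml; lra.
Qed.

Let cont (f : R -> R) : (forall x, derivable f x 1) -> continuous f.
Proof. by move=> df x; apply/differentiable_continuous/derivable1_diffP. Qed.

Lemma bump_lipschitz : exists L, forall x y, `|phi x - phi y| <= L * `|x - y|.
Proof.
have cd : {within `[-2, 2], continuous (fun x => `|derive1 phi x|)}.
  apply: continuous_subspaceT => x; apply: continuous_comp; first exact: cont.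
  exact: norm_continuous.
have [|c _ cmax] := EVT_max _ cd; first by lra.
exists (`|derive1 phi c|).
have lip x y : -2 <= x -> x <= y -> y <= 2 -> `|phi y - phi x| <= `|derive1 phi c| * `|y - x|.
  move=> x2 xy y2.
  have [| |z zxy ->] := @MVT_segment _ phi (derive1 phi) x y xy.
  - by move=> z _; apply: DeriveDef => //; rewrite derive1E.
  - by apply: continuous_subspaceT; exact: cont.
  - rewrite normrM ler_wpM2r//; apply: cmax; move: zxy; rewrite !in_itv/= => /andP[h1 h2].
    by rewrite (le_trans x2 h1) (le_trans h2 y2).
(* The vanishing of [phi] at 1 and -1 is not yet available, but beyond them it is; clipping to the
   longer segment [-2, 2] therefore keeps all values of [phi] and does not increase distances. *)
pose clip (x : R) := if x < -2 then -2 else if 2 < x then 2 else x.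
have clip1 x : -2 <= clip x <= 2.
  by rewrite /clip; case: ltP => h1; [|case: ltP => h2]; apply/andP; split; lra.
have clipphi x : phi (clip x) = phi x.
  rewrite /clip; case: ltP => h1; [|case: ltP => h2] => //.
    by rewrite !supp0 ?ltr_normr//; apply/orP; [right|right]; lra.
  by rewrite !supp0 ?ltr_normr//; apply/orP; [left|left]; lra.
have clipd x y : x <= y -> clip x <= clip y /\ clip y - clip x <= y - x.
  move=> xy; rewrite /clip.
  by case: (ltP x (-2)) => h1; case: (ltP y (-2)) => h2 //; try lra;
    case: (ltP 2 x) => h3; case: (ltP 2 y) => h4; try lra; split; lra.
have lipT x y : x <= y -> `|phi y - phi x| <= `|derive1 phi c| * `|y - x|.
  move=> xy; have [h1 h2] := clipd _ _ xy; rewrite -(clipphi x) -(clipphi y).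
  have /andP[a1 a2] := clip1 x; have /andP[b1 b2] := clip1 y.
  apply: (le_trans (lip _ _ a1 h1 b2)); rewrite ler_wpM2l//.
  by rewrite !ger0_norm ?subr_ge0.
move=> x y; case: (leP x y) => xy.
  by rewrite distrC (distrC x); exact: lipT.
by apply: lipT; exact: ltW.
Qed.

(** The support hypothesis leaves the end points 1 and -1 open; continuity, in the form of the
    Lipschitz bound, settles them. With the end points included, each kernel is supported in an open
    ball. *)
Lemma bump_eq0 x : 1 <= `|x| -> phi x = 0.
Proof.
move=> h; have [L phiL] := bump_lipschitz.
have L0 : 0 <= L by have := phiL 0 1; rewrite sub0r normrN1 mulr1; exact: le_trans.
apply/eqP; rewrite -normr_le0; apply/ler_addgt0Pl => e e0; rewrite addr0.
(* [x * (1 + r)] lies strictly beyond the support, and its distance to x times L is at most e. *)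
pose r := e / (L + 1) / `|x|.
have L1 : 0 < L + 1 by rewrite ltr_wpDl.
have x0 : 0 < `|x| by apply: lt_le_trans h.
have r0 : 0 < r by rewrite /r !divr_gt0.
have -> : phi x = phi x - phi (x * (1 + r)).
  rewrite [X in _ - X]supp0 ?subr0// normrM (gtr0_norm (x := 1 + r)) ?addr_gt0//.
  by rewrite (lt_le_trans (_ : 1 < 1 + r)) ?ltrDl// ler_peMl// addr_ge0// ltW.
apply: (le_trans (phiL _ _)).
rewrite (_ : x - x * (1 + r) = - (x * r)); last by ring.
rewrite normrN normrM (gtr0_norm r0) /r.
rewrite (_ : L * (`|x| * (e / (L + 1) / `|x|)) = L / (L + 1) * e); last first.
  by field; rewrite !gt_eqF.
by rewrite ler_piMl ?(ltW e0)// ler_pdivrMr// mul1r lerDl.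
Qed.

Lemma bump_bounded : exists M, forall x, `|phi x| <= M.
Proof.
have [L phiL] := bump_lipschitz.
have L0 : 0 <= L by have := phiL 0 1; rewrite sub0r normrN1 mulr1; exact: le_trans.
exists (L * 2) => x; have [h|h] := leP 1 (`|x|).
  by rewrite bump_eq0// normr0 mulr_ge0.
rewrite -[phi x]subr0 -[X in _ - X](@bump_eq0 1) ?normr1//.
apply: (le_trans (phiL _ _)); rewrite ler_wpM2l//.
by apply: (le_trans (ler_normB _ _)); rewrite normr1; lra.
Qed.

Lemma integ_bump : integ mu phi.
Proof.
have [M phiM] := bump_bounded; have [L phiL] := bump_lipschitz.
apply: (@integ_dom _ _ _ mu _ (fun x => M * ind (`|0 - x| < 1))).
- exact: lipschitz_measurable phiL.
- by apply: integZl; exact: integ_ball.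
- move=> x; rewrite sub0r normrN /ind; case: ltP => h; first by rewrite mulr1.
  by rewrite bump_eq0// normr0 mulr0.
Qed.

Let Phi (x : R) : R := \int[mu]_(t in `]-oo, x]) phi t.

Let dPhi (x : R) : is_derive x 1 Phi (phi x).
Proof.
have [dP PE] : derivable Phi x 1 /\ derive1 Phi x = phi x.
  apply: (@continuous_FTC1 _ _ -oo%O x (x + 1)); last exact: cont.
  - by rewrite ltrDl.
  - exact: (integrableS measurableT _ _ integ_bump).
  - by rewrite ltNyr.
by apply: DeriveDef; [exact: dP|rewrite -derive1E; exact: PE].
Qed.

(** A change of variables by primitives: x -> - Phi ((y - x) / t) is a primitive of the dilated
    kernel, so both integrals equal Phi 1 - Phi (-1). *)
Lemma kap_mean_zero : \int[mu]_x phi x = 0 ->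
  forall w, 0 < w.2 -> \int[mu]_x kap phi w x = 0.
Proof.
have Phi1 : \int[mu]_x phi x = Phi 1 - Phi (-1).
  rewrite (@Rintegral_supported _ (-1) 1)//.
  have ab : -1 < 1 :> R by lra.
  have cphi x : {for x, continuous phi} by exact: cont.
  by rewrite (integral_FTC ab (fun x _ => dPhi x) (fun x _ => cphi x)).
move=> I0 [y t] /= t0.
pose G (x : R) : R := - Phi (t^-1 * (y - x)).
pose K (x : R) : R := t^-1 * phi (t^-1 * (y - x)).
have dG (x : R) : is_derive x 1 G (K x).
  have dl : is_derive x 1 (fun x : R => t^-1 * (y - x)) (- t^-1).
    have := is_deriveZ t^-1 (is_deriveB (is_derive_cst (y : R) x 1) (is_derive_id x 1)).
    by move=> h; apply: is_derive_eq; rewrite sub0r /GRing.scale/= mulrN1.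
  have := is_deriveN (is_derive1_comp (dPhi _) dl).
  by move=> h; apply: is_derive_eq; rewrite /K /GRing.scale/=; ring.
rewrite (@Rintegral_supported _ (y - t) (y + t)); last first.
  move=> x /(kap_neq0 bump_eq0 (w := (y, t)) t0)/=; rewrite ltr_norml => /andP[h1 h2].
  by apply/andP; split; lra.
have ab : y - t < y + t by lra.
have ck (x : R) : {for x, continuous K}.
  apply: cvgM; first exact: cvg_cst.
  apply: (@continuous_comp _ _ _ (fun x : R => t^-1 * (y - x)) phi); last exact: cont.
  by apply: cvgM; [exact: cvg_cst|apply: cvgB; [exact: cvg_cst|exact: cvg_id]].
rewrite -[LHS]/(fine (\int[mu]_(x in `[y - t, y + t]) (K x)%:E)).
rewrite (integral_FTC ab (fun x _ => dG x) (fun x _ => ck x))/= /G.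
rewrite (_ : t^-1 * (y - (y + t)) = -1); last by field; rewrite gt_eqF.
rewrite (_ : t^-1 * (y - (y - t)) = 1); last by field; rewrite gt_eqF.
by rewrite opprK addrC -Phi1.
Qed.

End bump.

(** * The exceptional set *)

Lemma norm_ind_mul_le (R : realType) (b : bool) (a : R) :
  0 <= a -> `|ind b * a| <= a.
Proof.
by move=> a0; rewrite normrM (ger0_norm a0) (ger0_norm (ind_ge0 _ _)) ler_piMl ?ind_le1.
Qed.

Section level_set.
Context {R : realType}.
Notation mu := (@lebesgue_measure R).

Lemma measurable_tent (q : plane R) : measurable (tent q).
Proof.
have -> : tent q = [set: plane R] `&`
    (fun w : plane R => [&& 0 < w.2, w.2 < q.2 & `|q.1 - w.1| < q.2 - w.2]) @^-1` [set true].
  by apply/seteqP; split => w; rewrite setTI /tent /= => /and3P.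
have mb : measurable_fun setT
    (fun w : plane R => [&& 0 < w.2, w.2 < q.2 & `|q.1 - w.1| < q.2 - w.2]).
  apply: measurable_and; first exact: measurable_fun_ltr.
  apply: measurable_and; first exact: measurable_fun_ltr.
  apply: measurable_fun_ltr; last exact: measurable_funB.
  by apply: measurableT_comp => //; exact: measurable_funB.
exact: mb.
Qed.

Lemma tent_halfplane (q : plane R) : tent q `<=` halfplane R.
Proof. by move=> w []. Qed.

Lemma bigcup_tent_measurable (D : set (plane R)) :
  countable D -> measurable (\bigcup_(q in D) tent q).
Proof.
move=> cD; rewrite bigcup_set_type; apply: countable_bigcupT_measurable.
  by rewrite (eq_countable (card_setT D)).
by move=> i; exact: measurable_tent.
Qed.

Lemma outer_mu_bigcup_tent (D : set (plane R)) (B : \bar R) :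
  D `<=` halfplane R -> countable D ->
  (forall X : {fset (plane R)}, [set` X] `<=` D ->
    (\sum_(q <- X) (q.2)%:E <= B)%E) ->
  (outer_mu (\bigcup_(q in D) tent q) <= B)%E.
Proof.
move=> Dh cD XB; apply: (@le_trans _ _ (\esum_(q in D) sigma q)).
  by apply: ereal_inf_lbound; exists D => //; split.
apply: ge_ereal_sup => _ [X [fX XD] <-].
rewrite fsbig_finite//=; apply: XB.
by move=> q; rewrite /= in_fset_set// => /set_mem; exact: XD.
Qed.

(** At each x at most one of the ball indicators is nonzero, so the local masses add up to at most
    the integral of [T]. Finite families are the right form because an [esum] is the supremum of its
    finite partial sums. *)
Lemma disjoint_ball_mass (X : {fset (plane R)}) (c : R)
    (T : measurableTypeR R -> R) :
  0 < c -> (forall x, 0 <= T x) -> integ mu T ->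
  (forall q q', q \in X -> q' \in X -> forall x, `|q.1 - x| < c * q.2 ->
     `|q'.1 - x| < c * q'.2 -> q = q') ->
  (forall q, q \in X -> q.2 <= \int[mu]_x (ind (`|q.1 - x| < c * q.2) * T x)) ->
  (\sum_(q <- X) (q.2)%:E <= (\int[mu]_x T x)%:E)%E.
Proof.
move=> c0 T0 iT disj qT.
have iG (q : plane R) : integ mu (fun x : measurableTypeR R => ind (`|q.1 - x| < c * q.2) * T x).
  apply: (@integ_dom _ _ _ mu _ T) => //.
    apply: measurable_funM; last exact: integ_measurable iT.
    exact: integ_measurable (integ_ball q.1 (c * q.2)).
  by move=> x; exact: norm_ind_mul_le.
rewrite sumEFin lee_fin.
apply: (@le_trans _ _ (\sum_(q <- X) \int[mu]_x (ind (`|q.1 - x| < c * q.2) * T x))).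
  by rewrite big_seq [leRHS]big_seq; exact: ler_sum.
pose G (q : plane R) (x : measurableTypeR R) : R := ind (`|q.1 - x| < c * q.2) * T x.
have sumI (s : seq (plane R)) : integ mu (fun x => \sum_(q <- s) G q x) /\
    \int[mu]_x (\sum_(q <- s) G q x) = \sum_(q <- s) \int[mu]_x G q x.
  elim: s => [|q s [IH1 IH2]].
    have -> : (fun x => \sum_(q <- [::]) G q x) = cst 0.
      by apply/funext => x; rewrite big_nil.
    split; last by rewrite big_nil Rintegral_cst// mul0r.
    by apply: (@integ_dom _ _ _ mu _ T) => // x; rewrite normr0.
  have -> : (fun x => \sum_(p <- q :: s) G p x) = (fun x => G q x + \sum_(p <- s) G p x).
    by apply/funext => x; rewrite big_cons.
  split; first exact: integD (iG q) IH1.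
  by rewrite big_cons -IH2; exact: RintegralD measurableT (iG q) IH1.
have [i1 E1] := sumI X; rewrite -[leLHS]E1 /G.
apply: (le_Rintegral measurableT i1 iT) => x _; rewrite /G.
have [[q qX qx]|none] := pselect (exists2 q, q \in X & `|q.1 - x| < c * q.2).
  rewrite (bigD1_seq q)//= big_seq_cond big1 ?addr0.
    by rewrite ler_piMl ?ind_le1.
  move=> q' /andP[q'X]; rewrite /ind; case: ltP => h; last by rewrite mul0r.
  by rewrite (disj _ _ q'X qX x h qx) eqxx.
rewrite big_seq big1// => q qX; rewrite /ind; case: ltP => h; last by rewrite mul0r.
by exfalso; apply: none; exists q.
Qed.

Variables (N : measurableTypeR R -> R) (l : R).
Hypotheses (N0 : forall x, 0 <= N x) (l0 : 0 < l)
  (mN : measurable_fun setT N)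
  (iN : forall c r : R, integ mu (fun x : measurableTypeR R => ind (`|c - x| < r) * N x)).

(** Unlike [N], whose total mass may be infinite, this part is integrable for f in L^p. Its
    dependence on l is what turns the weak bound into a strong one upon integration in l. *)
Definition tail (x : measurableTypeR R) : R := ind (l / 4 < N x) * N x.

Hypothesis itail : integ mu tail.

Lemma tail_ge0 x : 0 <= tail x. Proof. by rewrite mulr_ge0 ?ind_ge0. Qed.

(** Pointwise [N] is at most [tail] plus l / 4, and the ball has length 2 r, so the constant
    accounts for l r / 2 only. *)
Lemma bad_ball (y r : R) : 0 < r ->
  l * r < \int[mu]_x (ind (`|y - x| < r) * N x) ->
  l * r / 2 <= \int[mu]_x (ind (`|y - x| < r) * tail x).
Proof.
move=> r0 bad.
have i1 : integ mu (fun x => ind (`|y - x| < r) * tail x).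
  apply: (@integ_dom _ _ _ mu _ tail) => //.
    apply: measurable_funM; last exact: integ_measurable itail.
    exact: integ_measurable (integ_ball y r).
  by move=> x; exact: norm_ind_mul_le (tail_ge0 x).
have i2 : integ mu (fun x : measurableTypeR R => ind (`|y - x| < r) * (l / 4)).
  by apply: integZr; exact: integ_ball.
have := le_Rintegral measurableT (iN y r) (integD i1 i2) => /(_ _)/wrap[].
  move=> x _; rewrite -mulrDr ler_wpM2l ?ind_ge0// /tail /ind.
  case: (ltP (l / 4) (N x)) => h; last by rewrite mul0r add0r.
  by rewrite mul1r lerDl divr_ge0// ltW.
rewrite (RintegralD measurableT i1 i2) (RintegralZr _ measurableT (integ_ball y r)).
by rewrite Rintegral_ball ?(ltW r0)//; lra.
Qed.

(** The tent over a selected ball of radius r_j has height 6 r_j, while that ball carries tail mass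
    at least l r_j / 2; this gives 12 = 6 * 2. *)
Lemma level_set_cover : exists A : set (plane R),
  [/\ measurable A, A `<=` halfplane R,
      (outer_mu A <= (12 / l * \int[mu]_x tail x)%:E)%E &
      forall w r, ~ A w -> 0 < w.2 -> w.2 <= r ->
        \int[mu]_x (ind (`|w.1 - x| < r) * N x) <= l * r].
Proof.
have num1 (a b c : R) : l * a / 2 <= b -> b <= c -> a <= 2 / l * c.
  by move=> h1 h2; rewrite mulrAC ler_pdivlMr//; lra.
have num2 (a b : R) : l * (a / 6) / 2 <= b -> a <= 12 / l * b.
  by move=> h; rewrite mulrAC ler_pdivlMr//; lra.
have num3 (t r j a b : R) : 0 < t -> t <= r -> r / 2 <= j -> a <= r -> b <= j ->
    t < j * 6 /\ b + a < j * 6 - t by move=> *; split; lra.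
pose V : set (plane R) := [set i | 0 < i.2 /\
  l * i.2 < \int[mu]_x (ind (`|i.1 - x| < i.2) * N x)].
(* Vitali's lemma is applied to balls indexed by the whole plane, all of which must have positive
   radius; 1 is the default at nonpositive heights. *)
pose rad (i : plane R) : R := if 0 < i.2 then i.2 else 1.
have rad0 i : 0 < rad i by rewrite /rad; case: ifP.
pose B (i : plane R) : set R := ball (i.1 : R) (rad i).
have radE i : (radius (B i))%:num = rad i by rewrite radius_ball_num// ltW.
have cB i : cpoint (B i) = i.1 by rewrite cpoint_ball.
have isB i : is_ball (B i) by exact: is_ball_ball.
have Vrad i : V i -> rad i = i.2 by case=> h _; rewrite /rad h.
have B0 i : 0 < (radius (B i))%:num by rewrite radE.
(* The Vitali selection needs bounded radii; [bad_ball] and the finite total mass of [tail] provide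
   the bound. *)
have VBr i : V i -> (radius (B i))%:num <= 2 / l * \int[mu]_x tail x.
  move=> Vi; rewrite radE Vrad//; have [i0 bad] := Vi.
  have := bad_ball i0 bad => h.
  have : \int[mu]_x (ind (`|i.1 - x| < i.2) * tail x) <= \int[mu]_x tail x.
    apply: (le_trans (ler_norm _)); apply: le_norm_Rintegral => //.
      apply: measurable_funM; last exact: integ_measurable itail.
      exact: integ_measurable (integ_ball i.1 i.2).
    by move=> x; exact: norm_ind_mul_le (tail_ge0 x).
  exact: num1 h.
have [D [cD DV tD maxD]] := vitali_lemma_infinite isB B0 VBr.
(* A bad w meets a selected ball with |y_j - y| + t <= 5 r_j only; the dilation factor
   6 makes the tent inequality strict. *)
pose D6 : set (plane R) := [set q | D (q.1, q.2 / 6)].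
have D6V q : D6 q -> V (q.1, q.2 / 6) by move=> /DV.
have cD6 : countable D6.
  apply: sub_countable cD; apply: card_le_trans (card_image_le (fun i : plane R => (i.1, i.2 * 6) : plane R) D).
  apply: subset_card_le => -[y t]; rewrite /D6 /= => h; exists (y, t / 6) => //=.
  by rewrite divfK.
exists (\bigcup_(q in D6) tent q); split.
- exact: bigcup_tent_measurable.
- by move=> w [q _]; exact: tent_halfplane.
- apply: outer_mu_bigcup_tent => //.
    move=> q /D6V [/= h _]; rewrite /halfplane/=; move: h.
    by rewrite pmulr_lgt0// invr_gt0.
  move=> X XD; have il : integ mu (fun x => 12 / l * tail x) by exact: integZl.
  rewrite -(RintegralZl _ measurableT itail).
  apply: (@disjoint_ball_mass X (6^-1)) => //.
  + by move=> x; rewrite mulr_ge0 ?tail_ge0// divr_ge0// ltW.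
  + move=> q q' qX q'X x h h'.
    have Dq : D (q.1, q.2 / 6) by exact: XD.
    have Dq' : D (q'.1, q'.2 / 6) by exact: XD.
    have e : (q.1, q.2 / 6) = (q'.1, q'.2 / 6).
      apply: (tD _ _ Dq Dq'); exists x; split; apply: subset_closure; rewrite /B -ball_normE/=.
        by rewrite Vrad; [rewrite /= mulrC|exact: DV].
      by rewrite Vrad; [rewrite /= mulrC|exact: DV].
    case: q q' e {qX q'X h h' Dq Dq'} => [y t] [y' t'] /= [-> e].
    by congr pair; apply: (divIf _ e).
  + move=> q qX; have [/= i0 bad] := D6V q (XD _ qX).
    have h := bad_ball i0 bad.
    under eq_Rintegral do rewrite mulrCA (mulrC 6^-1).
    rewrite RintegralZl//; last first.
      apply: (@integ_dom _ _ _ mu _ tail) => //.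
        apply: measurable_funM; last exact: integ_measurable itail.
        exact: integ_measurable (integ_ball q.1 (q.2 / 6)).
      by move=> x; exact: norm_ind_mul_le (tail_ge0 x).
    exact: num2.
- move=> w r nA t0 tr; rewrite leNgt; apply/negP => bad.
  have r0 : 0 < r by apply: lt_le_trans tr.
  have Vi : V (w.1, r) by split.
  have [j [Dj [z [zi zj]] rij _]] := maxD _ Vi.
  have Vj := DV _ Dj.
  have := is_ball_closureP (isB _) zi; rewrite cB radE Vrad//= => d1.
  have := is_ball_closureP (isB _) zj; rewrite cB radE Vrad//= => d2.
  have rV k : V k -> (radius (B k))%:num = k.2 by move=> Vk; rewrite radE Vrad.
  move: rij; rewrite (rV _ Vi) (rV _ Vj) => rij.
  apply: nA; exists (j.1, j.2 * 6); first by rewrite /D6 /= mulfK// -surjective_pairing.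
  have [n1 n2] := num3 _ _ _ _ _ t0 tr rij d1 d2.
  split => //=.
  rewrite (_ : j.1 - w.1 = (j.1 - z) - (w.1 - z)); last by ring.
  by apply: (le_lt_trans (ler_normB _ _)).
Qed.

End level_set.

Definition energy_const (R : realType) (M L : R) : R :=
  81 * (40 * L * M + 1) + 576 * L ^+ 2.

Lemma energy_const_ge0 (R : realType) (M L : R) :
  0 <= M -> 0 <= L -> 0 <= energy_const M L.
Proof.
move=> M0 L0; apply: addr_ge0; apply: mulr_ge0; rewrite ?ler0n ?sqr_ge0//.
by rewrite addr_ge0 ?ler01// mulr_ge0// mulr_ge0 ?ler0n.
Qed.

Section energy_off_level_set.
Context {R : realType}.
Notation mu := (@lebesgue_measure R).
Notation nu := (leb2 R).
Variables (phi : R -> R) (M L : R).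
Hypotheses (phiM : forall x, `|phi x| <= M)
  (phiL : forall x y, `|phi x - phi y| <= L * `|x - y|)
  (phi0 : forall x, 1 <= `|x| -> phi x = 0)
  (kap_mean : forall w, 0 < w.2 -> \int[mu]_x kap phi w x = 0).
Variables (f N : measurableTypeR R -> R).
Hypotheses (mf : measurable_fun setT f) (mN : measurable_fun setT N)
  (fN : forall x, `|f x| <= N x)
  (iN : forall c r : R, integ mu (fun x : measurableTypeR R => ind (`|c - x| < r) * N x)).
Variables (lam s x0 : R) (P : set (plane R)).
Hypotheses (s0 : 0 < s) (lam0 : 0 <= lam) (mP : measurable P)
  (P_cone : forall w, P w -> 0 < w.2 /\ `|x0 - w.1| < s - w.2)
  (P_good : forall (w : plane R) (r : R), P w -> w.2 <= r ->
    \int[mu]_x (ind (`|w.1 - x| < r) * N x) <= lam * r).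

Local Notation K := (energy_const M L).

Let N0 x : 0 <= N x. Proof. exact: le_trans (fN x). Qed.

Let energy w : R := kap_conv phi f w ^+ 2 / w.2.

Let energy_ge0 w : P w -> 0 <= energy w.
Proof. by move=> /P_cone[t0 _]; rewrite divr_ge0 ?sqr_ge0 ?ltW. Qed.

Let menergy : measurable_fun setT energy.
Proof.
apply: measurable_funM; last exact: measurable_funV.
by apply: measurable_funX; exact: measurable_kap_conv phiL _ mf.
Qed.

Let truncation eps : set (plane R) := P `&` [set w | eps <= w.2].

Let mtruncation eps : measurable (truncation eps).
Proof.
apply: measurableI => //; rewrite -[X in measurable X]setTI.
have mb : measurable_fun setT (fun w : plane R => eps <= w.2) by exact: measurable_fun_ler.
have -> : [set: plane R] `&` [set w : plane R | eps <= w.2] =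
    [set: plane R] `&` (fun w : plane R => eps <= w.2) @^-1` [set true] by [].
exact: mb.
Qed.

Let truncated_bound eps : 0 < eps ->
  (\int[nu]_(w in truncation eps) (energy w)%:E <= (K * lam ^+ 2 * s)%:E)%E.
Proof.
move=> e0; have L0 := lipschitz_const_ge0 phiL; have M0 := sup_bound_ge0 phiM.
have K0 : 0 <= K * lam ^+ 2 * s.
  by rewrite mulr_ge0 ?(ltW s0)// mulr_ge0 ?sqr_ge0// energy_const_ge0.
have [[w1 [Pw1 ew1]]|none] := pselect (truncation eps !=set0); last first.
  rewrite (_ : truncation eps = set0) ?integral_set0 ?lee_fin//.
  by apply/seteqP; split => // w tw; apply: none; exists w.
(* The good property is part of [E], so that a nearly optimal point for [vdist E] comes with its own
   bound on the mass of [N]. *)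
pose E : set (plane R) := [set w | eps <= w.2 /\ forall r, w.2 <= r ->
  \int[mu]_x (ind (`|w.1 - x| < r) * N x) <= lam * r].
have TE w : truncation eps w -> E w by move=> [Pw ew]; split => // r; exact: P_good.
have E0 : E !=set0 by exists w1; exact: TE.
have Eeps w : E w -> eps <= w.2 by case.
pose chi : plane R -> R := \1_(truncation eps).
have chi_neq0 w : chi w != 0 -> truncation eps w.
  by rewrite /chi indicE; case: (boolP (w \in truncation eps)) => [/set_mem|_]; rewrite ?eqxx.
have dl_good x : \int[mu]_z (ind (`|x - z| < 2 * vdist E x) * N z) <= 6 * lam * vdist E x.
  have [w Ew wx] := vdist_near E0 Eeps x e0.
  have dpos : 0 < vdist E x by apply: lt_le_trans (vdist_ge E0 Eeps x); rewrite divr_gt0.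
  (* The ball of radius [2 * vdist E x] about x lies in the ball of radius r about [w.1]. Since
     [vdist_near] bounds the first two terms by [4 * vdist E x], r is at most [6 * vdist E x]. *)
  pose r := w.2 + `|x - w.1| + 2 * vdist E x.
  have rw : w.2 <= r by rewrite /r -addrA lerDl addr_ge0// mulr_ge0// ltW.
  apply: (@le_trans _ _ (\int[mu]_z (ind (`|w.1 - z| < r) * N z))).
    apply: (le_Rintegral measurableT (iN _ _) (iN _ _)) => z _.
    rewrite ler_wpM2r//; apply: le_ind => h.
    rewrite (_ : w.1 - z = - (x - w.1) + (x - z)); last by ring.
    apply: (le_lt_trans (ler_normD _ _)); rewrite normrN /r.
    by have := lt_le_trans e0 (Eeps _ Ew); lra.
  apply: (@le_trans _ _ (lam * r)); first exact: Ew.2.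
  rewrite (mulrC 6) -mulrA ler_wpM2l// /r; lra.
have chi0 w : 0 <= chi w by [].
have chi1 w : chi w <= 1 by rewrite /chi indicE lern1; case: (_ \in _).
have chi_supp w : chi w != 0 -> eps <= w.2 /\ `|x0 - w.1| < s - w.2.
  by move=> /chi_neq0[/P_cone[_ h] ?].
have chi_good (w : plane R) (r : R) : chi w != 0 -> w.2 <= r ->
    \int[mu]_x (ind (`|w.1 - x| < r) * N x) <= lam * r.
  by move=> /chi_neq0[Pw _]; exact: P_good.
have dl_chi w x : chi w != 0 -> 2 * vdist E x <= w.2 + `|x - w.1|.
  by move=> /chi_neq0/TE; exact: (vdist_le Eeps).
have mchi : measurable_fun setT chi by exact: measurable_indic.
have [iE bE] := local_energy_bound phiM phiL phi0 kap_mean mf mN fN iN e0 s0 lam0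
  mchi chi0 chi1 chi_supp chi_good (vdist_ge E0 Eeps) (vdist_lip E0 Eeps) dl_good dl_chi.
rewrite integral_mkcond.
rewrite (eq_integral (EFin \o (fun w => chi w / w.2 * kap_conv phi f w ^+ 2))); last first.
  move=> w _; rewrite patchE /= /chi indicE /energy.
  by case: (w \in truncation eps); rewrite ?mul0r// mul1r mulrC.
rewrite -[leLHS]fineK; first by rewrite lee_fin.
exact: integrable_fin_num iE.
Qed.

(** Heights in [P] are positive, so the truncations at 1 / (n + 1) increase to [P]. The truncated
    bounds are uniform in eps and pass to the limit by monotone convergence. *)
Lemma energy_off_level_set :
  (\int[nu]_(w in P) (kap_conv phi f w ^+ 2 / w.2)%:E <= (K * lam ^+ 2 * s)%:E)%E.
Proof.
have PE : P = \bigcup_n truncation n.+1%:R^-1.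
  apply/seteqP; split => [w Pw|w [n _ []]//].
  have [t0 _] := P_cone Pw; exists (Num.truncn w.2^-1) => //; split => //=.
  rewrite -[leRHS]invrK lef_pV2 ?posrE ?invr_gt0//.
  by apply: ltW; exact: truncnS_gt.
have nd : nondecreasing_seq (fun n => truncation n.+1%:R^-1).
  move=> m n mn; apply/subsetPset => w [Pw mw]; split => //=.
  by apply: le_trans mw; rewrite lef_pV2 ?posrE// ler_nat.
have cvI := @ge0_nondecreasing_set_cvg_integral _ _ _ (fun n => truncation n.+1%:R^-1)
  (EFin \o energy) nu nd (fun n => mtruncation n.+1%:R^-1) _ _.
rewrite PE; apply: (@cvge_to_le _ \oo _ _ _ _ _ (cvI _ _)).
- by move=> n; apply/measurable_EFinP; apply: measurable_funTS.
- by move=> n w [Pw _]; rewrite lee_fin energy_ge0.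
- by near=> n; apply: truncated_bound; rewrite invr_gt0.
Unshelve. all: by end_near.
Qed.

End energy_off_level_set.

(** * Sizes off the exceptional set *)

(** All that the estimates retain of the smoothness and the support of the real and imaginary parts
    of [phi]. *)
Definition is_bump (R : realType) (M L : R) (psi : R -> R) : Prop :=
  [/\ forall x, `|psi x| <= M, forall x y, `|psi x - psi y| <= L * `|x - y| &
      forall x, 1 <= `|x| -> psi x = 0].

Lemma csmooth_bump (R : realType) (phi : R -> R[i]) : csmooth phi ->
  [set x | phi x != 0] `<=` `[-1, 1] ->
  exists M L, is_bump M L (fun x => complex.Re (phi x)) /\
              is_bump M L (fun x => complex.Im (phi x)).
Proof.
move=> sm supp.
have dr n x := (sm n x).1; have di n x := (sm n x).2.
have sr x : complex.Re (phi x) != 0 -> -1 <= x <= 1.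
  move=> h; have /= := supp x; rewrite in_itv/=; apply.
  by apply: contraNneq h => ->.
have si x : complex.Im (phi x) != 0 -> -1 <= x <= 1.
  move=> h; have /= := supp x; rewrite in_itv/=; apply.
  by apply: contraNneq h => ->.
have [Lr lr] := bump_lipschitz (dr 0%N) (dr 1%N) sr.
have [Li li] := bump_lipschitz (di 0%N) (di 1%N) si.
have [Mr mr] := bump_bounded (dr 0%N) (dr 1%N) sr.
have [Mi mi] := bump_bounded (di 0%N) (di 1%N) si.
have nr := bump_eq0 (dr 0%N) (dr 1%N) sr.
have ni := bump_eq0 (di 0%N) (di 1%N) si.
exists (Num.max Mr Mi), (Num.max Lr Li); split; split => //.
- by move=> x; rewrite le_max mr.
- by move=> x y; apply: (le_trans (lr x y)); rewrite ler_wpM2r// le_max lexx.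
- by move=> x; rewrite le_max mi orbT.
- by move=> x y; apply: (le_trans (li x y)); rewrite ler_wpM2r// le_max lexx orbT.
Qed.

Lemma csmooth_kap_mean (R : realType) (phi : R -> R[i]) : csmooth phi ->
  [set x | phi x != 0] `<=` `[-1, 1] -> cintegral phi = 0 ->
  (forall w, 0 < w.2 -> \int[lebesgue_measure]_x kap (fun x => complex.Re (phi x)) w x = 0) /\
  (forall w, 0 < w.2 -> \int[lebesgue_measure]_x kap (fun x => complex.Im (phi x)) w x = 0).
Proof.
move=> sm supp [I1 I2].
have dr n x := (sm n x).1; have di n x := (sm n x).2.
have sr x : complex.Re (phi x) != 0 -> -1 <= x <= 1.
  move=> h; have /= := supp x; rewrite in_itv/=; apply.
  by apply: contraNneq h => ->.
have si x : complex.Im (phi x) != 0 -> -1 <= x <= 1.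
  move=> h; have /= := supp x; rewrite in_itv/=; apply.
  by apply: contraNneq h => ->.
by split; apply: kap_mean_zero => //; [exact: (dr 0%N)|exact: (dr 1%N)|exact: (di 0%N)|exact: (di 1%N)].
Qed.

Lemma normc_ge0 (R : realType) (z : R[i]) : 0 <= normc z.
Proof. by case: z => a b; exact: sqrtr_ge0. Qed.

Lemma sqr_normc (R : realType) (z : R[i]) : normc z ^+ 2 = complex.Re z ^+ 2 + complex.Im z ^+ 2.
Proof. by case: z => a b; rewrite sqr_sqrtr// addr_ge0 ?sqr_ge0. Qed.

Lemma norm_Re_le (R : realType) (z : R[i]) : `|complex.Re z| <= normc z.
Proof.
rewrite -[leRHS]ger0_norm ?normc_ge0// -ler_sqr ?nnegrE// !real_normK ?num_real//.
by rewrite sqr_normc lerDl sqr_ge0.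
Qed.

Lemma norm_Im_le (R : realType) (z : R[i]) : `|complex.Im z| <= normc z.
Proof.
rewrite -[leRHS]ger0_norm ?normc_ge0// -ler_sqr ?nnegrE// !real_normK ?num_real//.
by rewrite sqr_normc lerDr sqr_ge0.
Qed.

Lemma measurable_normc (R : realType) (f : measurableTypeR R -> R[i]) :
  cmeasurable f -> measurable_fun setT (fun x => normc (f x)).
Proof.
move=> [m1 m2].
have -> : (fun x => normc (f x)) = fun x => (complex.Re (f x) ^+ 2 + complex.Im (f x) ^+ 2) `^ 2^-1.
  apply/funext => x; rewrite powR12_sqrt ?addr_ge0 ?sqr_ge0//.
  by case: (f x).
apply: (measurableT_comp (measurable_powR _)).
by apply: measurable_funD; exact: measurable_funX.
Qed.

Section complex_sizes.
Context {R : realType}.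
Notation mu := (@lebesgue_measure R).
Notation nu := (leb2 R).
Variables (phi : R -> R[i]) (M L : R).
Local Notation pr := (fun x => complex.Re (phi x)).
Local Notation pi := (fun x => complex.Im (phi x)).
Hypotheses (bump_re : is_bump M L pr) (bump_im : is_bump M L pi).
Variable f : measurableTypeR R -> R[i].
Hypothesis mf : cmeasurable f.
Local Notation fr := (fun x => complex.Re (f x)).
Local Notation fi := (fun x => complex.Im (f x)).
Local Notation N := (fun x => normc (f x)).
Hypothesis iN : forall c r : R,
  integ mu (fun x : measurableTypeR R => ind (`|c - x| < r) * N x).

Let integ_part (g : measurableTypeR R -> R) (psi : R -> R) w :
  measurable_fun setT g -> (forall x, `|g x| <= N x) -> is_bump M L psi ->
  0 < w.2 -> integ mu (fun x => g x * kap psi w x).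
Proof.
move=> mg gN [b1 b2 b3] t0; apply: (integ_mul_kap b1 b2 b3 mg _ t0).
apply: (@integ_dom _ _ _ mu _ (fun x => ind (`|w.1 - x| < w.2) * N x)) => //.
  apply: measurable_funM; last exact: measurableT_comp.
  exact: integ_measurable (integ_ball w.1 w.2).
by move=> x; rewrite normrM normr_id ger0_norm ?ind_ge0// ler_wpM2l ?ind_ge0.
Qed.

Lemma Re_Fphi w : 0 < w.2 ->
  complex.Re (Fphi phi f w) = kap_conv pr fr w + kap_conv pi fi w.
Proof.
move=> t0; have [m1 m2] := mf; rewrite /Fphi /cintegral /= /kap_conv.
rewrite -RintegralD//.
- apply: eq_Rintegral => x _; rewrite /kap.
  by case: (f x) => a b; case: (phi _) => c d /=; ring.
- by apply: integ_part => // x; exact: norm_Re_le.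
- by apply: integ_part => // x; exact: norm_Im_le.
Qed.

Lemma Im_Fphi w : 0 < w.2 ->
  complex.Im (Fphi phi f w) = kap_conv pr fi w - kap_conv pi fr w.
Proof.
move=> t0; have [m1 m2] := mf; rewrite /Fphi /cintegral /= /kap_conv.
rewrite -RintegralB//.
- apply: eq_Rintegral => x _; rewrite /kap.
  by case: (f x) => a b; case: (phi _) => c d /=; ring.
- by apply: integ_part => // x; exact: norm_Im_le.
- by apply: integ_part => // x; exact: norm_Re_le.
Qed.

Variables (A : set (plane R)) (lam : R).
Hypotheses (mA : measurable A) (lam0 : 0 <= lam)
  (good : forall w r, ~ A w -> 0 < w.2 -> w.2 <= r ->
        \int[mu]_x (ind (`|w.1 - x| < r) * N x) <= lam * r).

Let kap_conv_good (g : measurableTypeR R -> R) (psi : R -> R) w :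
  measurable_fun setT g -> (forall x, `|g x| <= N x) -> is_bump M L psi ->
  ~ A w -> 0 < w.2 -> `|kap_conv psi g w| <= M * lam.
Proof.
move=> mg gN [b1 b2 b3] nA t0; have M0 := sup_bound_ge0 b1.
have ig : integ mu (fun x => ind (`|w.1 - x| < w.2) * `|g x|).
  apply: (@integ_dom _ _ _ mu _ (fun x => ind (`|w.1 - x| < w.2) * N x)) => //.
    apply: measurable_funM; last exact: measurableT_comp.
    exact: integ_measurable (integ_ball w.1 w.2).
  by move=> x; rewrite normrM normr_id ger0_norm ?ind_ge0// ler_wpM2l ?ind_ge0.
apply: (le_trans (kap_conv_le b1 b2 b3 mg ig t0)).
rewrite (_ : M * lam = M / w.2 * (lam * w.2)); last by field; rewrite gt_eqF.
apply: ler_wpM2l; first by rewrite divr_ge0// ltW.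
apply: le_trans (good nA t0 (lexx _)).
apply: (le_Rintegral measurableT ig (iN _ _)) => x _.
by rewrite ler_wpM2l ?ind_ge0.
Qed.

(** The real and imaginary parts are each a sum or difference of two real convolutions, and each of
    these four is at most M lam by the mass bound at radius r = t. *)
Lemma sizeoo_off_level_set :
  (outsup (@sizeoo R) (halfplane R `\` A) (Fphi phi f) <= (4 * M * lam)%:E)%E.
Proof.
have [m1 m2] := mf; have M0 : 0 <= M by have [b1 _ _] := bump_re; exact: sup_bound_ge0 b1.
apply: ge_ereal_sup => _ [q _ <-]; apply: ge_ereal_sup => _ [w [t0 _ _] <-].
rewrite lee_fin indicE; case: (boolP (w \in halfplane R `\` A)) => [/set_mem[_ nA]|_]; last first.
  have -> : Fphi phi f w * (0%:R)%:C%C = 0 by exact: mulr0.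
  by rewrite /normc/= expr0n/= addr0 sqrtr0 mulr_ge0// mulr_ge0.
have -> : Fphi phi f w * (1%:R)%:C%C = Fphi phi f w by exact: mulr1.
have hr x := norm_Re_le (f x); have hi x := norm_Im_le (f x).
have q1 := kap_conv_good m1 hr bump_re nA t0.
have q2 := kap_conv_good m2 hi bump_im nA t0.
have q3 := kap_conv_good m2 hi bump_re nA t0.
have q4 := kap_conv_good m1 hr bump_im nA t0.
have hF : normc (Fphi phi f w) <= `|complex.Re (Fphi phi f w)| + `|complex.Im (Fphi phi f w)|.
  rewrite -[leLHS]ger0_norm ?normc_ge0// -ler_sqr ?nnegrE ?addr_ge0// real_normK ?num_real//.
  rewrite sqr_normc -[in leLHS]real_normK ?num_real// -[X in _ + X <= _]real_normK ?num_real//.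
  by rewrite sqrrD -addrA lerD2l lerDr mulrn_wge0// mulr_ge0.
apply: (le_trans hF); rewrite Re_Fphi// Im_Fphi//.
have := ler_normD (kap_conv pr fr w) (kap_conv pi fi w).
have := ler_normB (kap_conv pr fi w) (kap_conv pi fr w).
lra.
Qed.

Hypotheses (mean_re : forall w, 0 < w.2 -> \int[mu]_x kap pr w x = 0)
  (mean_im : forall w, 0 < w.2 -> \int[mu]_x kap pi w x = 0).

Local Notation K := (energy_const M L).

(** The squared modulus is at most twice the sum of the squares of the four real convolutions. On
    the tent minus [A] each of them has energy at most K lam^2 times the height of the tent, whence
    the factor 8. *)
Lemma size2_off_level_set :
  (outsup (@size2 R) (halfplane R `\` A) (Fphi phi f) <= (Num.sqrt (8 * K) * lam)%:E)%E.
Proof.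
have [m1 m2] := mf.
have [b1 b2 b3] := bump_re; have [c1 c2 c3] := bump_im.
have M0 := sup_bound_ge0 b1; have L0 := lipschitz_const_ge0 b2.
have K0 := energy_const_ge0 M0 L0.
have hr x := norm_Re_le (f x); have hi x := norm_Im_le (f x).
apply: ge_ereal_sup => _ [q q0 <-]; rewrite /halfplane/= in q0.
pose P := tent q `\` A.
have mP : measurable P by apply: measurableD => //; exact: measurable_tent.
have P_cone w : P w -> 0 < w.2 /\ `|q.1 - w.1| < q.2 - w.2 by move=> [[]].
have P_good (w : plane R) (r : R) : P w -> w.2 <= r ->
    \int[mu]_x (ind (`|w.1 - x| < r) * N x) <= lam * r.
  by move=> [[t0 _ _] nA]; exact: good.
have E (psi : R -> R) (g : measurableTypeR R -> R) : is_bump M L psi ->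
    (forall w, 0 < w.2 -> \int[mu]_x kap psi w x = 0) ->
    measurable_fun setT g -> (forall x, `|g x| <= N x) ->
    (\int[nu]_(w in P) (kap_conv psi g w ^+ 2 / w.2)%:E <= (K * lam ^+ 2 * q.2)%:E)%E.
  move=> [h1 h2 h3] hm mg gN.
  exact: (energy_off_level_set h1 h2 h3 hm mg (measurable_normc mf) gN iN q0 lam0 mP P_cone P_good).
pose U (psi : R -> R) (g : measurableTypeR R -> R) (w : plane R) : R := kap_conv psi g w ^+ 2 / w.2.
have U0 psi g w : P w -> (0 <= (U psi g w)%:E)%E.
  by move=> /P_cone[t0 _]; rewrite lee_fin divr_ge0 ?sqr_ge0// ltW.
have mU psi g : is_bump M L psi -> measurable_fun setT g ->
    measurable_fun P (EFin \o U psi g).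
  move=> [h1 h2 h3] mg; apply/measurable_EFinP; apply: measurable_funTS.
  apply: measurable_funM; last exact: measurable_funV.
  by apply: measurable_funX; exact: measurable_kap_conv h2 _ mg.
pose a1 := kap_conv pr fr; pose a2 := kap_conv pi fi; pose a3 := kap_conv pr fi; pose a4 := kap_conv pi fr.
pose W (w : plane R) : R := ((a1 w + a2 w) ^+ 2 + (a3 w - a4 w) ^+ 2) / w.2.
pose V (w : plane R) : R := U pr fr w + (U pi fi w + (U pr fi w + U pi fr w)).
have tP w : P w -> 0 < w.2 by move=> /P_cone[].
have I1 : (\int[nu]_(w in tent q)
    (normc (Fphi phi f w * (\1_(halfplane R `\` A) w)%:C%C) ^+ 2 / w.2)%:E =
    \int[nu]_(w in P) (W w)%:E)%E.
  rewrite integral_mkcond [RHS]integral_mkcond; apply: eq_integral => w _.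
  rewrite !patchE; case: ifPn => wq; last first.
    by rewrite ifF//; apply: contraNF wq => /set_mem[/mem_set].
  have t0 : 0 < w.2 by have [] := set_mem wq.
  case: ifPn => wP.
    have [_ nA] := set_mem wP.
    have -> : \1_(halfplane R `\` A) w = 1 :> R.
      by rewrite indicE mem_set.
    have -> : Fphi phi f w * 1%:C%C = Fphi phi f w by exact: mulr1.
    by rewrite sqr_normc Re_Fphi// Im_Fphi.
  have -> : \1_(halfplane R `\` A) w = 0 :> R.
    rewrite indicE memNset// => -[_ nA]; move/negP: wP; apply; apply: mem_set.
    by split => //; exact: set_mem wq.
  have -> : Fphi phi f w * 0%:C%C = 0 by exact: mulr0.
  by rewrite sqr_normc /= expr0n/= addr0 mul0r.
have mW : measurable_fun P (EFin \o W).
  have mQ psi g : is_bump M L psi -> measurable_fun setT g -> measurable_fun setT (kap_conv psi g).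
    by move=> [h1 h2 h3] mg; exact: measurable_kap_conv h2 _ mg.
  apply/measurable_EFinP; apply: measurable_funTS.
  apply: measurable_funM; last exact: measurable_funV.
  by apply: measurable_funD; apply: measurable_funX;
    [apply: measurable_funD|apply: measurable_funB]; exact: mQ.
have mV : measurable_fun P (EFin \o V).
  apply/measurable_EFinP; rewrite /V; do 3?[apply: measurable_funD];
    by apply/measurable_EFinP; exact: mU.
have V0 w : P w -> (0 <= (V w)%:E)%E.
  by move=> Pw; rewrite /V !EFinD !adde_ge0// U0.
have I2 : (\int[nu]_(w in P) (W w)%:E <= \int[nu]_(w in P) (2%:E * (V w)%:E))%E.
  apply: ge0_le_integral => //.
  - by move=> w /tP t0; rewrite lee_fin divr_ge0 ?addr_ge0 ?sqr_ge0// ltW.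
  - apply/measurable_EFinP; apply: measurable_funM => //; exact/measurable_EFinP.
  - move=> w /tP t0; rewrite -EFinM lee_fin /W /V /U -!mulrDl mulrA.
    rewrite ler_pM2r ?invr_gt0// -/(a1 w) -/(a2 w) -/(a3 w) -/(a4 w) -subr_ge0.
    rewrite (_ : _ - _ = (a1 w - a2 w) ^+ 2 + (a3 w + a4 w) ^+ 2); last by ring.
    by rewrite addr_ge0 ?sqr_ge0.
have I3 : (\int[nu]_(w in P) (V w)%:E <= (4 * (K * lam ^+ 2 * q.2))%:E)%E.
  have mU2 : measurable_fun P (fun w => (U pr fi w + U pi fr w)%:E).
    by apply/measurable_EFinP; apply: measurable_funD; apply/measurable_EFinP; exact: mU.
  have mU3 : measurable_fun P (fun w => (U pi fi w + (U pr fi w + U pi fr w))%:E).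
    apply/measurable_EFinP; apply: measurable_funD; last exact/measurable_EFinP.
    by apply/measurable_EFinP; exact: mU.
  have U2 w : P w -> (0 <= (U pr fi w + U pi fr w)%:E)%E.
    by move=> Pw; rewrite EFinD adde_ge0// U0.
  have U3 w : P w -> (0 <= (U pi fi w + (U pr fi w + U pi fr w))%:E)%E.
    by move=> Pw; rewrite EFinD adde_ge0 ?U0// U2.
  rewrite /V; under eq_integral do rewrite EFinD.
  rewrite ge0_integralD//; [|by move=> w; exact: U0|exact: mU].
  under [X in (_ + X <= _)%E]eq_integral do rewrite EFinD.
  rewrite ge0_integralD//; [|by move=> w; exact: U0|exact: mU].
  under [X in (_ + (_ + X) <= _)%E]eq_integral do rewrite EFinD.
  rewrite ge0_integralD//; [|by move=> w; exact: U0|exact: mU|by move=> w; exact: U0|exact: mU].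
  rewrite (_ : 4 * (K * lam ^+ 2 * q.2) = K * lam ^+ 2 * q.2 + (K * lam ^+ 2 * q.2 +
    (K * lam ^+ 2 * q.2 + K * lam ^+ 2 * q.2))); last by ring.
  rewrite !EFinD; do 3?[apply: leeD]; exact: E.
have I4 : (\int[nu]_(w in tent q)
    (normc (Fphi phi f w * (\1_(halfplane R `\` A) w)%:C%C) ^+ 2 / w.2)%:E <=
    (8 * K * lam ^+ 2 * q.2)%:E)%E.
  rewrite I1; apply: (le_trans I2); rewrite ge0_integralZl_EFin//.
  rewrite (_ : 8 * K * lam ^+ 2 * q.2 = 2 * (4 * (K * lam ^+ 2 * q.2))); last by ring.
  by rewrite EFinM lee_wpmul2l.
have J0 : (0 <= \int[nu]_(w in tent q)
    (normc (Fphi phi f w * (\1_(halfplane R `\` A) w)%:C%C) ^+ 2 / w.2)%:E)%E.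
  apply: integral_ge0 => w [t0 _ _].
  by rewrite lee_fin divr_ge0 ?sqr_ge0// ltW.
rewrite /size2.
have qi : (0 <= (q.2^-1)%:E :> \bar R)%E by rewrite lee_fin invr_ge0 ltW.
have -> : (Num.sqrt (8 * K) * lam)%:E = ((8 * K * lam ^+ 2)%:E `^ 2^-1)%E.
  rewrite poweR_EFin powR12_sqrt; last by rewrite mulr_ge0 ?sqr_ge0// mulr_ge0.
  by rewrite [in RHS]sqrtrM ?mulr_ge0 ?ler0n// sqrtr_sqr ger0_norm.
apply: gt0_ler_poweR; rewrite ?invr_ge0 ?in_itv/= ?leey ?andbT//.
- exact: mule_ge0.
- by rewrite lee_fin mulr_ge0 ?sqr_ge0// mulr_ge0.
- rewrite (_ : 8 * K * lam ^+ 2 = q.2^-1 * (8 * K * lam ^+ 2 * q.2)); last by field; rewrite gt_eqF.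
  by rewrite EFinM lee_wpmul2l.
Qed.

End complex_sizes.

(** * Strong type bounds *)

(* super_level S F is not shown to be measurable in its level. *)
Lemma ge0_le_integral_nonmeas d (T : measurableType d) (R : realType)
    (m : {measure set T -> \bar R}) (D : set T) (f g : T -> \bar R) :
  (forall x, D x -> 0 <= f x)%E -> (forall x, D x -> f x <= g x)%E ->
  (\int[m]_(x in D) f x <= \int[m]_(x in D) g x)%E.
Proof.
move=> f0 fg; have g0 x : D x -> (0 <= g x)%E.
  by move=> Dx; exact: le_trans (f0 _ Dx) (fg _ Dx).
rewrite !ge0_integralE//; apply: ereal_sup_le => _ [h hf <-]; exists h => // x.
apply: (le_trans (hf x)); rewrite !patchE.
by case: ifPn => // /set_mem; exact: fg.
Qed.

Lemma integral_powR_le (R : realType) (q a : R) : 0 < q ->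
  (\int[lebesgue_measure]_l (ind (0 < l < a) * l `^ (q - 1))%:E <= (a `^ q / q)%:E)%E.
Proof.
move=> q0.
(* For q < 1 the integrand is unbounded at 0; the primitive is used on [1 / (n + 1), a] and the
   bound passes to the limit by monotone convergence. *)
pose T n : set (measurableTypeR R) := [set` `[n.+1%:R^-1, a]].
have trunc n : (\int[lebesgue_measure]_(l in T n) (l `^ (q - 1))%:E <= (a `^ q / q)%:E)%E.
  have n0 : 0 < n.+1%:R^-1 :> R by rewrite invr_gt0.
  have [an|na] := leP a n.+1%:R^-1.
    rewrite (@integral_Sset1 _ _ _ a); last first.
      move=> x; rewrite /T/= in_itv/= => /andP[xn xa].
      by apply/eqP; rewrite eq_le xa (le_trans an).
    by rewrite lee_fin divr_ge0 ?powR_ge0// ltW.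
  have dF x : n.+1%:R^-1 <= x <= a ->
      is_derive x 1 (fun x : R => q^-1 * x `^ q) (x `^ (q - 1)).
    move=> /andP[nx _]; have x0 : 0 < x by apply: lt_le_trans nx.
    have := is_deriveZ q^-1 (is_derive1_powR q x0) => h.
    by apply: is_derive_eq; rewrite /GRing.scale/= mulrA mulVf ?mul1r// gt_eqF.
  have cf x : n.+1%:R^-1 <= x <= a -> {for x, continuous (fun x : R => x `^ (q - 1))}.
    move=> /andP[nx _]; have x0 : 0 < x by apply: lt_le_trans nx.
    apply/differentiable_continuous/derivable1_diffP.
    exact: @ex_derive _ _ _ _ _ _ _ (is_derive1_powR (q - 1) x0).
  rewrite /T (integral_FTC na dF cf).
  by rewrite lee_fin mulrC lerBlDr lerDl mulr_ge0 ?powR_ge0// invr_ge0 ltW.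
have TE : [set` `]0, a]] = \bigcup_n T n :> set R.
  apply/seteqP; split => [x /=|x [n _]]; rewrite /T/= !in_itv/= => /andP[x0 xa].
    exists (Num.truncn x^-1) => //; rewrite /T/= in_itv/= xa andbT.
    by rewrite -[leRHS]invrK lef_pV2 ?posrE ?invr_gt0//; apply: ltW; exact: truncnS_gt.
  by rewrite xa andbT (lt_le_trans _ x0)// invr_gt0.
have nd : nondecreasing_seq T.
  move=> m n mn; apply/subsetPset => x; rewrite /T/= !in_itv/= => /andP[h ->].
  by rewrite andbT; apply: le_trans h; rewrite lef_pV2 ?posrE// ler_nat.
have mT n : measurable (T n) by exact: measurable_itv.
have mf : measurable_fun setT (fun l : measurableTypeR R => l `^ (q - 1)) by exact: measurable_powR.
have cvI := @ge0_nondecreasing_set_cvg_integral _ (measurableTypeR R) _ T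
  (fun l : measurableTypeR R => (l `^ (q - 1))%:E) lebesgue_measure nd mT _ _.
apply: (@le_trans _ _ (\int[lebesgue_measure]_(l in `]0%R, a]) (l `^ (q - 1))%:E)%E).
  rewrite [leRHS]integral_mkcond; apply: ge0_le_integral_nonmeas => x _.
    by rewrite lee_fin mulr_ge0 ?ind_ge0 ?powR_ge0.
  rewrite patchE /ind; case: ifPn => [|/negP nx].
    by move=> _; rewrite lee_fin; case: (_ && _); rewrite ?mul1r// mul0r powR_ge0.
  case: andP => [[x0 xa]|_]; last by rewrite mul0r.
  by exfalso; apply: nx; apply: mem_set; rewrite /= in_itv/= x0 ltW.
rewrite TE; apply: (@cvge_to_le _ \oo _ _ _ _ _ (cvI _ _)).
- by move=> n; apply/measurable_EFinP; apply: measurable_funTS.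
- by move=> n x _; rewrite lee_fin powR_ge0.
- by near=> n; exact: trunc.
Unshelve. all: by end_near.
Qed.

Lemma super_level_ge0 (R : realType) (S : (plane R -> R[i]) -> plane R -> \bar R) F l :
  (0 <= super_level S F l)%E.
Proof.
apply: le_ereal_inf_tmp => _ [A _ <-]; apply: le_ereal_inf_tmp => _ [D [Dh _ _] <-].
by apply: esum_ge0 => q /Dh; rewrite /halfplane/= /sigma lee_fin => /ltW.
Qed.

Section strong_type.
Context {R : realType}.
Notation mu := (@lebesgue_measure R).
Variables (S : (plane R -> R[i]) -> plane R -> \bar R) (F : plane R -> R[i]).
Variables (N : measurableTypeR R -> R) (c p : R).
Hypotheses (c0 : 0 < c) (p1 : 1 < p) (N0 : forall x, 0 <= N x)
  (mN : measurable_fun setT N)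
  (weak : forall l, 0 < l ->
    (super_level S F (c * l) <= (12 / l)%:E * \int[mu]_x (tail N l x)%:E)%E).

(** The weak bound at l / c brings in the mass of [N] over l < 4 c N with the factor 12 c / l. After
    Tonelli the integral of l^(p - 2) up to 4 c N is (4 c N)^(p - 1) / (p - 1), which is finite
    because p > 1, and the remaining factor N completes the power N^p. *)
Lemma strong_type :
  (\int[mu]_(l in `]0%R, +oo[) ((p * l `^ (p - 1))%:E * super_level S F l) <=
   (12 * p * 4 `^ (p - 1) / (p - 1) * c `^ p)%:E * \int[mu]_x (N x `^ p)%:E)%E.
Proof.
have p0 : 0 < p by apply: lt_trans p1.
have q0 : 0 < p - 1 by rewrite subr_gt0.
pose H (z : measurableTypeR R * measurableTypeR R) : R :=
  12 * c * p * (ind (0 < z.1 < 4 * c * N z.2) * z.1 `^ (p - 1 - 1) * N z.2).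
have H0 z : 0 <= H z.
  by rewrite /H !mulr_ge0 ?ind_ge0 ?powR_ge0 ?ler0n// ltW.
have mN2 : measurable_fun setT (fun z : measurableTypeR R * measurableTypeR R => N z.2).
  exact: measurableT_comp.
have mH : measurable_fun setT H.
  apply: measurable_funM => //; apply: measurable_funM => //; apply: measurable_funM.
    apply: measurable_ind; apply: measurable_and; first exact: measurable_fun_ltr.
    by apply: measurable_fun_ltr => //; exact: measurable_funM.
  by apply: (measurableT_comp (measurable_powR _)).
have point l : 0 < l ->
    ((p * l `^ (p - 1))%:E * super_level S F l <= \int[mu]_x (H (l, x))%:E)%E.
  move=> l0.
  have lc0 : 0 < l / c by rewrite divr_gt0.
  have := weak lc0; rewrite (mulrC c) divfK ?gt_eqF// => h.
  have pl0 : 0 <= p * l `^ (p - 1) by rewrite mulr_ge0 ?powR_ge0// ltW.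
  apply: (le_trans (lee_wpmul2l _ h)); first by rewrite lee_fin.
  have t0 x : (0 <= (tail N (l / c) x)%:E)%E by rewrite lee_fin mulr_ge0 ?ind_ge0.
  have mt : measurable_fun setT (fun x => (tail N (l / c) x)%:E).
    apply/measurable_EFinP; apply: measurable_funM => //; apply: measurable_ind.
    exact: measurable_fun_ltr.
  have k0 : 0 <= p * l `^ (p - 1) * (12 / (l / c)).
    by rewrite mulr_ge0// divr_ge0 ?ler0n// ltW.
  rewrite muleA -EFinM -ge0_integralZl_EFin//.
  apply: ge0_le_integral_nonmeas => x _; first by rewrite -EFinM lee_fin mulr_ge0// -lee_fin.
  rewrite -EFinM lee_fin /H /tail /= l0 /=.
  have -> : (l / c / 4 < N x) = (l < 4 * c * N x).
    by rewrite !ltr_pdivrMr//; congr (_ < _); ring.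
  have -> : l `^ (p - 1) = l * l `^ (p - 1 - 1).
    by rewrite mulr_powRB1// ltW.
  rewrite le_eqVlt; apply/orP; left; apply/eqP; field.
  by rewrite !gt_eqF.
apply: (@le_trans _ _ (\int[mu]_l \int[mu]_x (H (l, x))%:E)%E).
  rewrite integral_mkcond; apply: ge0_le_integral_nonmeas => l _.
    rewrite patchE; case: ifPn => // _; apply: mule_ge0; last exact: super_level_ge0.
    by rewrite lee_fin mulr_ge0 ?powR_ge0// ltW.
  rewrite patchE; case: ifPn => [/set_mem/=|_].
    by rewrite in_itv/= andbT; exact: point.
  by apply: integral_ge0 => x _; rewrite lee_fin.
rewrite (fubini_tonelli (EFin \o H)); [|exact/measurable_EFinP|by move=> z; rewrite lee_fin].
have k0 : 0 <= 12 * p * 4 `^ (p - 1) / (p - 1) * c `^ p.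
  by rewrite !mulr_ge0 ?powR_ge0 ?ler0n ?invr_ge0// ltW.
rewrite -ge0_integralZl_EFin//; last first.
- by apply/measurable_EFinP; apply: (measurableT_comp (measurable_powR _)).
- by move=> x _; rewrite lee_fin powR_ge0.
apply: ge0_le_integral_nonmeas => x _.
  by apply: integral_ge0 => l _; rewrite lee_fin.
have k1 : 0 <= 12 * c * p * N x by rewrite !mulr_ge0 ?ler0n// ltW.
rewrite (eq_integral (fun l : measurableTypeR R => ((12 * c * p * N x)%:E *
    (ind (0 < l < 4 * c * N x) * l `^ (p - 1 - 1))%:E)%E)); last first.
  by move=> l _; rewrite -EFinM /H /=; congr _%:E; ring.
rewrite ge0_integralZl_EFin//; last first.
- apply/measurable_EFinP; apply: measurable_funM; last exact: measurable_powR.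
  apply: measurable_ind; apply: measurable_and; exact: measurable_fun_ltr.
- by move=> l _; rewrite lee_fin mulr_ge0 ?ind_ge0 ?powR_ge0.
apply: (le_trans (lee_wpmul2l _ (integral_powR_le _ q0))); first by rewrite lee_fin.
rewrite -!EFinM lee_fin.
have c4 : 0 <= 4 * c by rewrite mulr_ge0// ltW.
rewrite (powRM _ c4 (N0 x)) (powRM _ _ (ltW c0)) ?ler0n// -(mulr_powRB1 (ltW c0) p0) -(mulr_powRB1 (N0 x) p0).
rewrite le_eqVlt; apply/orP; left; apply/eqP; field.
by rewrite gt_eqF.
Qed.

End strong_type.

(** [Lnorm] at +oo is an essential supremum only when the whole space has positive measure;
    [in_Loo_bound] relies on this. *)
Lemma lebesgue_measureT_gt0 (R : realType) :
  (0 < @lebesgue_measure R [set: measurableTypeR R])%E.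
Proof.
apply: (@lt_le_trans _ _ (@lebesgue_measure R (ball 0 1))).
  by have /= -> := @lebesgue_measure_ball R 0 1 ler01; rewrite lte_fin mulr2n addr_gt0.
by apply: le_measure => //; apply: mem_set; [exact: measurable_ball|exact: measurableT].
Qed.

(** * L^p functions and the outer norms of an abstract size *)

Section in_Lp.
Context {R : realType}.
Notation mu := (@lebesgue_measure R).
Variable f : measurableTypeR R -> R[i].
Local Notation N := (fun x => normc (f x)).

Lemma integ_powR_in_Lp (p : R) : 0 < p -> in_Lp p%:E f ->
  integ mu (fun x => N x `^ p) /\
  (\int[mu]_x (N x `^ p)%:E = cLnorm p%:E f `^ p)%E.
Proof.
move=> p0 [mf fp].
have E : (\int[mu]_x `|(EFin \o (fun x => (N x `^ p)%R)) x| = cLnorm p%:E f `^ p)%E.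
  rewrite /cLnorm poweR_Lnorm ?gt_eqF//; apply: eq_integral => x _ /=.
  by rewrite !ger0_norm ?powR_ge0 ?normc_ge0.
split; last first.
  by rewrite -E; apply: eq_integral => x _ /=; rewrite ger0_norm ?powR_ge0.
apply/integrableP; split; last by rewrite E; exact: poweR_lty.
apply/measurable_EFinP; apply: (measurableT_comp (measurable_powR _)).
exact: measurable_normc.
Qed.

Lemma in_Loo_bound : in_Lp +oo%E f -> exists B : R, [/\ 0 <= B, cLnorm +oo%E f = B%:E &
  {ae mu, forall x, N x <= B}].
Proof.
move=> [mf foo]; have g0 : (0 <= cLnorm +oo%E f)%E by exact: Lnorm_ge0.
have E : cLnorm +oo%E f = (fine (cLnorm +oo%E f))%:E by rewrite fineK// ge0_fin_numE.
exists (fine (cLnorm +oo%E f)); split => //; first by rewrite -lee_fin -E.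
have h : cLnorm +oo%E f = ess_sup mu (abse \o (EFin \o N)).
  by rewrite /cLnorm Lnorm.unlock ifT// lebesgue_measureT_gt0.
have := ess_sup_ge mu (abse \o (EFin \o N)).
rewrite -h E; apply: filterS => x /=.
by rewrite lee_fin ger0_norm ?normc_ge0.
Qed.

Lemma integral_ball_ae_le (B c r : R) : cmeasurable f -> 0 <= B ->
  {ae mu, forall x, N x <= B} ->
  (\int[mu]_x (ind (`|c - x| < r) * N x)%:E <=
   \int[mu]_x (ind (`|c - x| < r) * B)%:E)%E.
Proof.
move=> mf B0 NB; have mi := integ_measurable (integ_ball c r).
apply: ae_ge0_le_integral => //.
- by move=> x _; rewrite lee_fin mulr_ge0 ?ind_ge0 ?normc_ge0.
- by apply/measurable_EFinP; apply: measurable_funM => //; exact: measurable_normc.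
- by move=> x _; rewrite lee_fin mulr_ge0 ?ind_ge0.
- by apply/measurable_EFinP; exact: measurable_funM.
- by apply: filterS NB => x h _; rewrite lee_fin ler_wpM2l ?ind_ge0.
Qed.

(** For finite p, N is at most N^p where N >= 1 and at most 1 elsewhere, so the ball indicator plus
    N^p dominates. For p = +oo the almost everywhere bound serves instead. *)
Lemma integ_ball_mul_in_Lp (p : \bar R) : (1 < p)%E -> in_Lp p f ->
  forall c r : R, integ mu (fun x => ind (`|c - x| < r) * N x).
Proof.
move=> p1 fp c r; have mf := fp.1; have mN := measurable_normc mf.
have mB : measurable_fun setT (fun x : measurableTypeR R => ind (`|c - x| < r) * N x).
  by apply: measurable_funM => //; exact: integ_measurable (integ_ball c r).
case: p p1 fp => [p||//].
  rewrite lte_fin => p1 fp; have p0 : 0 < p by apply: lt_trans p1.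
  have iD := integD (integ_ball c r) (integ_powR_in_Lp p0 fp).1.
  apply: (integ_dom mB iD) => x /=.
  rewrite ger0_norm ?mulr_ge0 ?ind_ge0 ?normc_ge0//.
  have [h|h] := leP 1 (N x).
    apply: (@le_trans _ _ (N x)); first by rewrite ler_piMl ?ind_le1 ?normc_ge0.
    by rewrite (le_trans (le1r_powR h (ltW p1)))// lerDr ind_ge0.
  apply: (@le_trans _ _ (ind (`|c - x| < r))).
    by rewrite ler_piMr ?ind_ge0// ltW.
  by rewrite lerDl powR_ge0.
move=> _ /in_Loo_bound[B [B0 _ NB]].
have iB := integZr B (integ_ball c r).
apply/integrableP; split; first exact/measurable_EFinP.
apply: le_lt_trans (integrable_lty measurableT iB).
apply: le_trans (integral_ball_ae_le c r mf B0 NB).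
by under eq_integral => x _ do rewrite /= (ger0_norm (mulr_ge0 (ind_ge0 _ _) (normc_ge0 _))).
Qed.

(** Where N > l / 4 one has N <= (l / 4)^(1 - p) N^p, because p > 1. *)
Lemma integ_tail_in_Lp (p l : R) : 1 < p -> 0 < l -> in_Lp p%:E f ->
  integ mu (tail N l).
Proof.
move=> p1 l0 fp; have mN := measurable_normc fp.1.
have p0 : 0 < p by apply: lt_trans p1.
apply: (integ_dom _ (integZl ((l / 4) `^ (1 - p)) (integ_powR_in_Lp p0 fp).1)).
  by apply: measurable_funM => //; apply: measurable_ind; exact: measurable_fun_ltr.
move=> x; rewrite /tail /ind; have l4 : 0 < l / 4 by rewrite divr_gt0.
case: ltP => h; last by rewrite mul0r normr0 mulr_ge0 ?powR_ge0.
rewrite mul1r ger0_norm ?normc_ge0// -(mulr_powRB1 (normc_ge0 _) p0).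
rewrite mulrCA ler_peMr ?normc_ge0// -(opprB p) powRN mulrC.
rewrite ler_pdivlMr ?powR_gt0// mul1r.
by apply: ge0_ler_powR; rewrite ?nnegrE ?normc_ge0 ?subr_ge0 ?ltW.
Qed.

Variables (S : (plane R -> R[i]) -> plane R -> \bar R) (F : plane R -> R[i]) (k : R).
Hypotheses (k0 : 0 < k)
  (S_ext : forall F G q, (forall w : plane R, 0 < w.2 -> F w = G w) -> S F q = S G q)
  (S_good : forall (A : set (plane R)) lam, measurable A -> 0 <= lam ->
    (forall (w : plane R) r, ~ A w -> 0 < w.2 -> w.2 <= r ->
       \int[mu]_x (ind (`|w.1 - x| < r) * N x) <= lam * r) ->
    (outsup S (halfplane R `\` A) F <= (k * lam)%:E)%E).

Lemma outer_Lnorm_le (p : R) : 1 < p -> in_Lp p%:E f ->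
  (outer_Lnorm S p%:E F <=
   (((12 * p * 4 `^ (p - 1) / (p - 1)) `^ p^-1 * k)%:E * cLnorm p%:E f))%E.
Proof.
move=> p1 fp; have p0 : 0 < p by apply: lt_trans p1.
have mf := fp.1; have mN := measurable_normc mf.
have p1E : (1 < p%:E)%E by rewrite lte_fin.
have N0 x : 0 <= N x by exact: normc_ge0.
have weak l : 0 < l ->
    (super_level S F (k * l) <= (12 / l)%:E * \int[mu]_x (tail N l x)%:E)%E.
  move=> l0; have it := integ_tail_in_Lp p1 l0 fp.
  have [A [mA Ah Amu Agood]] := level_set_cover N0 l0 (integ_ball_mul_in_Lp p1E fp) it.
  apply: (@le_trans _ _ (outer_mu A)).
    by apply: ereal_inf_lbound; exists A => //; split => //; apply: S_good => //; exact: ltW.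
  by apply: (le_trans Amu); rewrite EFinM /Rintegral fineK//; exact: integrable_fin_num.
have h := strong_type k0 p1 N0 mN weak.
have [_ E] := integ_powR_in_Lp p0 fp.
rewrite /outer_Lnorm; set D := 12 * p * _ / _ in h *.
have D0 : 0 <= D by rewrite /D divr_ge0 ?subr_ge0 ?(ltW p1)// mulr_ge0 ?powR_ge0// mulr_ge0 ?ler0n// ltW.
have L0 : (0 <= cLnorm p%:E f)%E by exact: Lnorm_ge0.
have -> : ((D `^ p^-1 * k)%:E * cLnorm p%:E f =
    ((D * k `^ p)%:E * \int[mu]_x (N x `^ p)%:E) `^ p^-1)%E.
  rewrite E poweRM ?poweR_ge0 ?lee_fin ?(mulr_ge0 D0 (powR_ge0 _ _))//.
  rewrite poweR_EFin powRM ?powR_ge0// -powRrM -poweRrM divff ?gt_eqF// powRr1 ?(ltW k0)//.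
  by rewrite poweRe1.
apply: gt0_ler_poweR h; rewrite ?invr_ge0 ?(ltW p0)// in_itv/= leey andbT.
  apply: integral_ge0 => l _; apply: mule_ge0; last exact: super_level_ge0.
  by rewrite lee_fin mulr_ge0 ?powR_ge0// ltW.
by rewrite E mule_ge0 ?poweR_ge0// lee_fin mulr_ge0 ?powR_ge0.
Qed.

(** The 2 is the ratio of the length of a ball to its radius. With the empty exceptional set
    [outsup] still multiplies [F] by the indicator of the half plane; [S_ext] removes it. *)
Lemma outer_Loo_le : in_Lp +oo%E f ->
  (outer_Lnorm S +oo%E F <= (k * 2)%:E * cLnorm +oo%E f)%E.
Proof.
move=> fp; have mf := fp.1; have [B [B0 -> NB]] := in_Loo_bound fp.
have B2 : 0 <= 2 * B by rewrite mulr_ge0 ?ler0n.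
rewrite -EFinM -mulrA; apply: le_trans (S_good (@measurable0 _ _) B2 _); last first.
  move=> w r _ t0 tr; have r0 : 0 <= r by rewrite (le_trans _ tr)// ltW.
  have iL := integ_ball_mul_in_Lp (ltry 1) fp w.1 r.
  have iR := integZr B (integ_ball w.1 r).
  have := integral_ball_ae_le w.1 r mf B0 NB.
  have e (g : measurableTypeR R -> R) : integ mu g ->
      (\int[mu]_x (g x)%:E = (\int[mu]_x g x)%:E)%E.
    by move=> ig; rewrite /Rintegral fineK//; exact: integrable_fin_num ig.
  rewrite (e _ iL) (e _ iR) lee_fin (RintegralZr _ measurableT (integ_ball w.1 r)).
  by rewrite Rintegral_ball// mulrAC.
apply: ge_ereal_sup => _ [q q0 <-].
apply: ereal_sup_ubound; exists q => //; apply: S_ext => w t0.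
by rewrite indicE mem_set ?setD0//; exact: mulr1.
Qed.

End in_Lp.

Lemma eq_sizeoo (R : realType) (F G : plane R -> R[i]) q :
  (forall w : plane R, 0 < w.2 -> F w = G w) -> sizeoo F q = sizeoo G q.
Proof.
move=> FG; rewrite /sizeoo; congr ereal_sup.
by apply/seteqP; split => _ [w [t0 h1 h2] <-]; exists w; rewrite ?FG.
Qed.

Lemma eq_size2 (R : realType) (F G : plane R -> R[i]) q :
  (forall w : plane R, 0 < w.2 -> F w = G w) -> size2 F q = size2 G q.
Proof.
move=> FG; rewrite /size2; congr ((_ * _) `^ _)%E.
by apply: eq_integral => w /set_mem[t0 _ _]; rewrite FG.
Qed.

Theorem theorem4p1 (R : realType) (phi : R -> R[i])
    (phi_smooth : csmooth phi)
    (phi_supp : [set x | phi x != 0] `<=` `[-1, 1])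
    (p : \bar R) (p_gt1 : (1 < p)%E) :
  exists C : R,
    (forall f : R -> R[i], in_Lp p f ->
       (outer_Lnorm (@sizeoo R) p (Fphi phi f) <= C%:E * cLnorm p f)%E) /\
    (cintegral phi = 0 ->
     forall f : R -> R[i], in_Lp p f ->
       (outer_Lnorm (@size2 R) p (Fphi phi f) <= C%:E * cLnorm p f)%E).
Proof.
have [M [L [bre bim]]] := csmooth_bump phi_smooth phi_supp.
have M0 : 0 <= M by have [h _ _] := bre; apply: le_trans (h 0).
pose s := Num.sqrt (8 * energy_const M L).
have s0 : 0 <= s by exact: sqrtr_ge0.
have M4 : 0 <= 4 * M by rewrite mulr_ge0 ?ler0n.
(* One constant dominating those of both sizes; the summand 1 makes it positive, as the division of
   the level by it in [strong_type] requires. *)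
pose k := 4 * M + s + 1.
have k0 : 0 < k by rewrite ltr_wpDl// addr_ge0.
have goodoo (f : R -> R[i]) : in_Lp p f -> forall (A : set (plane R)) lam, measurable A -> 0 <= lam ->
    (forall (w : plane R) r, ~ A w -> 0 < w.2 -> w.2 <= r ->
       \int[lebesgue_measure]_x (ind (`|w.1 - x| < r) * normc (f x)) <= lam * r) ->
    (outsup (@sizeoo R) (halfplane R `\` A) (Fphi phi f) <= (k * lam)%:E)%E.
  move=> fp A lam mA lam0 good.
  apply: (le_trans (sizeoo_off_level_set bre bim fp.1 (integ_ball_mul_in_Lp p_gt1 fp) lam0 good)).
  by rewrite lee_fin ler_wpM2r// /k -addrA lerDl addr_ge0.
have good2 (f : R -> R[i]) : cintegral phi = 0 -> in_Lp p f -> forall (A : set (plane R)) lam, measurable A -> 0 <= lam ->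
    (forall (w : plane R) r, ~ A w -> 0 < w.2 -> w.2 <= r ->
       \int[lebesgue_measure]_x (ind (`|w.1 - x| < r) * normc (f x)) <= lam * r) ->
    (outsup (@size2 R) (halfplane R `\` A) (Fphi phi f) <= (k * lam)%:E)%E.
  move=> phi0 fp A lam mA lam0 good.
  have [mre mim] := csmooth_kap_mean phi_smooth phi_supp phi0.
  apply: (le_trans (size2_off_level_set bre bim fp.1 (integ_ball_mul_in_Lp p_gt1 fp) mA lam0 good mre mim)).
  by rewrite lee_fin ler_wpM2r// /k addrAC lerDr addr_ge0.
case: p p_gt1 goodoo good2 => [p p1|_|//] goodoo good2.
- exists ((12 * p * 4 `^ (p - 1) / (p - 1)) `^ p^-1 * k).
  split=> [f fp|phi0 f fp]; apply: outer_Lnorm_le => //.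
  + exact: goodoo.
  + exact: good2.
- exists (k * 2); split=> [f fp|phi0 f fp]; apply: outer_Loo_le => //.
  + exact: eq_sizeoo.
  + exact: goodoo.
  + exact: eq_size2.
  + exact: good2.
Qed.
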